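(* Let $0<p<1$ and $\alpha>0$. There is a constant $C$ (independent of $f$ and $n$) such that for every $f$ with $f, f^{(\alpha)}\in L_1(\mathbb{T})$ and every $n\in\mathbb{N}$, $$E_n(f)_p\leq\frac{C}{n^\alpha}\left(E_n(f^{(\alpha)})_p+\left(\frac1{n^{1-p}}\sum_{\nu=n+1}^\infty\frac{E_\nu(f^{(\alpha)})_p^p}{\nu^{p}}\right)^{1/p}\right).$$
   Context: $\mathbb{T}\cong[0,2\pi)$; $L_p(\mathbb{T})$, $0<p<\infty$, is the space of measurable complex $2\pi$-periodic functions with $\|f\|_p=\left(\frac1{2\pi}\int_{\mathbb{T}}|f(x)|^p\,dx\right)^{1/p}<\infty$. $\mathbb{N}$ is the set of positive integers. $\mathcal{T}_n$ is the set of trigonometric polynomials of order at most $n$, and $E_n(f)_p=\inf_{T\in\mathcal{T}_n}\|f-T\|_p$. For $f\in L_1(\mathbb{T})$ and $\alpha\in\mathbb{R}$ the Weyl derivative $f^{(\alpha)}$ (fractional integral if $\alpha<0$) is given by $f^{(\alpha)}(x)\sim\sum_{k\in\mathbb{Z}\setminus\{0\}}(ik)^\alpha\widehat{f}_k e^{ikx}$, where $(ik)^\alpha=|k|^\alpha e^{i\frac{\alpha\pi}{2}\operatorname{sign}k}$ and $\widehat f_k=\frac1{2\pi}\int_0^{2\pi}f(x)e^{-ikx}dx$; $f^{(\alpha)}\in L_1(\mathbb{T})$ means that this series is the Fourier series of a function in $L_1(\mathbb{T})$, denoted $f^{(\alpha)}$. *)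

(* Defs.v *)
From mathcomp Require Import all_boot all_order all_algebra.
From mathcomp Require Import complex.
From mathcomp Require Import all_classical all_reals all_analysis.

Set Implicit Arguments.
Unset Strict Implicit.
Unset Printing Implicit Defensive.

Import Order.TTheory GRing.Theory Num.Theory.

Local Open Scope classical_set_scope.
Local Open Scope ring_scope.

(* Functions on the torus are represented by 2pi-periodic functions R -> R[i],
   integrated over the fundamental domain [0, 2pi[. *)

Definition periodic2pi (R : realType) (f : R -> R[i]) : Prop :=
  forall x, f (x + 2 * pi) = f x.

(* R[i] carries no sigma-algebra in the library; for the Borel one,
   measurability is componentwise. *)
Definition cmeasurable (R : realType) (f : R -> R[i]) : Prop :=
  measurable_fun setT (fun x => complex.Re (f x)) /\
  measurable_fun setT (fun x => complex.Im (f x)).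

(* Normc.normc is the modulus with values in R; `|z| on R[i] lives in R[i]. *)
Definition Lp_norm (R : realType) (p : R) (f : R -> R[i]) : \bar R :=
  (((2 * pi)^-1)%:E *
   \int[lebesgue_measure]_(x in `[0%R, (2 * pi)%R[) (Normc.normc (f x) `^ p)%:E)
    `^ p^-1%R.

Definition in_Lp (R : realType) (p : R) (f : R -> R[i]) : Prop :=
  [/\ periodic2pi f, cmeasurable f & (Lp_norm p f < +oo)%E].

Definition expi (R : realType) (t : R) : R[i] := Complex (cos t) (sin t).

(* The summation index j < 2n+1 stands for the frequency k = j - n, which
   ranges over -n, ..., n. *)
Definition trigpoly (R : realType) (n : nat) : set (R -> R[i]) :=
  [set T | exists c : int -> R[i], forall x,
    T x = \sum_(j < n.*2.+1)
            c (j%:Z - n%:Z) * expi ((j%:Z - n%:Z)%:~R * x)].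

Definition best_approx (R : realType) (n : nat) (p : R) (f : R -> R[i]) :
    \bar R :=
  ereal_inf [set Lp_norm p (fun x => f x - T x) | T in trigpoly n].

Definition fourier_coef (R : realType) (f : R -> R[i]) (k : int) : R[i] :=
  let F x := f x * expi (- (k%:~R * x)) in
  Complex
    ((2 * pi)^-1 *
      Rintegral lebesgue_measure `[0, 2 * pi[ (fun x => complex.Re (F x)))
    ((2 * pi)^-1 *
      Rintegral lebesgue_measure `[0, 2 * pi[ (fun x => complex.Im (F x))).

(* (ik)^alpha, meaningful for k != 0 *)
Definition ik_pow (R : realType) (alpha : R) (k : int) : R[i] :=
  Complex (`|k|%:~R `^ alpha) 0 * expi (alpha * pi / 2 * (sgz k)%:~R).

(* g is (a representative of) f^(alpha), which is determined up to equality
   almost everywhere. The Weyl series has no constant term. *)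
Definition weyl_derivative (R : realType) (alpha : R) (f g : R -> R[i]) :
    Prop :=
  in_Lp 1 g /\
  forall k : int, fourier_coef g k =
    if k == 0 then 0 else ik_pow alpha k * fourier_coef f k.

(* Main.v *)
(* Write N_p(f) for the integral of |f|^p over a period, which is subadditive as
   p < 1, and I^alpha for the inverse of the Weyl derivative, so that f is
   I^alpha g up to a constant.  Let T_k be a nearly best approximation of g in
   L_p of order 2^k n.
   If P is a polynomial of order 2^j n, then I^alpha P differs from a
   polynomial of order n by the convolution of P with a dyadic sum of smoothly
   truncated kernels sum_k (ik)^(-alpha) e^(ikx).  Summation by parts bounds
   N_p of these kernels, and Nikolskii's inequality
   N_1(T)^p <= C N^(1-p) N_p(T) for T of order N replaces Young's inequality,
   which fails for p < 1: N_p(P * K) <= C N^(1-p) N_p(P) N_p(K).  Hence I^alpha P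
   is within C n^(-alpha p) 2^(j(1-p)) N_p(P) of the polynomials of order n.
   Applied to T_{k+1} - T_k this gives the sum of the
   2^(k(1-p)) E_{2^k n}(g)_p^p, which is the series of the theorem after dyadic
   condensation.
   The telescoping sum of the T_{k+1} - T_k exhausts g, because Nikolskii's
   inequality turns the convergence of that sum into T_k -> g in L_1, and
   I^alpha is bounded on L_1 modulo polynomials of order n. *)

Require Import Defs.
From mathcomp Require Import all_boot all_order all_algebra.
From mathcomp Require Import complex ring lra zify.
From mathcomp Require Import all_classical all_reals all_analysis measurable_realfun.

Import Order.TTheory GRing.Theory Num.Theory.
Import numFieldNormedType.Exports.

Local Open Scope classical_set_scope.
Local Open Scope ring_scope.

Set Implicit Arguments.
Unset Strict Implicit.
Unset Printing Implicit Defensive.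

(** * Integrals over a period *)

Section period_integral.
Context {R : realType}.
Implicit Types (F G : R -> R) (a b s : R).
Local Notation mu := (@lebesgue_measure R).

(** For [p < 1], convergence in L_p gives no control of Fourier coefficients, while [f] and [g] are
    related only through their coefficients. Hence two estimates of different nature: one in L_p for
    polynomials, with a constant uniform in [n], and a crude one in L_1 for the remainder [g - T m].
    The constant of the second may depend on [n], because it multiplies a quantity that is made
    small afterwards. The phase of (ik)^(-alpha) jumps at k = 0, so kernels are split into positive
    and negative frequencies. On each half the phase is constant and the remaining coefficients are
    real; the two real-coefficient sums are complex conjugates. Kernels are bounded without
    splitting the circle: once [r * p >= 2] differences are available, the p-th power of the modulus
    lies below a multiple of the squared modulus of one explicit geometric sum, integrated by
    orthogonality. Density of trigonometric polynomials in L_1 is needed both for the remainder and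
    to identify the limit of the [T m]. It comes from polynomials converging to the sign of a
    trigonometric polynomial with two sign changes per period. *)

Definition nper F : \bar R := (\int[mu]_(x in `[0%R, (2 * pi)%R[) (F x)%:E)%E.

Lemma twopi_gt0 : 0 < 2 * pi :> R.
Proof. by rewrite mulr_gt0 ?pi_gt0. Qed.

(** Lebesgue measure is determined by its values on half-open intervals, and these are unchanged by
    a translation. *)
Lemma lebesgue_measure_shift s (A : set R) : measurable A ->
  pushforward mu ((fun x => x + s) : _ -> measurableTypeR R) A = mu A.
Proof.
move=> mA.
have ms : @measurable_fun _ _ (measurableTypeR R) (measurableTypeR R) setT
    (fun x => x + s).
  by apply: (@measurable_funD _ (measurableTypeR R)) => //; exact: measurable_cst.
apply/esym.
have H X : ocitv X -> lebesgue_measure X = pushforward lebesgue_measure ((fun x => x + s) : _ -> measurableTypeR R) X.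
  move=> [[a b]] _ <-; rewrite /pushforward /=.
  have -> : (fun x : R => x + s) @^-1` `]a, b] = `](a - s), (b - s)]%classic.
    by apply/seteqP; split => x /=; rewrite !in_itv/= ltrBlDr lerBrDr.
  rewrite !lebesgue_measure_itv/= !lte_fin ltrD2r; case: ifP => // _.
  by rewrite -!EFinB; congr EFin; ring.
have := lebesgue_measure_unique H.
by move=> /(_ ms A mA).
Qed.

Lemma ge0_integral_shift F s a b : measurable_fun setT F ->
  (forall x, 0 <= F x) ->
  (\int[mu]_(x in `[(a + s)%R, (b + s)%R[) (F x)%:E =
   \int[mu]_(x in `[a, b[) (F (x + s)%R)%:E)%E.
Proof.
move=> mF F0.
have ms : measurable_fun setT ((fun x : R => x + s) : _ -> measurableTypeR R).
  by apply: measurable_funD => //; exact: measurable_cst.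
have mE : measurable_fun `[(a + s)%R, (b + s)%R[ (EFin \o F).
  by apply/measurable_EFinP; exact: measurable_funTS.
transitivity (\int[pushforward mu ((fun x => x + s)%R : _ -> measurableTypeR R)]_(x in `[(a + s)%R, (b + s)%R[) (F x)%:E)%E.
  apply: eq_measure_integral => //= A mA _.
  exact/esym/lebesgue_measure_shift.
rewrite ge0_integral_pushforward//=; last by move=> *; rewrite lee_fin.
congr (integral _ _ _).
by apply/seteqP; split => x /=; rewrite !in_itv/= lerD2r ltrD2r.
Qed.

(** Periodicity reduces [s] modulo [2 * pi]. The shifted period is then cut at [2 * pi], and its
    second piece is moved back by one period. Non-negativity replaces integrability. *)
Lemma nper_shift F s : measurable_fun setT F -> (forall x, 0 <= F x) ->
  (forall x, F (x + 2 * pi) = F x) -> nper (fun x => F (x + s)) = nper F.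
Proof.
move=> mF F0 perF.
have perFZ (k : int) x : F (x + k%:~R * (2 * pi)) = F x.
  have perFn (n : nat) y : F (y + n%:R * (2 * pi)) = F y.
    elim: n y => [|n IH] y; first by rewrite mul0r addr0.
    by rewrite -natr1 mulrDl mul1r addrA perF IH.
  case: k => n; first exact: perFn.
  by rewrite NegzE mulrNz mulNr -[in RHS](subrK (n.+1%:R * (2 * pi)) x) perFn.
wlog : s / 0 <= s < 2 * pi.
  move=> H; set k := Num.floor (s / (2 * pi)).
  have : 0 <= s - k%:~R * (2 * pi) < 2 * pi.
    have h := Num.Theory.floor_itv (s / (2 * pi)).
    move: h; rewrite -/k ler_pdivlMr ?twopi_gt0// ltr_pdivrMr ?twopi_gt0//.
    by rewrite intrD; set t := 2 * pi; lra.
  move/H => <-; rewrite /nper; apply: eq_integral => x _.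
  by rewrite -[in LHS](perFZ (- k)) mulrNz mulNr addrA.
move=> /andP[s0 s1]; rewrite /nper.
have mFD D : measurable_fun D (EFin \o F).
  by apply/measurable_EFinP; exact: measurable_funTS.
have := @ge0_integral_shift F s 0 (2 * pi) mF F0.
rewrite add0r => <-.
have mI (a b : R) : measurable (`[a, b[%classic : set R) by [].
have cat (a b c : R) : a <= b -> b <= c ->
  (\int[mu]_(x in `[a, c[) (F x)%:E = \int[mu]_(x in `[a, b[) (F x)%:E +
    \int[mu]_(x in `[b, c[) (F x)%:E)%E.
  move=> ab bc.
  rewrite (_ : `[a, c[%classic = `[a, b[%classic `|` `[b, c[%classic).
    rewrite ge0_integral_setU//.
    - exact: mFD.
    - by move=> x _; rewrite lee_fin.
    - rewrite disj_set2E; apply/eqP; rewrite -subset0 => x [] /=.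
      by rewrite !in_itv/= => /andP[_ h] /andP[]; rewrite leNgt h.
  apply/seteqP; split => x /=; rewrite !in_itv/=.
    by move=> /andP[h1 h2]; case: (ltP x b) => h; [left|right]; apply/andP.
  by case=> /andP[h1 h2]; apply/andP; split => //;
    [exact: lt_le_trans h2 bc|exact: le_trans ab h1].
rewrite (@cat s (2 * pi) (2 * pi + s)) ?(ltW s1) ?lerDl//.
rewrite (@cat 0 s (2 * pi)) ?(ltW s1)// addeC; congr (_ + _)%E.
rewrite -{1}[2 * pi]add0r addrC -[X in `[_, X[](_ : s + 2 * pi = _) ?(addrC s)//.
rewrite -{2}[2 * pi]addr0 [in X in `[X, _[]addr0.
have := @ge0_integral_shift F (2 * pi) 0 s mF F0.
rewrite add0r addrC addr0 => ->.
by apply: eq_integral => x _; rewrite perF.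
Qed.

End period_integral.

Local Notation nc := (Normc.normc).

(** * Modulus and exponentials *)

Section complex_facts.
Context {R : realType}.
Implicit Types (x y t p : R) (z w : R[i]) (k l : int).

Lemma nc_ge0 z : 0 <= nc z.
Proof. by case: z => a b /=; exact: sqrtr_ge0. Qed.

Lemma nc0 : nc (0 : R[i]) = 0.
Proof. exact: Normc.normc0. Qed.

Lemma ncM z w : nc (z * w) = nc z * nc w.
Proof. exact: Normc.normcM. Qed.

Lemma ncD z w : nc (z + w) <= nc z + nc w.
Proof. exact: le_normcD. Qed.

Lemma ncN z : nc (- z) = nc z.
Proof. exact: (@normcN R). Qed.

Lemma ncB z w : nc (z - w) <= nc z + nc w.
Proof. by rewrite (le_trans (ncD _ _))// ncN. Qed.

Lemma nc_real x : nc x%:C%C = `|x|.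
Proof. by rewrite /= expr0n/= addr0 sqrtr_sqr. Qed.

Lemma nc_sum (I : Type) (s : seq I) (P : pred I) (F : I -> R[i]) :
  nc (\sum_(i <- s | P i) F i) <= \sum_(i <- s | P i) nc (F i).
Proof.
elim/big_rec2: _ => [|i y1 y2 _ le12]; first by rewrite nc0.
by rewrite (le_trans (ncD _ _))// lerD2l.
Qed.

Lemma nc_le_ReIm z : nc z <= `|complex.Re z| + `|complex.Im z|.
Proof.
case: z => a b /=.
rewrite -[leRHS]ger0_norm ?addr_ge0// -sqrtr_sqr ler_wsqrtr//.
have h : 0 <= `|a| * `|b| by rewrite mulr_ge0.
by rewrite sqrrD !real_normK ?num_real//; lra.
Qed.

Lemma Re_le_nc z : `|complex.Re z| <= nc z.
Proof. by case: z => a b /=; rewrite -sqrtr_sqr ler_wsqrtr// lerDl sqr_ge0. Qed.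

Lemma Im_le_nc z : `|complex.Im z| <= nc z.
Proof. by case: z => a b /=; rewrite -sqrtr_sqr ler_wsqrtr// lerDr sqr_ge0. Qed.

(** A ratio in [0, 1] is at most its p-th power; apply this to [x / (x + y)] and [y / (x + y)],
    whose sum is 1. *)
Lemma powR_subadd x y p : 0 <= x -> 0 <= y -> 0 < p -> p <= 1 ->
  (x + y) `^ p <= x `^ p + y `^ p.
Proof.
move=> x0 y0 p0 p1.
have [xy0|xyN0] := eqVneq (x + y) 0.
  by rewrite xy0 powR0 ?gt_eqF// addr_ge0 ?powR_ge0.
have s0 : 0 < x + y by rewrite lt_def xyN0 addr_ge0.
have H u : 0 <= u -> u <= x + y -> (u / (x + y)) * (x + y) `^ p <= u `^ p.
  move=> u0 us; have [->|uN0] := eqVneq u 0; first by rewrite !mul0r powR_ge0.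
  have ugt0 : 0 < u by rewrite lt_def uN0.
  have -> : u `^ p = (u / (x + y)) `^ p * (x + y) `^ p.
    by rewrite -powRM ?divr_ge0 ?ltW// divfK.
  rewrite ler_wpM2r ?powR_ge0// ger1_powR// divr_gt0//=.
  by rewrite ler_pdivrMr// mul1r.
apply: le_trans (lerD (H x x0 _) (H y y0 _)); rewrite ?lerDl ?lerDr//.
by rewrite -mulrDl -mulrDl divff// mul1r.
Qed.

Lemma ncD_powR z w p : 0 < p -> p <= 1 ->
  nc (z + w) `^ p <= nc z `^ p + nc w `^ p.
Proof.
move=> p0 p1; apply: (@le_trans _ _ ((nc z + nc w) `^ p)).
  by rewrite ge0_ler_powR ?nnegrE ?nc_ge0 ?addr_ge0 ?nc_ge0 ?(ltW p0)// ncD.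
by rewrite powR_subadd ?nc_ge0.
Qed.

Lemma expiD x y : expi (x + y) = expi x * expi y :> R[i].
Proof. by rewrite /expi cosD sinD; simpc; congr Complex; rewrite addrC. Qed.

Lemma expi0 : expi 0 = 1 :> R[i].
Proof. by rewrite /expi cos0 sin0. Qed.

Lemma expiNM x : expi (- x) * expi x = 1.
Proof. by rewrite -expiD addNr expi0. Qed.

Lemma nc_expi x : nc (expi x) = 1.
Proof. by rewrite /expi/= cos2Dsin2 sqrtr1. Qed.

Lemma expi_period k x : expi (k%:~R * (x + 2 * pi)) = expi (k%:~R * x).
Proof.
rewrite mulrDr expiD; suff -> : expi (k%:~R * (2 * pi)) = 1 :> R[i].
  by rewrite mulr1.
have H (n : nat) : expi (n%:R * (2 * pi)) = 1 :> R[i].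
  elim: n => [|n IH]; first by rewrite mul0r expi0.
  rewrite -natr1 mulrDl expiD IH mul1r mul1r /expi.
  by rewrite mulr_natl cos2pi sin2pi.
case: k => n; first exact: H.
have := expiNM (n.+1%:R * (2 * pi) : R).
by rewrite H mulr1 NegzE mulrNz mulNr.
Qed.

Lemma expi_add_int k l x :
  expi ((k + l)%:~R * x) = expi (k%:~R * x) * expi (l%:~R * x).
Proof. by rewrite intrD mulrDl expiD. Qed.

End complex_facts.

(** * Sums over symmetric ranges of frequencies *)

Section zsum.
Context {V : zmodType}.
Implicit Types (h g : int -> V) (n m : nat).

(** Repeats the indexing of [trigpoly] literally, so that passing between [trigpoly] and [tp] is
    mere unfolding. *)
Definition zsum n h : V := \sum_(j < n.*2.+1) h (j%:Z - n%:Z).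

Lemma zsum0 h : zsum 0 h = h 0.
Proof. by rewrite /zsum big_ord_recl big_ord0 addr0. Qed.

Lemma zsumS n h : zsum n.+1 h = h (- n.+1%:Z) + zsum n h + h n.+1%:Z.
Proof.
rewrite /zsum doubleS big_ord_recl big_ord_recr /= addrA; congr (_ + _ + _).
- by congr h; lia.
- by apply: eq_bigr => j _; congr h; rewrite /bump/=; lia.
- by congr h; rewrite /bump/=; lia.
Qed.

Lemma eq_zsum n h g : (forall k, `|k|%N <= n -> h k = g k)%N ->
  zsum n h = zsum n g.
Proof.
by move=> H; apply: eq_bigr => j _; apply: H; have := ltn_ord j; lia.
Qed.

Lemma zsumD n h g : zsum n (fun k => h k + g k) = zsum n h + zsum n g.
Proof. exact: big_split. Qed.

Lemma zsumN n h : zsum n (fun k => - h k) = - zsum n h.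
Proof. by rewrite /zsum sumrN. Qed.

Lemma zsumB n h g : zsum n (fun k => h k - g k) = zsum n h - zsum n g.
Proof. by rewrite zsumD zsumN. Qed.

Lemma zsum_eq0 n h : (forall k, (`|k| <= n)%N -> h k = 0) -> zsum n h = 0.
Proof. by move=> H; rewrite (@eq_zsum n h (fun=> 0))// /zsum big1. Qed.

Lemma zsum_widen m n h : (m <= n)%N ->
  (forall k, (m < `|k|)%N -> h k = 0) -> zsum n h = zsum m h.
Proof.
move=> mn H; rewrite -(subnK mn); elim: (n - m)%N => [|d IH]; first by rewrite add0n.
by rewrite addSn zsumS IH !H ?add0r ?addr0//; lia.
Qed.

Lemma zsum_delta n k h : (`|k| <= n)%N -> (forall j, j != k -> h j = 0) ->
  zsum n h = h k.
Proof.
move=> kn H; rewrite /zsum.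
have lt : (absz (k + n%:Z)%R < n.*2.+1)%N by lia.
have e : (Ordinal lt)%:Z - n%:Z = k by rewrite /=; lia.
rewrite (bigD1 (Ordinal lt))//= -[X in h X + _]/((Ordinal lt)%:Z - n%:Z) e.
rewrite big1 ?addr0// => i iN; apply: H; apply: contra iN => /eqP iE.
by apply/eqP/val_inj => /=; lia.
Qed.

(** The difference of the two sums telescopes to [h (n + 1) - h (- n)]; the endpoint [- n] is why
    vanishing is asked already at modulus [n]. *)
Lemma zsum_shift n h : (forall k, (n <= `|k|)%N -> h k = 0) ->
  zsum n (fun k => h (k + 1)) = zsum n h.
Proof.
move=> H; apply/eqP; rewrite -subr_eq0 -zsumB; apply/eqP.
have -> : zsum n (fun k => h (k + 1) - h k) = h n.+1%:Z - h (- n%:Z).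
  elim: n {H} => [|n IH]; first by rewrite zsum0 add0r oppr0.
  rewrite zsumS IH (_ : - n.+1%:Z + 1 = - n%:Z); last by lia.
  rewrite (_ : n.+1%:Z + 1 = n.+2%:Z); last by lia.
  set a := h (- n%:Z); set b := h (- n.+1%:Z); set c := h n.+1%:Z.
  have -> : a - b + (c - a) = c - b by rewrite addrC addrA subrK.
  by rewrite addrC addrA subrK.
by rewrite !H ?subr0//; lia.
Qed.

End zsum.

(** * Trigonometric polynomials *)

Section trigpoly_facts.
Context {R : realType}.
Implicit Types (c d : int -> R[i]) (n m : nat) (k : int) (f g : R -> R[i]).

Definition tp n c (x : R) : R[i] := zsum n (fun k => c k * expi (k%:~R * x)).

Lemma trigpolyP n f : trigpoly n f <-> exists c, f = tp n c.
Proof.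
split=> -[c fE]; exists c; last by move=> x; rewrite fE.
by apply/funext => x; rewrite fE.
Qed.

Lemma trigpoly_tp n c : trigpoly n (tp n c).
Proof. by apply/trigpolyP; exists c. Qed.

Lemma zsumZl n (a : R[i]) (h : int -> R[i]) :
  zsum n (fun k => a * h k) = a * zsum n h.
Proof. by rewrite /zsum mulr_sumr. Qed.

Lemma trigpolyD n f g : trigpoly n f -> trigpoly n g ->
  trigpoly n (fun x => f x + g x).
Proof.
move=> /trigpolyP[c ->] /trigpolyP[d ->]; apply/trigpolyP.
exists (fun k => c k + d k); apply/funext => x.
by rewrite /tp -zsumD; apply: eq_zsum => k _; rewrite mulrDl.
Qed.

Lemma trigpolyZ n a f : trigpoly n f -> trigpoly n (fun x => a * f x).
Proof.
move=> /trigpolyP[c ->]; apply/trigpolyP; exists (fun k => a * c k).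
by apply/funext => x; rewrite /tp -zsumZl; apply: eq_zsum => k _; rewrite mulrA.
Qed.

Lemma trigpolyN n f : trigpoly n f -> trigpoly n (fun x => - f x).
Proof.
move=> /(@trigpolyZ _ (-1)); congr trigpoly.
by apply/funext => x; rewrite mulN1r.
Qed.

Lemma trigpolyB n f g : trigpoly n f -> trigpoly n g ->
  trigpoly n (fun x => f x - g x).
Proof. by move=> tf tg; apply: trigpolyD => //; exact: trigpolyN. Qed.

Lemma trigpoly0 n : trigpoly n (fun=> 0 : R[i]).
Proof.
apply/trigpolyP; exists (fun=> 0); apply/funext => x.
by rewrite /tp zsum_eq0// => k _; rewrite mul0r.
Qed.

Lemma trigpoly_expi n k : (`|k| <= n)%N ->
  trigpoly n (fun x : R => expi (k%:~R * x)).
Proof.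
move=> kn; apply/trigpolyP; exists (fun j => if j == k then 1 else 0).
apply/funext => x; rewrite /tp (@zsum_delta _ n k)// ?eqxx ?mul1r//.
by move=> j /negbTE ->; rewrite mul0r.
Qed.

Lemma trigpoly_zsum n m (F : int -> R -> R[i]) :
  (forall k, (`|k| <= n)%N -> trigpoly m (F k)) ->
  trigpoly m (fun x => zsum n (fun k => F k x)).
Proof.
elim: n => [|n IH] H.
  by under eq_fun do rewrite zsum0; exact: H.
under eq_fun do rewrite zsumS.
apply: trigpolyD; last by apply: H; lia.
apply: trigpolyD; first by apply: H; lia.
by apply: IH => k kn; apply: H; lia.
Qed.

Lemma trigpoly_sum m (I : Type) (s : seq I) (P : pred I) (F : I -> R -> R[i]) :
  (forall i, P i -> trigpoly m (F i)) ->
  trigpoly m (fun x => \sum_(i <- s | P i) F i x).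
Proof.
move=> H; elim: s => [|i s IH].
  by under eq_fun do rewrite big_nil; exact: trigpoly0.
under eq_fun do rewrite big_cons.
by case Pi: (P i) => //; apply: trigpolyD => //; exact: H.
Qed.

Lemma trigpoly_widen n m f : (n <= m)%N -> trigpoly n f -> trigpoly m f.
Proof.
move=> nm /trigpolyP[c ->]; apply: trigpoly_zsum => k kn.
by apply: trigpolyZ; apply: trigpoly_expi; lia.
Qed.

Lemma trigpolyM n m f g : trigpoly n f -> trigpoly m g ->
  trigpoly (n + m) (fun x => f x * g x).
Proof.
move=> /trigpolyP[c ->] /trigpolyP[d ->].
have -> : (fun x => tp n c x * tp m d x) =
    fun x => zsum n (fun k => zsum m (fun l => c k * d l * expi ((k + l)%:~R * x))).
  apply/funext => x; rewrite mulrC -zsumZl; apply: eq_zsum => k _.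
  rewrite mulrC -zsumZl; apply: eq_zsum => l _.
  by rewrite expi_add_int mulrACA.
apply: trigpoly_zsum => k kn; apply: trigpoly_zsum => l lm.
by apply: trigpolyZ; apply: trigpoly_expi; lia.
Qed.

Lemma trigpoly_cst n (a : R[i]) : trigpoly n (fun=> a).
Proof.
have := @trigpolyZ n a _ (@trigpoly_expi n 0 (leq0n _)).
by congr trigpoly; apply/funext => x; rewrite mul0r expi0 mulr1.
Qed.

Lemma trigpoly_shift_opp n f x : trigpoly n f -> trigpoly n (fun y => f (x - y)).
Proof.
move=> /trigpolyP[c ->].
have -> : (fun y => tp n c (x - y)) = fun y => zsum n (fun k =>
    (c k * expi (k%:~R * x)) * expi ((- k)%:~R * y)).
  apply/funext => y; apply: eq_zsum => k _.
  by rewrite mulrBr expiD mulrA mulrNz mulNr.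
apply: trigpoly_zsum => k kn; apply: trigpolyZ; apply: trigpoly_expi.
by rewrite abszN.
Qed.

Lemma trigpoly_period n f : trigpoly n f -> periodic2pi f.
Proof.
by move=> /trigpolyP[c ->] x; apply: eq_zsum => k _; rewrite expi_period.
Qed.

End trigpoly_facts.

(** * Positive integrals over a period and Tonelli's theorem *)

Section nper_facts.
Context {R : realType}.
Implicit Types (F G : R -> R) (a b u : R -> R) (k c : R).
Local Notation mu := (@lebesgue_measure R).
Local Notation I := (`[0%R, (2 * pi)%R[%classic : set R).

Lemma mfunI F : measurable_fun setT F -> measurable_fun I (EFin \o F).
Proof. by move=> mF; apply/measurable_EFinP; exact: measurable_funTS. Qed.
Hint Extern 0 (measurable_fun _ (fun x => (_)%:E)) => apply: mfunI : core.

Lemma mu_period : mu I = (2 * pi)%:E.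
Proof.
rewrite lebesgue_measure_itv/= lte_fin twopi_gt0 -EFinB subr0.
by [].
Qed.

Lemma mu_period_lty : (mu I < +oo)%E.
Proof. by have := ltry (2 * pi : R); rewrite -mu_period. Qed.

Lemma nper_ge0 F : (forall x, 0 <= F x) -> (0 <= nper F)%E.
Proof. by move=> F0; apply: integral_ge0 => x _; rewrite lee_fin. Qed.

Lemma eq_nper F G : F =1 G -> nper F = nper G.
Proof. by move=> FG; apply: eq_integral => x _; rewrite FG. Qed.

Lemma le_nper_period F G : measurable_fun setT F -> measurable_fun setT G ->
  (forall x, 0 <= F x) -> (forall x, 0 <= x < 2 * pi -> F x <= G x) ->
  (nper F <= nper G)%E.
Proof.
move=> mF mG F0 FG; apply: ge0_le_integral.
- by [].
- by move=> x _; rewrite lee_fin.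
- exact: mfunI.
- exact: mfunI.
- by move=> x; rewrite /= in_itv/= => /FG; rewrite lee_fin.
Qed.

Lemma le_nper F G : measurable_fun setT F -> measurable_fun setT G ->
  (forall x, 0 <= F x) -> (forall x, F x <= G x) -> (nper F <= nper G)%E.
Proof. by move=> mF mG F0 FG; apply: le_nper_period. Qed.

Lemma nperD F G : measurable_fun setT F -> measurable_fun setT G ->
  (forall x, 0 <= F x) -> (forall x, 0 <= G x) ->
  nper (fun x => F x + G x) = (nper F + nper G)%E.
Proof.
move=> mF mG F0 G0; rewrite /nper -ge0_integralD//.
- by move=> x _; rewrite lee_fin.
- exact: mfunI.
- by move=> x _; rewrite lee_fin.
- exact: mfunI.
Qed.

Lemma nperZ k F : measurable_fun setT F -> (forall x, 0 <= F x) -> 0 <= k ->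
  nper (fun x => k * F x) = (k%:E * nper F)%E.
Proof.
move=> mF F0 k0; rewrite /nper -ge0_integralZl_EFin//.
- by move=> x _; rewrite lee_fin.
- exact: mfunI.
Qed.

Lemma nper_cst c : nper (fun=> c) = (c * (2 * pi))%:E.
Proof.
transitivity (c%:E * mu I)%E; first exact: integral_cst.
by rewrite mu_period.
Qed.

Lemma integral_indic_l (D : set R) (G : R -> \bar R) :
  (\int[mu]_(x in D) G x = \int[mu]_x ((\1_D x : R)%:E * G x))%E.
Proof.
rewrite integral_mkcond; apply: eq_integral => x _.
by rewrite patchE indicE; case: (x \in D); rewrite ?mul1e ?mul0e.
Qed.

(** Tonelli, then translation invariance of the integral of [b]. Since [u] is only dominated
    pointwise, the lemma serves p-th powers as well as moduli: [a], [b], [u] will be the p-th powers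
    of the moduli of two functions and of their convolution. *)
Lemma nper_convolution k a b u : 0 <= k ->
  measurable_fun setT a -> measurable_fun setT b -> measurable_fun setT u ->
  (forall x, 0 <= a x) -> (forall x, 0 <= b x) -> (forall x, 0 <= u x) ->
  (forall x, b (x + 2 * pi) = b x) ->
  (forall x, ((u x)%:E <= k%:E * nper (fun y => a y * b (x - y))%R)%E) ->
  (nper u <= k%:E * (nper a * nper b))%E.
Proof.
move=> k0 ma mb mu' a0 b0 u0 perb H.
have mD : measurable (I : set R) by [].
have mi : measurable_fun setT (\1_I : R -> R) by exact/measurable_indicP.
have i0 x : 0 <= \1_I x :> R by rewrite indicE.
(* Both restrictions to the period become indicator factors, so that Tonelli applies on the whole
   plane. *)
pose f (z : R * R) := (\1_I z.1 * (\1_I z.2 * (a z.2 * b (z.1 - z.2))))%:E.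
have mab : measurable_fun setT (fun z : R * R => a z.2 * b (z.1 - z.2)).
  apply: measurable_funM.
    by apply: measurableT_comp => //; exact: measurable_snd.
  apply: (measurableT_comp mb); apply: measurable_funB.
    exact: measurable_fst.
  exact: measurable_snd.
have mf : measurable_fun setT f.
  apply/measurable_EFinP; apply: measurable_funM.
    by apply: measurableT_comp => //; exact: measurable_fst.
  apply: measurable_funM => //.
  by apply: measurableT_comp => //; exact: measurable_snd.
pose T := measurableTypeR R.
have mf' : @measurable_fun _ _ (T * T)%type _ setT f by exact: mf.
have f0 z : (0 <= f z)%E by rewrite lee_fin !mulr_ge0.
have mbs (x : R) : measurable_fun setT (fun y : R => b (x - y)).
  by apply: (measurableT_comp mb); apply: measurable_funB => //; exact: measurable_cst.
have mby (y : R) : measurable_fun setT (fun x : R => b (x - y)).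
  by apply: (measurableT_comp mb); apply: measurable_funB => //; exact: measurable_cst.
have mabx (x : R) : measurable_fun setT (fun y : R => a y * b (x - y)).
  exact: measurable_funM.
have mF := @measurable_fun_fubini_tonelli_F _ _ T T R mu f mf' f0.
have mG := @measurable_fun_fubini_tonelli_G _ _ T T R mu f mf' f0.
have fE x : (\int[mu]_y f (x, y) =
    (\1_I x : R)%:E * nper (fun y => a y * b (x - y))%R)%E.
  rewrite /nper (integral_indic_l I) -ge0_integralZl_EFin//.
  - by move=> y _; rewrite -EFinM lee_fin !mulr_ge0.
  - by apply: emeasurable_funM; apply/measurable_EFinP; [exact: mi|exact: mabx].
apply: (@le_trans _ _ (k%:E * \int[mu]_x \int[mu]_y f (x, y))%E).
  rewrite -ge0_integralZl_EFin//; last by move=> x _; exact: integral_ge0.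
  rewrite /nper (integral_indic_l I); apply: ge0_le_integral => //.
  - by move=> x _; rewrite mule_ge0// lee_fin.
  - by apply: emeasurable_funM; apply/measurable_EFinP; [exact: mi|exact: mu'].
  - apply: measurable_funeM.
    exact: mF.
  - by move=> x _; rewrite fE muleCA lee_pmul// lee_fin.
rewrite lee_wpmul2l ?lee_fin// (@fubini_tonelli _ _ T T R mu mu f mf' f0).
rewrite /nper [X in (X * _)%E](integral_indic_l I) -ge0_integralZr//; last 3 first.
- by apply/measurable_EFinP; exact: measurable_funM.
- by move=> x _; rewrite mule_ge0// lee_fin.
- by apply: nper_ge0.
apply: ge0_le_integral => //.
- by move=> y _; exact: integral_ge0.
- apply: emeasurable_funM => //.
  by apply: emeasurable_funM; apply/measurable_EFinP; [exact: mi|exact: ma].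
move=> y _.
(* For fixed [y] the inner integral in [x] is that of a translate of [b], hence independent of
   [y]. *)
have := @nper_shift _ b (- y) mb b0 perb; rewrite /nper => <-.
rewrite (integral_indic_l I) -EFinM -ge0_integralZl_EFin//.
- rewrite le_eqVlt; apply/orP; left; apply/eqP; apply: eq_integral => x _.
  by rewrite /f/= -!EFinM; congr EFin; ring.
- by move=> x _; rewrite -EFinM lee_fin mulr_ge0.
- by apply: emeasurable_funM; apply/measurable_EFinP; [exact: mi|exact: mby].
- by rewrite mulr_ge0.
Qed.

End nper_facts.

(** * The functionals Np and Fourier coefficients *)

Section complex_integral.
Context {R : realType}.
Implicit Types (f g : R -> R[i]) (p : R) (a z : R[i]) (n : nat) (k : int).
Local Notation mu := (@lebesgue_measure R).
Local Notation I := (`[0%R, (2 * pi)%R[%classic : set R).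

Lemma cmeasurable_cst a : cmeasurable (fun=> a : R[i]).
Proof. by split; exact: measurable_cst. Qed.

Lemma cmeasurableD f g : cmeasurable f -> cmeasurable g ->
  cmeasurable (fun x => f x + g x).
Proof.
move=> [f1 f2] [g1 g2]; split.
- have -> : (fun x => complex.Re (f x + g x)) =
      (fun x => complex.Re (f x) + complex.Re (g x)).
    by apply/funext => x; case: (f x); case: (g x).
  exact: measurable_funD.
- have -> : (fun x => complex.Im (f x + g x)) =
      (fun x => complex.Im (f x) + complex.Im (g x)).
    by apply/funext => x; case: (f x); case: (g x).
  exact: measurable_funD.
Qed.

Lemma cmeasurableM f g : cmeasurable f -> cmeasurable g ->
  cmeasurable (fun x => f x * g x).
Proof.
move=> [f1 f2] [g1 g2]; split.
- have -> : (fun x => complex.Re (f x * g x)) =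
      (fun x => complex.Re (f x) * complex.Re (g x) -
                complex.Im (f x) * complex.Im (g x)).
    by apply/funext => x; case: (f x); case: (g x).
  by apply: measurable_funB; exact: measurable_funM.
- have -> : (fun x => complex.Im (f x * g x)) =
      (fun x => complex.Re (f x) * complex.Im (g x) +
                complex.Im (f x) * complex.Re (g x)).
    by apply/funext => x; case: (f x); case: (g x).
  by apply: measurable_funD; exact: measurable_funM.
Qed.

Lemma cmeasurableN f : cmeasurable f -> cmeasurable (fun x => - f x).
Proof.
move=> mf; have := cmeasurableM (cmeasurable_cst (-1)) mf.
by under eq_fun do rewrite mulN1r.
Qed.

Lemma cmeasurableB f g : cmeasurable f -> cmeasurable g ->
  cmeasurable (fun x => f x - g x).
Proof. by move=> mf mg; apply: cmeasurableD => //; exact: cmeasurableN. Qed.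

Lemma cmeasurable_expi k : cmeasurable (fun x : R => expi (k%:~R * x)).
Proof.
have mk : measurable_fun setT (fun x : R => k%:~R * x) by exact: mulrl_measurable.
split => /=.
- apply: (measurableT_comp _ mk); apply: continuous_measurable_fun.
  exact: continuous_cos.
- apply: (measurableT_comp _ mk); apply: continuous_measurable_fun.
  exact: continuous_sin.
Qed.

Lemma cmeasurable_trigpoly n f : trigpoly n f -> cmeasurable f.
Proof.
move=> /trigpolyP[c ->].
rewrite /tp; elim: n => [|n IH].
  under eq_fun do rewrite zsum0.
  by apply: cmeasurableM; [exact: cmeasurable_cst|exact: cmeasurable_expi].
under eq_fun do rewrite zsumS.
have mk k : cmeasurable (fun x : R => c k * expi (k%:~R * x)).
  by apply: cmeasurableM; [exact: cmeasurable_cst|exact: cmeasurable_expi].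
by apply: cmeasurableD => //; apply: cmeasurableD.
Qed.

Lemma measurable_nc f : cmeasurable f -> measurable_fun setT (fun x => nc (f x)).
Proof.
move=> [f1 f2].
have -> : (fun x => nc (f x)) = fun x =>
    Num.sqrt (complex.Re (f x) ^+ 2 + complex.Im (f x) ^+ 2).
  by apply/funext => x; case: (f x).
apply: (measurableT_comp (f := @Num.sqrt R)).
  by apply: continuous_measurable_fun; exact: sqrt_continuous.
by apply: measurable_funD; exact: measurable_funX.
Qed.

Lemma measurable_ncp p f : cmeasurable f ->
  measurable_fun setT (fun x => nc (f x) `^ p).
Proof.
move=> mf; apply: (measurableT_comp (f := fun t => t `^ p)).
  exact: measurable_powR.
exact: measurable_nc.
Qed.

Definition Np p f : \bar R := nper (fun x => nc (f x) `^ p).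

Lemma Np_ge0 p f : (0 <= Np p f)%E.
Proof. by apply: nper_ge0 => x; exact: powR_ge0. Qed.

Lemma Np1E f : Np 1 f = nper (fun x => nc (f x)).
Proof. by apply: eq_nper => x; rewrite powRr1 ?nc_ge0. Qed.

Lemma NpD p f g : 0 < p -> p <= 1 -> cmeasurable f -> cmeasurable g ->
  (Np p (fun x => f x + g x)%R <= Np p f + Np p g)%E.
Proof.
move=> p0 p1 mf mg; rewrite -nperD; [|exact: measurable_ncp|exact: measurable_ncp
  |by move=> x; exact: powR_ge0|by move=> x; exact: powR_ge0].
apply: le_nper.
- by apply: measurable_ncp; exact: cmeasurableD.
- by apply: measurable_funD; exact: measurable_ncp.
- by move=> x; exact: powR_ge0.
- by move=> x; exact: ncD_powR.
Qed.

Lemma NpN p f : Np p (fun x => - f x)%R = Np p f.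
Proof. by apply: eq_nper => x; rewrite ncN. Qed.

Lemma NpB p f g : 0 < p -> p <= 1 -> cmeasurable f -> cmeasurable g ->
  (Np p (fun x => f x - g x)%R <= Np p f + Np p g)%E.
Proof.
move=> p0 p1 mf mg; rewrite -(NpN p g); apply: NpD => //; exact: cmeasurableN.
Qed.

Lemma NpZ p a f : cmeasurable f ->
  Np p (fun x => a * f x)%R = ((nc a `^ p)%:E * Np p f)%E.
Proof.
move=> mf; rewrite -nperZ ?powR_ge0//.
- by apply: eq_nper => x; rewrite ncM powRM ?nc_ge0.
- exact: measurable_ncp.
- by move=> x; exact: powR_ge0.
Qed.

Lemma cmeasurable_sum (J : Type) (s : seq J) (F : J -> R -> R[i]) :
  (forall j, cmeasurable (F j)) ->
  cmeasurable (fun x => \sum_(j <- s) F j x).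
Proof.
move=> mF; elim: s => [|j s IH].
  by under eq_fun do rewrite big_nil; exact: cmeasurable_cst.
by under eq_fun do rewrite big_cons; exact: cmeasurableD.
Qed.

Lemma Np0 p : 0 < p -> Np p (fun=> 0) = 0.
Proof.
move=> p0; rewrite /Np (@eq_nper _ _ (fun=> 0)); first by rewrite nper_cst mul0r.
by move=> x; rewrite nc0 powR0// gt_eqF.
Qed.

Lemma Np_sum p (J : Type) (s : seq J) (F : J -> R -> R[i]) :
  0 < p -> p <= 1 -> (forall j, cmeasurable (F j)) ->
  (Np p (fun x => \sum_(j <- s) F j x)%R <= \sum_(j <- s) Np p (F j))%E.
Proof.
move=> p0 p1 mF; elim: s => [|j s IH].
  by rewrite big_nil; under eq_fun do rewrite big_nil; rewrite Np0.
rewrite big_cons; under eq_fun do rewrite big_cons.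
apply: le_trans (leeD (lexx _) IH); apply: NpD => //.
exact: cmeasurable_sum.
Qed.

Lemma nc_tp_le n (c : int -> R[i]) x : nc (tp n c x) <= zsum n (fun k => nc (c k)).
Proof.
apply: le_trans (nc_sum _ _ _) _; apply: ler_sum => j _.
by rewrite ncM nc_expi mulr1.
Qed.

Lemma Np_trigpoly_fin p n f : 0 < p -> trigpoly n f -> Np p f \is a fin_num.
Proof.
move=> p0 tf; have mf := cmeasurable_trigpoly tf.
rewrite ge0_fin_numE ?Np_ge0//; move: tf => /trigpolyP[c fE].
have B0 : 0 <= zsum n (fun k => nc (c k)) by apply: sumr_ge0 => j _; exact: nc_ge0.
apply: (@le_lt_trans _ _ (nper (fun=> zsum n (fun k => nc (c k)) `^ p))).
  apply: le_nper => //.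
  - exact: measurable_ncp.
  - by move=> x; exact: powR_ge0.
  - move=> x; apply: ge0_ler_powR; rewrite ?nnegrE ?(ltW p0) ?nc_ge0//.
    by rewrite fE; exact: nc_tp_le.
by rewrite nper_cst ltry.
Qed.

Definition L1 f : Prop := cmeasurable f /\ (Np 1 f < +oo)%E.

Lemma L1_trigpoly n f : trigpoly n f -> L1 f.
Proof.
move=> tf; split; first exact: cmeasurable_trigpoly tf.
by have := Np_trigpoly_fin ltr01 tf; rewrite ge0_fin_numE ?Np_ge0.
Qed.

Lemma L1D f g : L1 f -> L1 g -> L1 (fun x => f x + g x).
Proof.
move=> [mf lf] [mg lg]; split; first exact: cmeasurableD.
by apply: le_lt_trans (NpD ltr01 (lexx 1) mf mg) (lte_add_pinfty lf lg).
Qed.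

Lemma L1N f : L1 f -> L1 (fun x => - f x).
Proof. by move=> [mf lf]; split; rewrite ?NpN//; exact: cmeasurableN. Qed.

Lemma L1B f g : L1 f -> L1 g -> L1 (fun x => f x - g x).
Proof. by move=> lf lg; exact: (L1D lf (L1N lg)). Qed.

Lemma L1_le f g : cmeasurable f -> L1 g -> (forall x, nc (f x) <= nc (g x)) -> L1 f.
Proof.
move=> mf [mg lg] fg; split; first exact: mf.
apply: le_lt_trans lg; rewrite !Np1E; apply: le_nper fg.
- exact: measurable_nc mf.
- exact: measurable_nc mg.
- by move=> x; exact: nc_ge0.
Qed.

Lemma L1Z a f : L1 f -> L1 (fun x => a * f x).
Proof.
move=> [mf lf]; split.
  by apply: cmeasurableM => //; exact: cmeasurable_cst.
rewrite NpZ// powRr1 ?nc_ge0//.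
have : Np 1 f \is a fin_num by rewrite ge0_fin_numE ?Np_ge0.
by move=> /fineK <-; rewrite -EFinM ltry.
Qed.

Lemma L1M_expi k f : L1 f -> L1 (fun x => f x * expi (k%:~R * x)).
Proof.
move=> lf; have [mf _] := lf; apply: L1_le lf _ => [|x].
  by apply: cmeasurableM => //; exact: cmeasurable_expi.
by rewrite ncM nc_expi mulr1.
Qed.

Definition cmean f : R[i] := Complex
  ((2 * pi)^-1 * Rintegral mu I (fun x => complex.Re (f x)))
  ((2 * pi)^-1 * Rintegral mu I (fun x => complex.Im (f x))).

Lemma fourier_coefE f k :
  fourier_coef f k = cmean (fun x => f x * expi ((- k)%:~R * x)).
Proof.
rewrite /fourier_coef /cmean.
by congr Complex; congr (_ * _); apply: eq_Rintegral => x _; rewrite mulrNz mulNr.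
Qed.

Lemma L1_integrable_Re f : L1 f -> mu.-integrable I (EFin \o (fun x => complex.Re (f x))).
Proof.
move=> [mf lf]; apply/integrableP; split.
  by case: mf => m1 _; exact: mfunI.
apply: le_lt_trans lf; rewrite Np1E; apply: ge0_le_integral => //.
- by apply: measurableT_comp => //; apply: mfunI; case: mf.
- by apply: mfunI; exact: measurable_nc.
- by move=> x _; rewrite /= lee_fin Re_le_nc.
Qed.

Lemma L1_integrable_Im f : L1 f -> mu.-integrable I (EFin \o (fun x => complex.Im (f x))).
Proof.
move=> [mf lf]; apply/integrableP; split.
  by case: mf => _ m1; exact: mfunI.
apply: le_lt_trans lf; rewrite Np1E; apply: ge0_le_integral => //.
- by apply: measurableT_comp => //; apply: mfunI; case: mf.
- by apply: mfunI; exact: measurable_nc.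
- by move=> x _; rewrite /= lee_fin Im_le_nc.
Qed.

Lemma cmeanD f g : L1 f -> L1 g -> cmean (fun x => f x + g x) = cmean f + cmean g.
Proof.
move=> lf lg; rewrite /cmean.
rewrite (@eq_Rintegral _ _ _ mu I (fun x => complex.Re (f x) + complex.Re (g x))); last first.
  by move=> x _; case: (f x); case: (g x).
rewrite [X in Complex _ (_ * X)](@eq_Rintegral _ _ _ mu I (fun x => complex.Im (f x) + complex.Im (g x))); last first.
  by move=> x _; case: (f x); case: (g x).
rewrite !RintegralD//; try exact: L1_integrable_Re; try exact: L1_integrable_Im.
by rewrite !mulrDr.
Qed.

Lemma cmeanZ a f : L1 f -> cmean (fun x => a * f x) = a * cmean f.
Proof.
move=> lf; rewrite /cmean; case: a => a b.
have iR := L1_integrable_Re lf; have iI := L1_integrable_Im lf.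
have iZ (c : R) h : mu.-integrable I (EFin \o h) -> mu.-integrable I (EFin \o (fun x => c * h x)).
  by move=> ih; exact: (@integrableZl _ _ _ mu I (measurable_itv _) c (EFin \o h) ih).
rewrite (@eq_Rintegral _ _ _ mu I (fun x => a * complex.Re (f x) - b * complex.Im (f x))); last first.
  by move=> x _; case: (f x).
rewrite [X in Complex _ (_ * X)](@eq_Rintegral _ _ _ mu I (fun x => a * complex.Im (f x) + b * complex.Re (f x))); last first.
  by move=> x _; case: (f x).
rewrite RintegralB ?RintegralD ?RintegralZl//; try by apply: iZ.
by simpc; congr Complex; ring.
Qed.

(** The modulus is bounded by the sum of the real and imaginary parts, each at most
    [Np 1 f / (2 * pi)]. The lost factor 2 is harmless: [1 / pi] is still at most 1, which is all
    that is used later. *)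
Lemma nc_cmean f : L1 f -> ((nc (cmean f))%:E <= (pi^-1)%:E * Np 1 f)%E.
Proof.
move=> lf; have [mf lf1] := lf.
have fin : Np 1 f \is a fin_num by rewrite ge0_fin_numE ?Np_ge0.
have t0 : 0 < (2 * pi)^-1 :> R by rewrite invr_gt0 twopi_gt0.
have H (h : R -> R) : measurable_fun setT h -> (forall x, `|h x| <= nc (f x)) ->
    mu.-integrable I (EFin \o h) -> `|Rintegral mu I h| <= fine (Np 1 f).
  move=> mh hle ih; apply: (le_trans (le_normr_Rintegral _ ih)) => //.
  rewrite /Rintegral; apply: fine_le => //.
    by apply: integrable_fin_num => //; exact: integrable_norm.
  rewrite Np1E; apply: le_nper => //.
  - exact: measurableT_comp.
  - exact: measurable_nc.
rewrite -(fineK fin) -EFinM lee_fin (le_trans (nc_le_ReIm _))//=.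
rewrite !normrM (gtr0_norm t0) -mulrDr.
apply: (@le_trans _ _ ((2 * pi)^-1 * (fine (Np 1 f) + fine (Np 1 f)))).
  rewrite ler_wpM2l ?(ltW t0)//; apply: lerD; apply: H.
  - by case: mf.
  - by move=> x; exact: Re_le_nc.
  - exact: L1_integrable_Re.
  - by case: mf.
  - by move=> x; exact: Im_le_nc.
  - exact: L1_integrable_Im.
rewrite le_eqVlt; apply/orP; left; apply/eqP.
have := pi_gt0 R; move: (pi : R) => q q0; field.
by rewrite gt_eqF.
Qed.

(** A shift by [pi / k] changes the sign of the cosine. The constant 1 is added because [nper_shift]
    speaks of non-negative functions: the integrals of [1 + c] and [1 - c] agree, so that of [c] is
    zero. *)
Lemma Rintegral_cos_period k (t : R) : k != 0 ->
  Rintegral mu I (fun x => cos (k%:~R * x + t)) = 0.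
Proof.
move=> k0; pose c x := cos (k%:~R * x + t); rewrite -/(Rintegral mu I c).
have kR : k%:~R != 0 :> R by rewrite intr_eq0.
have mc : measurable_fun setT c.
  apply: continuous_measurable_fun => x; apply: continuous_comp; last exact: continuous_cos.
  apply: cvgD; last exact: cvg_cst.
  by apply: cvgM; [exact: cvg_cst|exact: cvg_id].
have cb x : -1 <= c x <= 1 by rewrite cos_geN1 cos_le1.
have ic : mu.-integrable I (EFin \o c).
  apply: measurable_bounded_integrable => //.
  - exact: mu_period_lty.
  - exact: measurable_funTS.
  - by exists 1; split => // M M1 x _ /=; rewrite (le_trans _ (ltW M1))// ler_norml cb.
have i1 (r : R) : mu.-integrable I (EFin \o (fun=> r)).
  apply: measurable_bounded_integrable => //.
  - exact: mu_period_lty.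
  - by exists `|r|; split => // M M1 x _ /=; exact: ltW.
have e : nper (fun x => 1 + c x) = nper (fun x => 1 - c x).
  rewrite -(@nper_shift _ (fun x => 1 + c x) (pi / k%:~R)).
  - apply: eq_nper => x; congr (_ + _); rewrite /c mulrDr mulrCA divff// mulr1.
    by rewrite addrAC cosDpi.
  - by apply: measurable_funD => //; exact: measurable_cst.
  - by move=> x; have := cb x; lra.
  - move=> x; congr (_ + _); rewrite /c.
    have := @expi_period _ k x; rewrite /expi => -[e1 e2].
    by rewrite cosD e1 e2 -cosD.
have := congr1 fine e; rewrite /nper -/(Rintegral mu I (fun x => 1 + c x)) -/(Rintegral mu I (fun x => 1 - c x)).
by rewrite RintegralD ?RintegralB//; lra.
Qed.

Lemma cmean_expi k : cmean (fun x => expi (k%:~R * x)) = if k == 0 then 1 else 0.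
Proof.
rewrite /cmean; case: eqVneq => [->|k0].
  have t0 : (2 * pi) != 0 :> R by rewrite gt_eqF ?twopi_gt0.
  rewrite (@eq_Rintegral _ _ _ mu I (fun=> 1)); last by move=> x _; rewrite mul0r expi0.
  rewrite [X in Complex _ (_ * X)](@eq_Rintegral _ _ _ mu I (fun=> 0)); last by move=> x _; rewrite mul0r expi0.
  have cst (r : R) : Rintegral mu I (fun=> r) = r * (2 * pi).
    by have := nper_cst r; rewrite /nper /Rintegral => ->.
  by rewrite !cst mul1r mul0r mulr0 mulVf.
rewrite (@eq_Rintegral _ _ _ mu I (fun x => cos (k%:~R * x + 0))); last by move=> x _; rewrite addr0.
(* The sine is a cosine with phase [- pi / 2], which puts both components under the same lemma. *)
rewrite [X in Complex _ (_ * X)](@eq_Rintegral _ _ _ mu I (fun x => cos (k%:~R * x + (- (pi / 2))))); last first.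
  move=> x _ /=; have := sinDpihalf (k%:~R * x - pi / 2).
  by rewrite subrK.
by rewrite !Rintegral_cos_period// !mulr0.
Qed.

Lemma cmean_zsum n (F : int -> R -> R[i]) : (forall k, L1 (F k)) ->
  cmean (fun x => zsum n (fun k => F k x)) = zsum n (fun k => cmean (F k)).
Proof.
move=> lF; have lS m : L1 (fun x => zsum m (fun k => F k x)).
  elim: m => [|m IH].
    by under eq_fun do rewrite zsum0; exact: lF.
  under eq_fun do rewrite zsumS.
  exact: (L1D (L1D (lF _) IH) (lF _)).
elim: n => [|n IH]; first by under eq_fun do rewrite zsum0; rewrite zsum0.
rewrite zsumS -IH -(cmeanD (lF _) (lS _)) -(cmeanD (L1D (lF _) (lS _)) (lF _)).
by congr cmean; apply/funext => x; rewrite zsumS.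
Qed.

Lemma fourier_coef_tp n (c : int -> R[i]) k :
  fourier_coef (tp n c) k = if (`|k| <= n)%N then c k else 0.
Proof.
rewrite fourier_coefE.
have -> : (fun x => tp n c x * expi ((- k)%:~R * x)) =
    fun x => zsum n (fun j => c j * expi ((j - k)%:~R * x)).
  apply/funext => x; rewrite /tp mulrC -zsumZl; apply: eq_zsum => j _.
  by rewrite expi_add_int; ring.
have lE j : L1 (fun x : R => expi (j%:~R * x)).
  exact: (L1_trigpoly (@trigpoly_expi R `|j|%N j (leqnn _))).
rewrite cmean_zsum; last by move=> j; exact: L1Z.
have e j : cmean (fun x => c j * expi ((j - k)%:~R * x)) = if j == k then c j else 0.
  by rewrite cmeanZ// cmean_expi subr_eq0; case: eqVneq; rewrite ?mulr1 ?mulr0.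
case: leqP => kn.
  rewrite (@zsum_delta _ n k)// ?e ?eqxx// => j jk.
  by rewrite e (negbTE jk).
apply: zsum_eq0 => j jn; rewrite e; case: eqVneq => // jk.
by move: jn; rewrite jk leqNgt kn.
Qed.

End complex_integral.

(** * Nikolskii inequality and convolution *)

Section nikolskii_convolution.
Context {R : realType}.
Implicit Types (f g w : R -> R[i]) (p A : R) (n m : nat) (k : int).
Implicit Types (b c : int -> R[i]).

Lemma pi_ge1 : 1 <= pi :> R.
Proof. by rewrite (le_trans _ (pi_ge2 R))// ler1n. Qed.

Lemma nc_cmean_le f : L1 f -> ((nc (cmean f))%:E <= Np 1 f)%E.
Proof.
move=> lf; apply: le_trans (nc_cmean lf) _.
by rewrite gee_pMl ?Np_ge0// ?lee_fin ?invf_le1 ?pi_gt0 ?pi_ge1.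
Qed.

Lemma nc_fourier_coef_le f k : L1 f -> ((nc (fourier_coef f k))%:E <= Np 1 f)%E.
Proof.
move=> lf; rewrite fourier_coefE.
apply: le_trans (nc_cmean_le (L1M_expi (- k) lf)) _.
rewrite !Np1E (@eq_nper _ _ (fun x => nc (f x)))// => x.
by rewrite ncM nc_expi mulr1.
Qed.

Lemma tp_fourier_coef n f : trigpoly n f -> f = tp n (fourier_coef f).
Proof.
move=> /trigpolyP[c ->]; apply/funext => x; apply: eq_zsum => k kn.
by rewrite fourier_coef_tp kn.
Qed.

(** Each of the [2n + 1] Fourier coefficients is at most [Np 1 f]. This endpoint case of Nikolskii's
    inequality is the only input for the others. *)
Lemma trigpoly_sup_le_L1 n f x : trigpoly n f ->
  nc (f x) <= n.*2.+1%:R * fine (Np 1 f).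
Proof.
move=> tf; have lf := L1_trigpoly tf.
rewrite {1}(tp_fourier_coef tf) (le_trans (nc_tp_le _ _ _))//.
have fin := Np_trigpoly_fin ltr01 tf.
apply: (@le_trans _ _ (\sum_(j < n.*2.+1) fine (Np 1 f))).
  apply: ler_sum => j _; rewrite -lee_fin fineK//; exact: nc_fourier_coef_le.
by rewrite sumr_const card_ord mulr_natl.
Qed.

Lemma Np1_le_sup p f A : 0 < p -> p <= 1 -> cmeasurable f ->
  (forall x, nc (f x) <= A) -> (Np 1 f <= (A `^ (1 - p))%:E * Np p f)%E.
Proof.
move=> p0 p1 mf fA; rewrite -nperZ ?powR_ge0//; last 2 first.
- exact: measurable_ncp.
- by move=> x; exact: powR_ge0.
have mp := measurable_ncp p mf; have m1 := measurable_ncp 1 mf.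
apply: le_nper.
- exact: m1.
- by apply: measurable_funM => //; exact: measurable_cst.
- by move=> x; exact: powR_ge0.
move=> x; rewrite -[X in nc (f x) `^ X](subrK p) powRD; last first.
  by rewrite subrK oner_eq0.
rewrite ler_wpM2r ?powR_ge0// ge0_ler_powR ?nnegrE ?nc_ge0 ?subr_ge0//.
by rewrite (le_trans (nc_ge0 (f x))).
Qed.

(** [A] stands for the supremum, [K] for [2n + 1], [N] and [N1] for [Np p] and [Np 1]. From
    [A <= K * N1 <= K * A^(1-p) * N] one cancels to [A^p <= K * N], and then
    [N1^p <= (A^p)^(1-p) * N^p <= K^(1-p) * N]. *)
Lemma nikolskii_arith p (A K N N1 : R) : 0 < p -> p <= 1 ->
  0 <= A -> 0 <= K -> 0 <= N -> 0 <= N1 ->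
  N1 <= A `^ (1 - p) * N -> A <= K * N1 -> N1 `^ p <= K `^ (1 - p) * N.
Proof.
move=> p0 p1 A0 K0 N0 N10 N1A AKN.
have ApKN : A `^ p <= K * N.
  have [A_eq0|AN0] := eqVneq A 0.
    by rewrite A_eq0 powR0 ?gt_eqF// mulr_ge0.
  have Agt0 : 0 < A by rewrite lt_def AN0.
  rewrite -(ler_pM2l (powR_gt0 (1 - p) Agt0)) -powRD ?AN0 ?implybT//.
  by rewrite subrK powRr1// (le_trans AKN)// mulrCA ler_wpM2l.
apply: (@le_trans _ _ ((A `^ (1 - p) * N) `^ p)).
  by rewrite ge0_ler_powR ?nnegrE ?(ltW p0) ?mulr_ge0 ?powR_ge0.
rewrite powRM ?powR_ge0//.
apply: (@le_trans _ _ ((K * N) `^ (1 - p) * N `^ p)).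
  rewrite ler_wpM2r ?powR_ge0// powRAC.
  by rewrite ge0_ler_powR ?nnegrE ?subr_ge0 ?powR_ge0 ?mulr_ge0.
rewrite powRM// -mulrA -powRD; first by rewrite subrK powRr1.
by rewrite subrK oner_eq0.
Qed.

Lemma nikolskii n p f : 0 < p -> p <= 1 -> trigpoly n f ->
  fine (Np 1 f) `^ p <= n.*2.+1%:R `^ (1 - p) * fine (Np p f).
Proof.
move=> p0 p1 tf; have mf := cmeasurable_trigpoly tf.
have hs : has_sup (range (fun x => nc (f x))).
  split; first by exists (nc (f 0)); exists 0.
  by exists (n.*2.+1%:R * fine (Np 1 f)) => _ [x _ <-]; exact: trigpoly_sup_le_L1.
have fA x : nc (f x) <= sup (range (fun x => nc (f x))).
  by apply: sup_upper_bound => //; exists x.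
apply: (nikolskii_arith p0 p1 (le_trans (nc_ge0 _) (fA 0))).
- exact: ler0n.
- by rewrite fine_ge0// Np_ge0.
- by rewrite fine_ge0// Np_ge0.
- have := Np1_le_sup p0 p1 mf fA.
  rewrite -(fineK (Np_trigpoly_fin p0 tf)) -(fineK (Np_trigpoly_fin ltr01 tf)).
  by rewrite -EFinM lee_fin.
- by apply: ge_sup => [|_ [x _ <-]]; [exact: hs.1|exact: trigpoly_sup_le_L1].
Qed.

Lemma L1M_trigpoly n w f : L1 w -> trigpoly n f -> L1 (fun x => w x * f x).
Proof.
move=> lw tf; have mf := cmeasurable_trigpoly tf; have [mw _] := lw.
have h := trigpoly_sup_le_L1 _ tf.
have g0 : 0 <= n.*2.+1%:R * fine (Np 1 f).
  by rewrite mulr_ge0// fine_ge0// Np_ge0.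
apply: (@L1_le _ _ (fun x => ((n.*2.+1%:R * fine (Np 1 f))%:C)%C * w x)).
- exact: cmeasurableM.
- exact: L1Z.
- by move=> x; rewrite !ncM nc_real ger0_norm// mulrC ler_wpM2r ?nc_ge0.
Qed.

Lemma tp_convolution n w b x : L1 w ->
  tp n (fun k => fourier_coef w k * b k) x = cmean (fun y => w y * tp n b (x - y)).
Proof.
move=> lw.
have -> : (fun y => w y * tp n b (x - y)) = fun y => zsum n (fun k =>
    (b k * expi (k%:~R * x)) * (w y * expi ((- k)%:~R * y))).
  apply/funext => y; rewrite -zsumZl; apply: eq_zsum => k _.
  rewrite mulrBr expiD -(mulNr _ y) -mulrNz; ring.
rewrite cmean_zsum; last by move=> k; exact: (L1Z _ (L1M_expi _ lw)).
apply: eq_zsum => k _; rewrite (cmeanZ _ (L1M_expi _ lw)) -fourier_coefE; ring.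
Qed.

Lemma Np1_convolution n w b : L1 w ->
  (Np 1 (tp n (fun k => fourier_coef w k * b k)%R) <= Np 1 w * Np 1 (tp n b))%E.
Proof.
move=> lw; have [mw _] := lw; have tb := trigpoly_tp n b.
have mb := cmeasurable_trigpoly tb.
rewrite !Np1E -[leRHS]mul1e; apply: nper_convolution => //.
- exact: measurable_nc.
- exact: measurable_nc.
- exact: (measurable_nc (cmeasurable_trigpoly (trigpoly_tp _ _))).
- by move=> x; exact: nc_ge0.
- by move=> x; exact: nc_ge0.
- by move=> x; exact: nc_ge0.
- by move=> x; rewrite (trigpoly_period tb).
move=> x; rewrite mul1e tp_convolution//.
apply: le_trans (nc_cmean_le (L1M_trigpoly lw (trigpoly_shift_opp x tb))) _.
by rewrite Np1E (@eq_nper _ _ (fun y => nc (w y) * nc (tp n b (x - y)))%R)// => y; rewrite ncM.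
Qed.

(** For fixed [x] the integrand [f y * K (x - y)] is a trigonometric polynomial of order [2n] in
    [y], and Nikolskii's inequality, with constant [4n + 1], moves the p-th power inside the
    integral. Both factors have to be polynomials, hence the truncation of all kernels. *)
Lemma Np_convolution n p f b : 0 < p -> p <= 1 -> trigpoly n f ->
  (Np p (tp n (fun k => fourier_coef f k * b k)%R) <=
   ((n.*2.*2.+1)%:R `^ (1 - p))%:E * (Np p f * Np p (tp n b)))%E.
Proof.
move=> p0 p1 tf; have tb := trigpoly_tp n b.
have mb := cmeasurable_trigpoly tb; have mf := cmeasurable_trigpoly tf.
have lf := L1_trigpoly tf.
apply: nper_convolution.
- exact: powR_ge0.
- exact: measurable_ncp.
- exact: measurable_ncp.
- exact: (measurable_ncp p (cmeasurable_trigpoly (trigpoly_tp _ _))).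
- by move=> x; exact: powR_ge0.
- by move=> x; exact: powR_ge0.
- by move=> x; exact: powR_ge0.
- by move=> x; rewrite (trigpoly_period tb).
move=> x; rewrite (tp_convolution n b x lf).
set h := (fun y => f y * tp n b (x - y)).
have th : trigpoly n.*2 h by rewrite -addnn; exact: (trigpolyM tf (trigpoly_shift_opp x tb)).
have lh := L1_trigpoly th.
have -> : nper (fun y => nc (f y) `^ p * nc (tp n b (x - y)) `^ p) = Np p h.
  by apply: eq_nper => y; rewrite ncM powRM ?nc_ge0.
rewrite -(fineK (Np_trigpoly_fin p0 th)) -EFinM lee_fin.
apply: le_trans (nikolskii p0 p1 th).
rewrite ge0_ler_powR ?nnegrE ?(ltW p0) ?nc_ge0 ?fine_ge0 ?Np_ge0//.
rewrite -lee_fin (fineK (Np_trigpoly_fin ltr01 th)); exact: nc_cmean_le.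
Qed.

End nikolskii_convolution.

(** * Kernels with small differences *)

Section difference_kernels.
Context {R : realType}.
Implicit Types (c : int -> R) (p A B rho x : R) (n m M r S : nat) (k : int).

Definition dlt c k : R := c (k + 1) - c k.

Lemma iter_dlt_supp r S c k : (forall l, (S < `|l|)%N -> c l = 0) ->
  (S + r < `|k|)%N -> iter r dlt c k = 0.
Proof.
move=> H; elim: r k => [|r IH] k /=; first by rewrite addn0; exact: H.
by move=> hk; rewrite /dlt !IH ?subrr//; lia.
Qed.

(** Summation by parts in multiplicative form: multiplication by [expi (- x)] shifts the
    coefficients by one, and the vanishing near the ends removes the boundary terms. *)
Lemma tp_dlt n c x : (forall k, (n <= `|k|)%N -> c k = 0) ->
  tp n (fun k => (dlt c k)%:C%C) x = (expi (- x) - 1) * tp n (fun k => (c k)%:C%C) x.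
Proof.
move=> H.
have e : expi (- x) * tp n (fun k => (c k)%:C%C) x =
    tp n (fun k => (c (k + 1))%:C%C) x.
  rewrite /tp -zsumZl -(@zsum_shift _ n (fun k => expi (- x) * ((c k)%:C%C * expi (k%:~R * x)))).
    apply: eq_zsum => k _; rewrite expi_add_int mul1r mulrCA; congr (_ * _).
    by rewrite mulrCA expiNM mulr1.
  by move=> k hk; rewrite H// mul0r mulr0.
rewrite mulrBl mul1r e /tp -zsumB; apply: eq_zsum => k _.
by rewrite -mulrBl /dlt rmorphB.
Qed.

Lemma tp_iter_dlt n r S c x : (forall k, (S < `|k|)%N -> c k = 0) ->
  (S + r <= n)%N ->
  tp n (fun k => (iter r dlt c k)%:C%C) x =
  (expi (- x) - 1) ^+ r * tp n (fun k => (c k)%:C%C) x.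
Proof.
move=> H; elim: r => [|r IH] Sn; first by rewrite mul1r.
rewrite exprS -mulrA -IH; last by lia.
by rewrite /= -tp_dlt// => k hk; apply: (iter_dlt_supp H); lia.
Qed.

Lemma nc_tp_real_le n c A x : (forall k, `|c k| <= A) ->
  nc (tp n (fun k => (c k)%:C%C) x) <= n.*2.+1%:R * A.
Proof.
move=> cA; apply: le_trans (nc_tp_le _ _ _) _.
rewrite -[n.*2.+1 in leRHS]card_ord mulr_natl -sumr_const.
by apply: ler_sum => j _; rewrite nc_real.
Qed.

(** Taken at [d = 1/n] this gives [(1 - 1/n)^n <= 1/2], which keeps the truncation of [geom] away
    from zero. *)
Lemma expr_bernoulli (d : R) n : 0 <= d -> d <= 1 ->
  (1 - d) ^+ n * (1 + n%:R * d) <= 1.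
Proof.
move=> d0 d1; elim: n => [|n IH]; first by rewrite mul0r addr0 mul1r.
apply: le_trans IH; rewrite exprSr -mulrA ler_wpM2l ?exprn_ge0 ?subr_ge0//.
rewrite -natr1; have : 0 <= (n%:R + 1) * d ^+ 2 :> R by rewrite mulr_ge0// ?sqr_ge0// addr_ge0.
lra.
Qed.

(* Truncated Poisson-type kernel: its modulus dominates 1 / (1/M + |e^(-ix) - 1|)
   up to a constant, while its L2 norm is explicit by Parseval. *)
Definition geom M (x : R) : R[i] :=
  \sum_(k < M) ((1 - M%:R^-1 : R) ^+ k)%:C%C * expi (k%:Z%:~R * x).

(** With [rho = 1 - 1/M] and [z = expi x], the product [(1 - rho z) * geom] equals [1 - (rho z)^M],
    of modulus at least 1/2, and [1 - rho z = 1/M + rho z (expi (- x) - 1)]. *)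
Lemma geom_lower M x : (0 < M)%N ->
  2^-1 <= (M%:R^-1 + nc (expi (- x) - 1)) * nc (geom M x).
Proof.
move=> M0; set rho : R := 1 - M%:R^-1; set z := expi x.
have MR : 0 < M%:R :> R by rewrite ltr0n.
have i0 : 0 <= M%:R^-1 :> R by rewrite invr_ge0 ltW.
have i1 : M%:R^-1 <= 1 :> R by rewrite invf_le1// ler1n.
have rho0 : 0 <= rho by rewrite subr_ge0.
have zX (k : nat) : expi (k%:R * x) = z ^+ k.
  elim: k => [|k IH]; first by rewrite mul0r expi0.
  by rewrite -natr1 mulrDl mul1r expiD IH exprSr.
have gE : geom M x = \sum_(k < M) (rho%:C%C * z) ^+ k.
  by apply: eq_bigr => k _; rewrite exprMn -zX rmorphXn.
have id : (1 - rho%:C%C * z) * geom M x = 1 - (rho%:C%C * z) ^+ M.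
  by rewrite gE -opprB mulNr -subrX1 opprB.
have lo : 2^-1 <= nc ((1 - rho%:C%C * z) * geom M x).
  rewrite id; have := @ncD R (1 - (rho%:C%C * z) ^+ M) ((rho%:C%C * z) ^+ M).
  rewrite subrK Normc.normc1 exprMn ncM -zX nc_expi mulr1.
  have -> : rho%:C%C ^+ M = (rho ^+ M)%:C%C by rewrite rmorphXn.
  rewrite nc_real.
  rewrite ger0_norm ?exprn_ge0// -/rho.
  have := @expr_bernoulli M%:R^-1 M i0 i1; rewrite divff ?gt_eqF// -/rho.
  lra.
apply: le_trans lo _; rewrite ncM ler_wpM2r ?nc_ge0//.
have -> : 1 - rho%:C%C * z = (M%:R^-1)%:C%C + rho%:C%C * z * (expi (- x) - 1).
  rewrite mulrBr -mulrA [z * _]mulrC expiNM mulr1 mulr1 /rho rmorphB rmorph1.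
  by ring.
apply: le_trans (ncD _ _) _; rewrite !ncM !nc_real ger0_norm// nc_expi mulr1 lerD2l.
by rewrite ger0_norm// ler_piMl ?nc_ge0// /rho; lra.
Qed.

Lemma cmean_sum (J : Type) (s : seq J) (F : J -> R -> R[i]) :
  (forall j, L1 (F j)) ->
  cmean (fun x => \sum_(j <- s) F j x) = \sum_(j <- s) cmean (F j).
Proof.
move=> lF.
have l0 : L1 (fun=> 0 : R[i]) by exact: (L1_trigpoly (@trigpoly0 R 0)).
have lS (t : seq J) : L1 (fun x => \sum_(j <- t) F j x).
  elim: t => [|j t IH]; first by under eq_fun do rewrite big_nil.
  by under eq_fun do rewrite big_cons; exact: (L1D (lF j) IH).
elim: s => [|j s IH].
  under eq_fun do rewrite big_nil; rewrite big_nil.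
  by have := cmeanZ 0 l0; rewrite !mul0r.
by rewrite big_cons -IH -(cmeanD (lF j) (lS s)); congr cmean; apply/funext => x; rewrite big_cons.
Qed.

(** The squared modulus is expanded into the double sum [H]; its mean keeps only the diagonal, [M]
    terms of size at most 1. *)
Lemma geom_square M : (0 < M)%N -> (Np 2 (geom M) <= (2 * pi * M%:R)%:E)%E.
Proof.
move=> M0; set rho : R := 1 - M%:R^-1.
have MR : 0 < M%:R :> R by rewrite ltr0n.
have i0 : 0 <= M%:R^-1 :> R by rewrite invr_ge0 ltW.
have i1 : M%:R^-1 <= 1 :> R by rewrite invf_le1// ler1n.
have rho01 : 0 <= rho <= 1 by rewrite /rho; lra.
pose H x := \sum_(k < M) \sum_(l < M)
  (rho ^+ (k + l))%:C%C * expi ((k%:Z - l%:Z)%:~R * x) : R[i].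
have HE x : H x = (nc (geom M x) ^+ 2)%:C%C.
  have -> : (nc (geom M x) ^+ 2)%:C%C = geom M x * (geom M x)^*%C.
    case: (geom M x) => u v /=; rewrite sqr_sqrtr ?addr_ge0 ?sqr_ge0//.
    by simpc; congr Complex; ring.
  have cS (F : 'I_M -> R[i]) : (\sum_(l < M) F l)^*%C = \sum_(l < M) (F l)^*%C.
    exact: rmorph_sum.
  have cM (u v : R[i]) : (u * v)^*%C = u^*%C * v^*%C by exact: rmorphM.
  rewrite /geom cS mulr_suml; apply: eq_bigr => k _.
  rewrite mulr_sumr; apply: eq_bigr => l _.
  rewrite cM exprD rmorphM intrD mulrDl expiD mulrNz mulNr -/rho.
  have -> : (expi (l%:Z%:~R * x))^*%C = expi (- (l%:Z%:~R * x)) :> R[i].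
    by rewrite /expi cosN sinN.
  have -> : ((rho ^+ l)%:C)^*%C = (rho ^+ l)%:C%C :> R[i] by rewrite /= oppr0.
  by ring.
have tE k : trigpoly `|k| (fun x : R => expi (k%:~R * x)) by exact: trigpoly_expi.
have lE (a : R[i]) k : L1 (fun x : R => a * expi (k%:~R * x)).
  exact: (L1Z _ (L1_trigpoly (tE k))).
have lI (k : 'I_M) : L1 (fun x => \sum_(l < M) (rho ^+ (k + l))%:C%C * expi ((k%:Z - l%:Z)%:~R * x)).
  have := @trigpoly_sum R M.*2 'I_M (index_enum _) predT
    (fun l x => (rho ^+ (k + l))%:C%C * expi ((k%:Z - l%:Z)%:~R * x)).
  move=> hh; apply: L1_trigpoly; apply: hh => l _; apply: trigpolyZ.
  by apply: trigpoly_expi; have := ltn_ord k; have := ltn_ord l; lia.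
have cH : cmean H = (\sum_(k < M) rho ^+ (k + k))%:C%C.
  rewrite /H cmean_sum// rmorph_sum/=; apply: eq_bigr => k _.
  rewrite cmean_sum; last by move=> l; exact: lE.
  rewrite (bigD1 k)//= (cmeanZ _ (L1_trigpoly (tE _))) subrr cmean_expi eqxx mulr1.
  rewrite big1 ?addr0// => l lk.
  rewrite (cmeanZ _ (L1_trigpoly (tE _))) cmean_expi subr_eq0.
  case: eqVneq => [kl|]; last by rewrite mulr0.
  by move: lk; rewrite -val_eqE /= => /eqP; lia.
have tG : trigpoly M (geom M).
  apply: trigpoly_sum => k _; apply: trigpolyZ; apply: trigpoly_expi.
  by have := ltn_ord k; lia.
have fin : Np 2 (geom M) \is a fin_num by exact: (Np_trigpoly_fin _ tG).
have eN : Np 2 (geom M) = nper (fun x => complex.Re (H x)).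
  by apply: eq_nper => x; rewrite HE /= powR_mulrn ?nc_ge0.
have t0 := @twopi_gt0 R.
rewrite -(fineK fin) lee_fin.
have : complex.Re (cmean H) <= M%:R.
  rewrite cH /= -[M in leRHS]card_ord -sumr_const; apply: ler_sum => k _.
  by rewrite exprn_ile1//; case/andP: rho01.
rewrite /cmean /= /Rintegral -/(nper (fun x => complex.Re (H x))) -eN.
by rewrite ler_pdivrMl.
Qed.

(* Summation by parts gives |K(x)| <= B min(1, (M |e^(-ix) - 1|)^(-r)); as
   rp >= 2, the p-th power is dominated by |geom M x|^2. *)
Lemma kernel_bound p r S M A c : 0 < p -> 2 <= r%:R * p -> (0 < M)%N -> 0 <= A ->
  (forall k, (S < `|k|)%N -> c k = 0) ->
  (forall k, `|c k| <= A) -> (forall k, `|iter r dlt c k| <= A / M%:R ^+ r) ->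
  (Np p (tp S (fun k => (c k)%:C%C)) <=
    (((S + r).*2.+1%:R * A) `^ p * (16 * (2 * pi) / M%:R))%:E)%E.
Proof.
move=> p0 rp M0 A0 cS cA cD.
have MR : 0 < M%:R :> R by rewrite ltr0n.
set n := (S + r)%N; set B := n.*2.+1%:R * A.
have B0 : 0 <= B by rewrite mulr_ge0.
set K := tp S _.
have KE x : K x = tp n (fun k => (c k)%:C%C) x.
  rewrite /K /tp (@zsum_widen _ S n)//; first by rewrite leq_addr.
  by move=> k hk; rewrite cS// mul0r.
have K1 x : nc (K x) <= B by rewrite KE; exact: nc_tp_real_le.
have K2 x : nc (K x) * (M%:R * nc (expi (- x) - 1)) ^+ r <= B.
  have := @nc_tp_real_le n (iter r dlt c) (A / M%:R ^+ r) x cD.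
  rewrite (@tp_iter_dlt n r S c x cS (leqnn _)) -KE ncM mulrA -/B.
  have -> : nc ((expi (- x) - 1) ^+ r) = nc (expi (- x) - 1) ^+ r.
    by elim: (r) => [|j IH]; rewrite ?Normc.normc1// !exprS ncM IH.
  by rewrite ler_pdivlMr ?exprn_gt0// exprMn; congr (_ <= _); ring.
have tK : trigpoly S K by exact: trigpoly_tp.
have mG : cmeasurable (geom M).
  apply: (@cmeasurable_trigpoly R M); apply: trigpoly_sum => k _.
  by apply: trigpolyZ; apply: trigpoly_expi; have := ltn_ord k; lia.
(* 16 is the product of two factors 4: one in [key], one from squaring [M <= 2 (1 + t) G]. *)
pose cst := B `^ p * (16 / M%:R ^+ 2).
have c0 : 0 <= cst by rewrite mulr_ge0 ?powR_ge0// divr_ge0// exprn_ge0// ltW.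
apply: (@le_trans _ _ (cst%:E * Np 2 (geom M))%E); last first.
  apply: (@le_trans _ _ (cst%:E * (2 * pi * M%:R)%:E)%E).
    by rewrite lee_wpmul2l ?lee_fin//; exact: geom_square.
  rewrite -EFinM lee_fin le_eqVlt; apply/orP; left; apply/eqP; rewrite /cst.
  by move: (pi : R) => q; field; rewrite gt_eqF.
rewrite /Np -nperZ//; last 2 first.
- exact: measurable_ncp.
- by move=> x; exact: powR_ge0.
apply: le_nper.
- exact: (measurable_ncp p (cmeasurable_trigpoly tK)).
- by apply: measurable_funM; [exact: measurable_cst|exact: measurable_ncp].
- by move=> x; exact: powR_ge0.
move=> x; set s := nc (expi (- x) - 1); set G := nc (geom M x).
have s0 : 0 <= s by exact: nc_ge0.
have G0 : 0 <= G by exact: nc_ge0.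
have lo : 2^-1 <= (M%:R^-1 + s) * G by exact: geom_lower.
have lo' : M%:R <= 2 * (1 + M%:R * s) * G.
  have -> : 2 * (1 + M%:R * s) * G = 2 * M%:R * ((M%:R^-1 + s) * G).
    by field; rewrite gt_eqF.
  by rewrite -mulrA -ler_pdivrMl// mulrC ler_wpM2l// ltW.
rewrite powR_mulrn// /cst -[leRHS]mulrA.
set t := M%:R * s; have t0 : 0 <= t by rewrite mulr_ge0// ltW.
(* Near the origin, [t <= 1], the trivial bound [K1] suffices. Beyond, the differenced bound [K2]
   gives [t^(r p)], which is at least [t^2] by the choice of [r]. *)
have key : nc (K x) `^ p * (1 + t) ^+ 2 <= B `^ p * 4.
  have [t1|t1] := leP t 1.
    apply: ler_pM => //; rewrite ?powR_ge0 ?sqr_ge0//.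
      by rewrite ge0_ler_powR ?nnegrE ?nc_ge0 ?(ltW p0).
    by rewrite (_ : 4 = 2 ^+ 2) ?lerXn2r ?nnegrE//; [lra|lra|rewrite expr2; lra].
  have h := K2 x; rewrite -/s -/t in h.
  have h2 : nc (K x) `^ p * t ^+ 2 <= B `^ p.
    apply: (@le_trans _ _ ((nc (K x) * t ^+ r) `^ p)); last first.
      by rewrite ge0_ler_powR ?nnegrE ?(ltW p0)// mulr_ge0 ?nc_ge0 ?exprn_ge0.
    rewrite powRM ?nc_ge0 ?exprn_ge0// ler_wpM2l ?powR_ge0//.
    by rewrite -(powR_mulrn r t0) -powRrM -(powR_mulrn 2 t0) ler_powR// ltW.
  have h3 : (1 + t) ^+ 2 <= 4 * t ^+ 2 by nra.
  rewrite mulrC -ler_pdivlMl; last by nra.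
  rewrite mulrC ler_pdivlMr; last by nra.
  apply: le_trans (ler_wpM2l (powR_ge0 _ _) h3) _; nra.
have h4 : M%:R ^+ 2 <= 4 * (1 + t) ^+ 2 * G ^+ 2.
  have -> : 4 * (1 + t) ^+ 2 * G ^+ 2 = (2 * (1 + t) * G) ^+ 2 by ring.
  have y0 : 0 <= 2 * (1 + t) * G by rewrite !mulr_ge0 ?addr_ge0.
  by apply: lerXn2r; rewrite ?nnegrE ?ler0n.
have M2 : 0 < M%:R ^+ 2 :> R by rewrite exprn_gt0.
have X0 := powR_ge0 (nc (K x)) p.
have h5 := ler_wpM2l X0 h4.
have h6 := ler_wpM2r (sqr_ge0 G) key.
have -> : B `^ p * (16 / M%:R ^+ 2 * G ^+ 2) = 16 * (B `^ p * G ^+ 2) / M%:R ^+ 2.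
  by field; rewrite gt_eqF.
rewrite ler_pdivlMr//; lra.
Qed.

End difference_kernels.

(** * Smooth cutoffs *)

Section smooth_cutoffs.
Context {R : realType}.
Implicit Types (c h psi : int -> R) (A B mu a beta : R) (m r j n M : nat) (k : int).

Lemma iter_dlt_recr j c : iter j dlt (dlt c) = iter j.+1 dlt c.
Proof. by rewrite -iterSr. Qed.

Lemma iter_dlt_shift j c l k : iter j dlt (fun i => c (i + l)) k = iter j dlt c (k + l).
Proof.
elim: j k => [//|j IH] k /=; rewrite /dlt !IH; congr (_ - _).
by congr (iter _ _ _ _); rewrite addrAC.
Qed.

Lemma iter_dltZB j (u : R) c c' k :
  iter j dlt (fun i => u * (c i - c' i)) k = u * (iter j dlt c k - iter j dlt c' k).
Proof. by elim: j k => [//|j IH] k /=; rewrite /dlt !IH; ring. Qed.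

Lemma iter_dltB j c c' k :
  iter j dlt (fun i => c i - c' i) k = iter j dlt c k - iter j dlt c' k.
Proof. by elim: j k => [//|j IH] k /=; rewrite /dlt !IH; ring. Qed.

Lemma iter_dltD j c c' k :
  iter j dlt (fun i => c i + c' i) k = iter j dlt c k + iter j dlt c' k.
Proof. by elim: j k => [//|j IH] k /=; rewrite /dlt !IH; ring. Qed.

(* The support of psi lets the factor h be controlled only beyond m0. *)
Lemma dlt_leibniz r (m0 : int) psi h A B mu : 0 < mu -> 0 <= A -> 0 <= B ->
  (forall k, k <= m0 -> psi k = 0) ->
  (forall j k, (j <= r)%N -> `|iter j dlt psi k| <= B / mu ^+ j) ->
  (forall j k, (j <= r)%N -> m0 < k -> `|iter j dlt h k| <= A / mu ^+ j) ->
  forall k, `|iter r dlt (fun i => psi i * h i) k| <= 2 ^+ r * (A * B) / mu ^+ r.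
Proof.
move=> mu0; elim: r m0 psi h A B => [|r IH] m0 psi h A B A0 B0 ps Dp Dh k.
  rewrite /= expr0 mul1r divr1 normrM.
  have [km|km] := leP k m0; first by rewrite ps// normr0 mul0r mulr_ge0.
  have := Dp 0%N k isT; have := Dh 0%N k isT km; rewrite /= !divr1 => h1 h2.
  by rewrite mulrC ler_pM.
rewrite -iter_dlt_recr.
have -> : dlt (fun i => psi i * h i) =
    fun i => dlt psi i * h (i + 1) + psi i * dlt h i.
  by apply/funext => i; rewrite /dlt; ring.
rewrite iter_dltD.
have d0 C : 0 <= C -> 0 <= C / mu by move=> C0; rewrite divr_ge0// ltW.
have de C j : C / mu ^+ j.+1 = C / mu / mu ^+ j.
  by rewrite exprS invfM mulrA.
have H1 := IH (m0 - 1) (dlt psi) (fun i => h (i + 1)) A (B / mu) A0 (d0 _ B0) _ _ _ k.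
have H2 := IH m0 psi (dlt h) (A / mu) B (d0 _ A0) B0 ps _ _ k.
apply: (le_trans (ler_normD _ _)).
have -> : 2 ^+ r.+1 * (A * B) / mu ^+ r.+1 =
    2 ^+ r * (A * (B / mu)) / mu ^+ r + 2 ^+ r * (A / mu * B) / mu ^+ r.
  by rewrite !exprS; field; rewrite expf_neq0 gt_eqF.
apply: lerD.
- apply: H1 => [i im|j i jr|j i jr im].
  + by rewrite /dlt !ps ?subrr//; lia.
  + by rewrite iter_dlt_recr -de; apply: Dp.
  + by rewrite iter_dlt_shift; apply: Dh; [exact: leqW|lia].
- apply: H2 => [j i jr|j i jr im].
  + by apply: Dp; exact: leqW.
  + by rewrite iter_dlt_recr -de; apply: Dh.
Qed.

Definition avg m c k : R := m%:R^-1 * \sum_(i < m) c (k + i%:Z).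

Lemma dlt_avg m c : (0 < m)%N ->
  dlt (avg m c) = fun k => m%:R^-1 * (c (k + m%:Z) - c k).
Proof.
move=> m0; apply/funext => k; rewrite /dlt /avg -mulrBr; congr (_ * _).
case: m m0 => // m _.
rewrite [X in X - _]big_ord_recr [X in _ - X]big_ord_recl /=.
have -> : \sum_(i < m) c (k + 1 + i%:Z) = \sum_(i < m) c (k + (bump 0 i)%:Z).
  by apply: eq_bigr => i _; congr c; rewrite /bump/=; lia.
rewrite (_ : k + 1 + m%:Z = k + m.+1%:Z); last by lia.
by rewrite addr0; ring.
Qed.

(* Each averaging step over m consecutive integers gains one difference of
   size 1/m, so cut r m turns a step into a cutoff smooth to order r. *)
Definition cut r m c : int -> R := iter r (avg m) c.

(** The difference of an average is [(c (k + m) - c k) / m], so every difference uses up one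
    averaging step and costs a factor [2 / m]; the remaining averages do not increase the bound. *)
Lemma cut_bound r m c : (0 < m)%N -> (forall k, `|c k| <= 1) ->
  forall j k, (j <= r)%N -> `|iter j dlt (cut r m c) k| <= (2 / m%:R) ^+ j.
Proof.
move=> m0 c1; have mR : 0 < m%:R :> R by rewrite ltr0n.
elim: r => [|r IH] j k; first by rewrite leqn0 => /eqP -> /=.
case: j => [_|j jr].
  rewrite /= /avg normrM gtr0_norm ?invr_gt0// ler_pdivrMl// mulr1.
  apply: le_trans (ler_norm_sum _ _ _) _.
  rewrite -[m in leRHS]card_ord -sumr_const; apply: ler_sum => i _.
  exact: (IH 0%N).
rewrite -iter_dlt_recr /= dlt_avg// iter_dltZB iter_dlt_shift.
rewrite normrM gtr0_norm ?invr_gt0// ler_pdivrMl//.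
apply: le_trans (ler_normB _ _) _.
have -> : m%:R * (2 / m%:R) ^+ j.+1 = (2 / m%:R) ^+ j + (2 / m%:R) ^+ j :> R.
  by rewrite exprS; field; rewrite gt_eqF.
by apply: lerD; apply: IH.
Qed.

(** The averages look forward only: [r] of them see the points from [k] to [k + r (m - 1)]. *)
Lemma cut_cst r m c k (v : R) : (0 < m)%N ->
  (forall i, (i <= r * m.-1)%N -> c (k + i%:Z) = v) -> cut r m c k = v.
Proof.
move=> m0; have mR : 0 < m%:R :> R by rewrite ltr0n.
elim: r k => [|r IH] k H; first by have := H 0%N isT; rewrite addr0.
rewrite /= /avg (eq_bigr (fun=> v)); last first.
  move=> i _; apply: IH => l lr; rewrite -addrA -PoszD; apply: H.
  by have := ltn_ord i; rewrite mulSn; lia.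
by rewrite sumr_const card_ord -[v *+ m]mulr_natl mulrA mulVf ?mul1r ?gt_eqF.
Qed.

Definition dltR (F : R -> R) x : R := F (x + 1) - F x.

(** The rising factorial of [beta] of length [j], the constant in the j-th derivative of
    [t^(-beta)]. *)
Fixpoint powc j beta : R := if j is j'.+1 then beta * powc j' (beta + 1) else 1.

Lemma powc_ge0 j beta : 0 <= beta -> 0 <= powc j beta.
Proof.
elim: j beta => [//|j IH] beta b0 /=; rewrite mulr_ge0// IH//.
by rewrite addr_ge0.
Qed.

Lemma is_derive_dltR_pow j beta (x : R) : 0 < x ->
  is_derive x 1 (iter j dltR (fun t => t `^ (- beta)))
    (- beta * iter j dltR (fun t => t `^ (- (beta + 1))) x).
Proof.
elim: j x => [|j IH] x x0 /=.
  apply: is_derive_eq; first exact: is_derive1_powR.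
  by rewrite opprD.
have h1 := IH x x0.
have x10 : 0 < x + 1 by rewrite addr_gt0.
have h2 := IH (x + 1) x10.
have h4 : is_derive x 1 (fun t : R => t + 1) 1.
  by apply: is_derive_eq; rewrite addr0.
have h5 := @is_derive1_comp R _ (fun t : R => t + 1) x _ _ h2 h4.
rewrite mulr1 in h5.
have h6 := is_deriveB h5 h1.
by rewrite {2}/dltR mulrBr; exact: h6.
Qed.

(** Differencing commutes with differentiation, so the mean value theorem trades one difference for
    a factor [- beta] and the exponent [beta + 1], at an intermediate point to the right of [x]. The
    induction on [j] therefore lets [beta] vary. *)
Lemma iter_dltR_pow_bound j beta (x : R) : 0 <= beta -> 0 < x ->
  `|iter j dltR (fun t => t `^ (- beta)) x| <= powc j beta * x `^ (- (beta + j%:R)).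
Proof.
elim: j beta x => [|j IH] beta x b0 x0.
  by rewrite /= addr0 mul1r ger0_norm ?powR_ge0.
rewrite /= /dltR; set G := iter j dltR _.
have dG y : y \in `]x, x + 1[ ->
    is_derive y 1 G (- beta * iter j dltR (fun t => t `^ (- (beta + 1))) y).
  rewrite in_itv/= => /andP[xy _]; apply: is_derive_dltR_pow; exact: lt_trans xy.
have cG : {within `[x, x + 1], continuous G}.
  apply: derivable_within_continuous => y; rewrite in_itv/= => /andP[xy _].
  have := @is_derive_dltR_pow j beta y (lt_le_trans x0 xy).
  by move=> [].
have [|xi] := MVT _ dG cG; first by rewrite ltrDl.
rewrite in_itv/= => /andP[xxi _] ->; rewrite addrAC subrr add0r mulr1.
have xi0 : 0 < xi := lt_trans x0 xxi.
rewrite normrM normrN (ger0_norm b0) -mulrA ler_wpM2l//.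
apply: le_trans (IH (beta + 1) xi (addr_ge0 b0 ler01) xi0) _.
rewrite ler_wpM2l ?powc_ge0 ?addr_ge0//.
rewrite -addrA [1 + _]addrC natr1 !powRN lef_pV2 ?posrE ?powR_gt0//.
by rewrite ge0_ler_powR ?nnegrE ?addr_ge0// ltW.
Qed.

(** For [k <= 0] this is a default value of the real power; in the kernels it is multiplied by
    [psi], which vanishes there. *)
Definition intpow beta k : R := (k%:~R) `^ (- beta).

Lemma iter_dlt_intpow j beta k :
  iter j dlt (intpow beta) k = iter j dltR (fun t => t `^ (- beta)) k%:~R.
Proof.
elim: j k => [//|j IH] k /=; rewrite /dlt /dltR !IH.
by rewrite intrD.
Qed.

End smooth_cutoffs.

(** * Smooth dyadic blocks of frequencies *)

Section frequency_cutoffs.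
Context {R : realType}.
Variable r : nat.
Implicit Types (n M j : nat) (k : int).

(** A one-sided cutoff, equal to 1 on all negative integers. With this window, [r] averages look
    ahead by [r * (n / (r + 1))], so the descent from 1 to 0 takes place between [n / (r + 1)] and
    [n]. *)
Definition chi n : int -> R := cut r (n %/ r.+1).+1 (fun k => (nat_of_bool (k <= n%:Z)%R)%:R).

Lemma chi_gt n k : n%:Z < k -> chi n k = 0.
Proof.
move=> nk; apply: cut_cst => // i _.
by rewrite (_ : (_ <= _) = false)//; apply/negbTE; rewrite -ltNge; lia.
Qed.

Lemma chi_le n k : k <= (n %/ r.+1)%:Z -> chi n k = 1.
Proof.
move=> nk; apply: cut_cst => // i; rewrite /= => ir.
rewrite (_ : (_ <= _) = true)//.
have := leq_divM n r.+1; rewrite mulnS mulnC => h.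
by lia.
Qed.

Lemma chi_diff n j k : (0 < n)%N -> (j <= r)%N ->
  `|iter j dlt (chi n) k| <= (2 * r.+1%:R) ^+ r / n%:R ^+ j.
Proof.
move=> n0 jr; have nR : 0 < n%:R :> R by rewrite ltr0n.
have c1 l : `|(nat_of_bool (l <= n%:Z)%R)%:R : R| <= 1 by case: (l <= _); rewrite ?normr1 ?normr0.
have m0 : (0 < (n %/ r.+1).+1)%N by [].
apply: le_trans (cut_bound m0 c1 k jr) _.
have q : 2 / (n %/ r.+1).+1%:R <= 2 * r.+1%:R / n%:R :> R.
  rewrite -mulrA ler_wpM2l// ler_pdivlMr// mulrC ler_pdivrMr// -natrM ler_nat.
  by rewrite mulnC ltnW// ltn_ceil.
apply: (@le_trans _ _ ((2 * r.+1%:R / n%:R) ^+ j)).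
  by apply: lerXn2r => //; rewrite nnegrE ?divr_ge0 ?mulr_ge0 ?ler0n.
rewrite expr_div_n ler_wpM2r ?invr_ge0 ?exprn_ge0// ler_weXn2l//.
by rewrite -natrM ler1n muln_gt0.
Qed.

(** The subtraction removes the negative frequencies and makes the blocks telescope along
    [M = 2^i n]. *)
Definition psi M k : R := chi (2 * M) k - chi M k.

Lemma psi_le M k : k <= (M %/ r.+1)%:Z -> psi M k = 0.
Proof.
move=> kM; rewrite /psi !chi_le ?subrr//.
by apply: le_trans kM _; rewrite lez_nat leq_div2r// leq_pmull.
Qed.

Lemma psi_gt M k : (2 * M)%:Z < k -> psi M k = 0.
Proof. by move=> kM; rewrite /psi !chi_gt ?subrr//; lia. Qed.

Lemma psi_le0 M k : k <= 0 -> psi M k = 0.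
Proof. by move=> k0; apply: psi_le; apply: le_trans k0 _. Qed.

Lemma psi_supp M k : (2 * M < `|k|)%N -> psi M k = 0.
Proof.
move=> kM; have [k0|k0] := leP k 0; first exact: psi_le0.
by apply: psi_gt; lia.
Qed.

Lemma psi_diff M j k : (0 < M)%N -> (j <= r)%N ->
  `|iter j dlt (psi M) k| <= 2 * (2 * r.+1%:R) ^+ r / M%:R ^+ j.
Proof.
move=> M0 jr; have MR : 0 < M%:R :> R by rewrite ltr0n.
rewrite iter_dltB; apply: le_trans (ler_normB _ _) _.
have M20 : (0 < 2 * M)%N by rewrite muln_gt0.
have h1 := chi_diff k M20 jr; have h2 := chi_diff k M0 jr.
rewrite -mulrA mulr_natl mulr2n; apply: lerD => //.
apply: le_trans h1 _; rewrite ler_wpM2l ?exprn_ge0 ?mulr_ge0//.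
rewrite lef_pV2 ?posrE ?exprn_gt0 ?ltr0n//.
by apply: lerXn2r; rewrite ?nnegrE ?ler0n// ler_nat leq_pmull.
Qed.

End frequency_cutoffs.

Lemma half_kernel_degree M r : (0 < M)%N -> ((2 * M + r).*2.+1 <= (5 + 2 * r) * M)%N.
Proof. by move=> M0; rewrite mulnDl -mulnA; have := leq_pmulr r M0; lia. Qed.

(** * Kernels of fractional integration *)

Section fractional_kernels.
Context {R : realType}.
Variables (p alpha : R) (r : nat).
Hypotheses (p0 : 0 < p) (p1 : p <= 1) (alpha0 : 0 < alpha) (rp : 2 <= r%:R * p).
Implicit Types (n M N J i j : nat) (k : int).
Local Notation chi := (@chi R r).
Local Notation psi := (@psi R r).

(** One constant for all orders [j <= r]: each summand is the bound for the j-th difference of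
    [k^(-alpha)] at [k >= M / (r + 1)], relative to [M^(-alpha-j)]. *)
Definition fpc : R := \sum_(j < r.+1) powc j alpha * r.+1%:R `^ (alpha + j%:R).

Lemma fpc_ge0 : 0 <= fpc.
Proof.
by apply: sumr_ge0 => j _; rewrite mulr_ge0 ?powR_ge0 ?powc_ge0 ?ltW.
Qed.

Lemma intpow_diff M j k : (0 < M)%N -> (j <= r)%N -> (M %/ r.+1)%:Z < k ->
  `|iter j dlt (intpow alpha) k| <= fpc * M%:R `^ (- alpha) / M%:R ^+ j.
Proof.
move=> M0 jr Mk; have MR : 0 < M%:R :> R by rewrite ltr0n.
have k0 : 0 < k by apply: le_lt_trans Mk.
have kR : 0 < k%:~R :> R by rewrite ltr0z.
have rR : 0 < r.+1%:R :> R by rewrite ltr0n.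
have Mk' : M%:R / r.+1%:R <= k%:~R :> R.
  rewrite ler_pdivrMr//; have -> : k = `|k|%N%:Z by lia.
  rewrite -pmulrn -natrM ler_nat ltnW//; apply: leq_trans (ltn_ceil M (ltn0Sn r)) _.
  by rewrite leq_mul2r; apply/orP; right; lia.
rewrite iter_dlt_intpow; apply: le_trans (iter_dltR_pow_bound _ (ltW alpha0) kR) _.
have e : M%:R `^ (- alpha) / M%:R ^+ j = M%:R `^ (- (alpha + j%:R)) :> R.
  rewrite opprD powRD; last by rewrite (gt_eqF MR) implybT.
  by rewrite powR_invn ?ler0n.
rewrite -mulrA e.
have jr' : (j < r.+1)%N by [].
apply: (@le_trans _ _ (powc j alpha * r.+1%:R `^ (alpha + j%:R) * M%:R `^ (- (alpha + j%:R)))).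
  rewrite -mulrA ler_wpM2l ?powc_ge0 ?(ltW alpha0)//.
  have -> : r.+1%:R `^ (alpha + j%:R) * M%:R `^ (- (alpha + j%:R)) =
      (M%:R / r.+1%:R) `^ (- (alpha + j%:R)) :> R.
    rewrite powRM ?invr_ge0 ?ler0n// mulrC; congr (_ * _).
    by rewrite -powR_inv1 ?ler0n// -powRrM mulN1r opprK.
  rewrite !powRN lef_pV2 ?posrE ?powR_gt0 ?divr_gt0//.
  by rewrite ge0_ler_powR ?nnegrE ?addr_ge0 ?divr_ge0 ?(ltW alpha0) ?ler0n ?(ltW kR).
rewrite ler_wpM2r ?powR_ge0// /fpc (bigD1 (Ordinal jr'))//= lerDl.
by apply: sumr_ge0 => i _; rewrite mulr_ge0 ?powR_ge0 ?powc_ge0 ?ltW.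
Qed.

(** The block of (ik)^(-alpha) on positive frequencies without its constant phase, hence a real
    sequence. *)
Definition half_coef M k : R := psi M k * intpow alpha k.

(** [kernel_bound] with amplitude [D * M^(-alpha)], the differences being controlled by the Leibniz
    rule. About [M] frequencies contribute, and [(M * M^(-alpha))^p / M] is the power in the
    statement. *)
Lemma half_kernel_bound : exists C : R, 0 < C /\ forall M, (0 < M)%N ->
  (Np p (tp (2 * M) (fun k => (half_coef M k)%:C%C)) <=
   (C * M%:R `^ ((1 - alpha) * p - 1))%:E)%E.
Proof.
pose B : R := 2 * (2 * r.+1%:R) ^+ r.
have B1 : 1 <= (2 * r.+1%:R) ^+ r :> R by rewrite exprn_ege1// -natrM ler1n.
pose D := 2 ^+ r * (fpc * B) + 1.
have f0 := fpc_ge0.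
have D0 : 0 < D.
  by rewrite /D ltr_wpDl// !mulr_ge0// ?exprn_ge0// (le_trans ler01).
exists (((5 + 2 * r)%:R * D) `^ p * (16 * (2 * pi))); split.
  by rewrite !mulr_gt0 ?powR_gt0 ?mulr_gt0 ?ltr0n ?pi_gt0.
move=> M M0; have MR : 0 < M%:R :> R by rewrite ltr0n.
set Ma := M%:R `^ (- alpha); have Ma0 : 0 <= Ma by exact: powR_ge0.
have B0 : 0 <= B by rewrite /B; lra.
have AM0 : 0 <= fpc * Ma by rewrite mulr_ge0.
have DMa : 2 ^+ r * (fpc * Ma * B) <= D * Ma.
  by rewrite /D mulrDl mul1r (_ : 2 ^+ r * (fpc * Ma * B) = 2 ^+ r * (fpc * B) * Ma) ?lerDl//; ring.
have supp k : (2 * M < `|k|)%N -> half_coef M k = 0.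
  by move=> kM; rewrite /half_coef psi_supp ?mul0r.
have le1 k : `|half_coef M k| <= D * Ma.
  apply: le_trans DMa; have [km|km] := leP k (M %/ r.+1)%:Z.
    by rewrite /half_coef psi_le// mul0r normr0 !mulr_ge0 ?exprn_ge0.
  have h1 := @psi_diff R r M 0 k M0 isT; have h2 := @intpow_diff M 0 k M0 isT km.
  rewrite /= !divr1 in h1 h2; rewrite normrM.
  apply: (@le_trans _ _ (fpc * Ma * B)).
    by rewrite mulrC ler_pM.
  by rewrite ler_peMl ?mulr_ge0// exprn_ege1// ler1n.
have le2 k : `|iter r dlt (half_coef M) k| <= D * Ma / M%:R ^+ r.
  apply: (@le_trans _ _ (2 ^+ r * (fpc * Ma * B) / M%:R ^+ r)).
    apply: (@dlt_leibniz R r (M %/ r.+1)%:Z) => //.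
    - by move=> *; exact: psi_le.
    - by move=> j i jr; exact: psi_diff.
    - by move=> j i jr ir; exact: intpow_diff.
  by rewrite ler_wpM2r// invr_ge0 exprn_ge0// ltW.
have DMa0 : 0 <= D * Ma by rewrite mulr_ge0// ltW.
apply: le_trans (kernel_bound p0 rp M0 DMa0 supp le1 le2) _.
rewrite lee_fin.
have -> : M%:R `^ ((1 - alpha) * p - 1) = (M%:R * Ma) `^ p / M%:R.
  have -> : M%:R * Ma = M%:R `^ (1 - alpha).
    by rewrite powRD ?(gt_eqF MR) ?implybT// powRr1 ?ler0n.
  by rewrite -powRrM powRD ?(gt_eqF MR) ?implybT// powR_inv1 ?ler0n.
have -> : ((5 + 2 * r)%:R * D) `^ p * (16 * (2 * pi)) * ((M%:R * Ma) `^ p / M%:R) =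
    (((5 + 2 * r)%:R * M%:R) * (D * Ma)) `^ p * (16 * (2 * pi) / M%:R).
  have -> : (5 + 2 * r)%:R * M%:R * (D * Ma) = ((5 + 2 * r)%:R * D) * (M%:R * Ma) by ring.
  by rewrite [in RHS]powRM ?mulr_ge0 ?ler0n ?(ltW D0)//; ring.
rewrite ler_wpM2r ?divr_ge0 ?mulr_ge0 ?pi_ge0 ?ler0n//.
rewrite ge0_ler_powR ?nnegrE ?(ltW p0) ?mulr_ge0 ?ler0n ?(ltW D0)//.
rewrite ler_wpM2r// -natrM ler_nat.
exact: half_kernel_degree.
Qed.

Definition ikinv k : R[i] :=
  Complex (`|k|%:~R `^ (- alpha)) 0 * expi (- (alpha * pi / 2 * (sgz k)%:~R)).

Lemma ikinvK k : k != 0 -> ikinv k * ik_pow alpha k = 1.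
Proof.
move=> k0; have kR : 0 < `|k|%:~R :> R by rewrite ltr0z normr_gt0.
rewrite /ikinv /ik_pow mulrACA expiNM mulr1.
rewrite -[Complex _ 0]/((`|k|%:~R `^ (- alpha) : R)%:C)%C.
rewrite -[Complex (_ `^ alpha) 0]/((`|k|%:~R `^ alpha : R)%:C)%C -rmorphM.
by rewrite powRN mulVf// gt_eqF// powR_gt0.
Qed.

Definition kap M k : R[i] := (psi M `|k|)%:C%C * ikinv k.

Lemma zsum_opp (n : nat) (h : int -> R[i]) : zsum n (fun k => h (- k)) = zsum n h.
Proof.
elim: n => [|n IH]; first by rewrite !zsum0 oppr0.
by rewrite !zsumS IH opprK; ring.
Qed.

Lemma nc_conj (z : R[i]) : nc (z^*%C) = nc z.
Proof. by case: z => a b /=; rewrite sqrrN. Qed.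

(** The negative half of a kernel is thereby the conjugate of the positive half, with the same
    [Np]. *)
Lemma tp_opp_conj (n : nat) (c : int -> R) x :
  tp n (fun k => (c (- k))%:C%C) x = (tp n (fun k => (c k)%:C%C) x)^*%C.
Proof.
rewrite /tp -[LHS]zsum_opp.
have cS (m : nat) (F : 'I_m -> R[i]) : (\sum_(l < m) F l)^*%C = \sum_(l < m) (F l)^*%C.
  exact: rmorph_sum.
have cM (u v : R[i]) : (u * v)^*%C = u^*%C * v^*%C by exact: rmorphM.
rewrite /zsum cS; apply: eq_bigr => j _; rewrite cM opprK; congr (_ * _).
  by rewrite /= oppr0.
by rewrite mulrNz mulNr /expi cosN sinN.
Qed.

(** At most one of the two terms is nonzero, because [psi] vanishes at non-positive arguments; the
    sign of [k] then fixes the phase. *)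
Lemma kapE M k : kap M k =
  (half_coef M k)%:C%C * expi (- (alpha * pi / 2)) +
  (half_coef M (- k))%:C%C * expi (alpha * pi / 2).
Proof.
rewrite /kap /ikinv /half_coef /intpow; case: (ltrgtP k 0) => k0.
- rewrite (@psi_le0 R r _ k (ltW k0)).
  rewrite mul0r rmorph0 mul0r add0r ltr0_norm// ltr0_sgz// mulrN1 opprK mulrA.
  by rewrite rmorphM.
- rewrite (@psi_le0 R r _ (- k)); last by rewrite oppr_le0 ltW.
  rewrite mul0r rmorph0 mul0r addr0 gtr0_norm// gtr0_sgz// mulr1 mulrA.
  by rewrite rmorphM.
- by rewrite k0 normr0 oppr0 !psi_le// !mul0r ?addr0.
Qed.

Lemma kap_kernel_bound : exists C : R, 0 < C /\ forall M N, (0 < M)%N ->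
  (2 * M <= N)%N ->
  (Np p (tp N (kap M)) <= (C * M%:R `^ ((1 - alpha) * p - 1))%:E)%E.
Proof.
have [C [C0 HC]] := half_kernel_bound.
exists (2 * C); split; first by rewrite mulr_gt0.
move=> M N M0 MN; set F := tp (2 * M) (fun k => (half_coef M k)%:C%C).
have -> : tp N (kap M) = fun x => expi (- (alpha * pi / 2)) * F x +
    expi (alpha * pi / 2) * (F x)^*%C.
  apply/funext => x; rewrite -tp_opp_conj /F /tp -!zsumZl -zsumD.
  rewrite (@zsum_widen _ (2 * M) N)//.
    by apply: eq_zsum => k _; rewrite kapE; ring.
  move=> k kM; rewrite kapE /half_coef.
  by rewrite !psi_supp ?abszN// !mul0r ?addr0 ?mul0r.
have tF : trigpoly (2 * M) F by exact: trigpoly_tp.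
have mF := cmeasurable_trigpoly tF.
have tG : trigpoly (2 * M) (fun x => (F x)^*%C).
  have -> : (fun x => (F x)^*%C) = tp (2 * M) (fun k => (half_coef M (- k))%:C%C).
    by apply/funext => x; rewrite -tp_opp_conj.
  exact: trigpoly_tp.
have mG := cmeasurable_trigpoly tG.
apply: le_trans (NpD p0 p1 _ _) _.
- exact: (cmeasurable_trigpoly (trigpolyZ _ tF)).
- exact: (cmeasurable_trigpoly (trigpolyZ _ tG)).
rewrite !NpZ// !nc_expi powR1 !mul1e.
have -> : Np p (fun x => (F x)^*%C) = Np p F.
  by apply: eq_nper => x; rewrite nc_conj.
rewrite -mulrA mulr_natl mulr2n EFinD.
by apply: leeD; exact: HC.
Qed.

Definition ker n J k : R[i] := \sum_(i < J) kap (2 ^ i * n) k.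

(** The blocks telescope. On frequencies up to [2^J n / (r + 1)] the first cutoff is 1, so there
    [ker] is (ik)^(-alpha) minus its smooth truncation of order [n]. *)
Lemma kerE n J k : ker n J k = (chi (2 ^ J * n) `|k| - chi n `|k|)%:C%C * ikinv k.
Proof.
rewrite /ker /kap -mulr_suml -rmorph_sum; congr (_%:C%C * _).
elim: J => [|J IH]; first by rewrite big_ord0 mul1n subrr.
by rewrite big_ord_recr /= IH /psi mulnA -expnS addrC addrA subrK.
Qed.

(** The exponent [(1 - alpha) p - 1] is negative, as [p <= 1] and [alpha > 0]. The blocks thus decay
    geometrically, the first one dominates, and the bound does not depend on [J]. *)
Lemma ker_bound : exists C : R, 0 < C /\ forall n J N, (0 < n)%N ->
  (2 ^ J * n <= N)%N ->
  (Np p (tp N (ker n J)) <= (C * n%:R `^ ((1 - alpha) * p - 1))%:E)%E.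
Proof.
have [C [C0 HC]] := kap_kernel_bound.
set e := (1 - alpha) * p - 1.
have e0 : e < 0.
  rewrite /e subr_lt0 mulrBl mul1r ltrBlDr; apply: le_lt_trans p1 _.
  by rewrite ltrDl mulr_gt0.
pose q : R := 2 `^ e.
have q0 : 0 < q by rewrite powR_gt0.
have q1 : q < 1.
  have := @gt0_ltr_powR R (- e); rewrite oppr_gt0 => /(_ e0 1 2).
  rewrite !nnegrE ler01 ler0n ltr1n powR1 => /(_ isT isT isT).
  by rewrite powRN -/q invf_gt1.
exists (C / (1 - q)); split; first by rewrite divr_gt0// subr_gt0.
move=> n J N n0 JN.
have nR : 0 < n%:R :> R by rewrite ltr0n.
have -> : tp N (ker n J) = fun x => \sum_(i < J) tp N (kap (2 ^ i * n)) x.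
  apply/funext => x; rewrite /tp /zsum exchange_big; apply: eq_bigr => j _.
  by rewrite mulr_suml.
apply: le_trans (Np_sum _ p0 p1 _) _.
  by move=> i; exact: (cmeasurable_trigpoly (trigpoly_tp _ _)).
apply: (@le_trans _ _ (\sum_(i < J) (C * n%:R `^ e * q ^+ i)%:E)%E).
  apply: lee_sum => i _; apply: le_trans (HC _ _ _ _) _.
  - by rewrite muln_gt0 expn_gt0.
  - apply: leq_trans JN; rewrite mulnA -expnS leq_mul2r leq_exp2l// (ltn_ord i).
    by rewrite orbT.
  rewrite lee_fin natrM powRM ?ler0n// natrX.
  rewrite -powR_mulrn// -powRrM mulrC -[q ^+ i](powR_mulrn _ (ltW q0)) /q -powRrM.
  by rewrite le_eqVlt; apply/orP; left; apply/eqP; rewrite (mulrC e); ring.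
rewrite sumEFin lee_fin -mulr_sumr -mulrA [X in _ <= C * X]mulrC mulrA ler_wpM2l//.
  by rewrite mulr_ge0 ?powR_ge0 ?ltW.
rewrite -[leRHS]mul1r ler_pdivlMr ?subr_gt0// mulrC -opprB mulNr -subrX1 opprB.
by rewrite gerBl exprn_ge0 ?ltW.
Qed.

End fractional_kernels.

(** * Fractional integrals as convolutions with the kernels *)

Section fractional_approximation.
Context {R : realType}.
Implicit Types (f g u w P Q : R -> R[i]) (n N J i j : nat) (k : int).

Definition iw (alpha : R) k : R[i] := if k == 0 then 0 else ikinv alpha k.

(** The condition on [J] makes the outer cutoff equal to 1 on the spectrum of [a]. At [k = 0] both
    sides vanish, since [iw] is zero and the two cutoffs agree there. *)
Lemma low_pass_difference (alpha : R) r n N J (a : int -> R[i]) x :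
  (0 < n)%N -> (N * r.+1 <= 2 ^ J * n)%N ->
  (forall k, (N < `|k|)%N -> a k = 0) ->
  tp N (fun k => iw alpha k * a k) x -
    tp n (fun k => (chi r n `|k|)%:C%C * (iw alpha k * a k)) x =
  tp (2 ^ J * n) (fun k => a k * ker alpha r n J k) x.
Proof.
move=> n0 NJ aN.
have NJ' : (N <= 2 ^ J * n)%N.
  by apply: leq_trans NJ; rewrite leq_pmulr.
have nJ : (n <= 2 ^ J * n)%N by rewrite leq_pmull// expn_gt0.
rewrite /tp -(@zsum_widen _ N _ _ NJ'); last first.
  by move=> k kN; rewrite aN// mulr0 mul0r.
rewrite -(@zsum_widen _ n _ _ nJ); last first.
  move=> k kn; rewrite chi_gt; last by lia.
  by rewrite !mul0r.
rewrite -zsumB; apply: eq_zsum => k kN.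
have [Nk|Nk] := ltnP N `|k|; first by rewrite aN// !(mulr0, mul0r) subrr.
rewrite kerE [chi r (2 ^ J * n) _]chi_le; last first.
  rewrite -abszE lez_nat leq_divRL//.
  by apply: leq_trans NJ; rewrite leq_mul2r Nk orbT.
rewrite /iw; case: eqVneq => [->|k0].
  by rewrite normr0 chi_le// subrr rmorph0 !(mulr0, mul0r) subrr.
by rewrite rmorphB rmorph1; ring.
Qed.

(** The approximant is the low-pass part of the fractional integral. Convolution costs
    [(2^i n)^(1-p)] up to a constant, the kernel contributes [n^((1-alpha)p-1)], and the exponents
    of [n] add up to [- alpha p]. *)
Lemma fractional_integral_approx (p alpha : R) : 0 < p -> p <= 1 -> 0 < alpha ->
  exists C : R, 0 < C /\ forall n i P, (0 < n)%N -> trigpoly (2 ^ i * n) P ->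
    exists Q, trigpoly n Q /\
    (Np p (fun x => tp (2 ^ i * n) (fun k => iw alpha k * fourier_coef P k) x - Q x)%R
      <= (C * n%:R `^ (- (alpha * p)) * (2 ^+ i) `^ (1 - p))%:E * Np p P)%E.
Proof.
move=> p0 p1 alpha0.
have [r rp] : exists r : nat, 2 <= r%:R * p.
  by exists (Num.truncn (2 / p)).+1; rewrite -ler_pdivrMr// ltW// truncnS_gt.
have [C [C0 HC]] := ker_bound p0 p1 alpha0 rp.
exists ((5 * 2 ^+ r.+1) `^ (1 - p) * C); split.
  by rewrite mulr_gt0// powR_gt0// mulr_gt0// exprn_gt0.
move=> n i P n0 tP; have nR : 0 < n%:R :> R by rewrite ltr0n.
(* The extra [r + 1] doublings absorb the factor [r + 1] lost in the transition of [chi], as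
   [r + 1 <= 2^(r+1)]. *)
set N := (2 ^ i * n)%N; pose J := (i + r.+1)%N.
have NJ : (N * r.+1 <= 2 ^ J * n)%N.
  by rewrite /N /J expnD mulnAC leq_mul2r leq_mul2l (ltnW (ltn_expl _ _)) ?orbT.
have NJ' : (N <= 2 ^ J * n)%N by apply: leq_trans NJ; rewrite leq_pmulr.
have aN k : (N < `|k|)%N -> fourier_coef P k = 0.
  by move=> kN; rewrite (tp_fourier_coef tP) fourier_coef_tp leqNgt kN.
exists (tp n (fun k => (chi r n `|k|)%:C%C * (iw alpha k * fourier_coef P k))).
split; first exact: trigpoly_tp.
under eq_fun do rewrite (@low_pass_difference alpha r n N J _ _ n0 NJ aN).
apply: le_trans (Np_convolution _ p0 p1 (trigpoly_widen NJ' tP)) _.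
rewrite muleCA mulrC -!mulrA.
have hK := HC n J (2 ^ J * n)%N n0 (leqnn _).
apply: (@le_trans _ _ (Np p P *
   (((2 ^ J * n).*2.*2.+1%:R `^ (1 - p))%:E * (C * n%:R `^ ((1 - alpha) * p - 1))%:E))%E).
  rewrite lee_wpmul2l ?Np_ge0// lee_wpmul2l ?lee_fin ?powR_ge0//.
rewrite muleC lee_wpmul2r ?Np_ge0// -EFinM lee_fin.
(* The 5 comes from [4 X + 1 <= 5 X] with [X = 2^J n >= 1]. *)
have e1 : (2 ^ J * n).*2.*2.+1%:R `^ (1 - p) <=
    (5 * 2 ^+ r.+1) `^ (1 - p) * ((2 ^+ i) `^ (1 - p) * n%:R `^ (1 - p)) :> R.
  rewrite -!powRM ?mulr_ge0 ?exprn_ge0//.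
  rewrite ge0_ler_powR ?nnegrE ?subr_ge0 ?mulr_ge0 ?exprn_ge0//.
  rewrite -!natrX -!natrM ler_nat /J expnD -!muln2.
  have : (0 < 2 ^ i * 2 ^ r.+1 * n)%N by rewrite !muln_gt0 !expn_gt0 n0.
  set a := (2 ^ i)%N; set b := (2 ^ r.+1)%N; move=> h; nia.
have e2 : n%:R `^ (1 - p) * n%:R `^ ((1 - alpha) * p - 1) = n%:R `^ (- (alpha * p)) :> R.
  by rewrite -powRD ?(gt_eqF nR) ?implybT//; congr (_ `^ _); ring.
rewrite -e2.
have c0 : 0 <= C * n%:R `^ ((1 - alpha) * p - 1) by rewrite mulr_ge0 ?powR_ge0 ?(ltW C0).
apply: le_trans (ler_wpM2r c0 e1) _.
rewrite le_eqVlt; apply/orP; left; apply/eqP; ring.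
Qed.

(* De la Vallee Poussin multiplier. *)
Definition vcoef n : int -> R :=
  cut 2 n (fun k => (nat_of_bool ((- n%:Z <= k) && (k <= (3 * n)%N%:Z))%R)%:R).

(** Two forward averages see up to [2 (n - 1)] steps ahead; the asymmetric interval from [- n] to
    [3n] compensates for this. *)
Lemma vcoef1 n k : (0 < n)%N -> (`|k| <= n)%N -> vcoef n k = 1.
Proof.
move=> n0 kn; apply: cut_cst => // i ik.
by rewrite (_ : _ && _ = true)//; lia.
Qed.

Lemma vcoef0 n k : (0 < n)%N -> (3 * n < `|k|)%N -> vcoef n k = 0.
Proof.
move=> n0 kn; apply: cut_cst => // i ik.
by rewrite (_ : _ && _ = false)//; lia.
Qed.

Definition vker n : R -> R[i] := tp (3 * n) (fun k => (vcoef n k)%:C%C).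

(** [kernel_bound] with [p = 1] and [r = 2]. The amplitude is 4 because second differences are at
    most [(2/n)^2], and [4 (2 (3n + 2) + 1) = 24n + 20 <= 44n]. *)
Lemma vker_bound : exists C : R, 0 < C /\
  forall n, (0 < n)%N -> (Np 1 (vker n) <= C%:E)%E.
Proof.
exists (44 * (16 * (2 * pi))); split; first by rewrite !mulr_gt0 ?pi_gt0.
move=> n n0; have nR : 0 < n%:R :> R by rewrite ltr0n.
have c1 l : `|(nat_of_bool ((- n%:Z <= l) && (l <= (3 * n)%N%:Z))%R)%:R : R| <= 1.
  by case: (_ && _); rewrite ?normr1 ?normr0.
have D j k : (j <= 2)%N -> `|iter j dlt (vcoef n) k| <= (2 / n%:R) ^+ j.
  by move=> j2; exact: (cut_bound n0 c1).
have := @kernel_bound R 1 2 (3 * n) n 4 (vcoef n) ltr01 _ n0 _ _ _ _.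
rewrite mulr1 lexx => /(_ isT) H.
apply: le_trans (H _ _ _ _) _ => //.
- by move=> k; exact: vcoef0.
- by move=> k; apply: le_trans (D 0%N k isT) _; rewrite expr0 ler1n.
- move=> k; apply: le_trans (D 2%N k isT) _.
  by rewrite expr_div_n (_ : 2 ^+ 2 = 4) //; ring.
rewrite lee_fin powRr1 ?mulr_ge0// [leRHS]mulrC [leLHS]mulrC.
have pp : 0 < 16 * (2 * pi) :> R by rewrite !mulr_gt0 ?pi_gt0.
move: (16 * (2 * pi)) pp => c pp.
rewrite -mulrA; apply: ler_wpM2l; first exact: ltW.
by rewrite ler_pdivrMl// -!natrM ler_nat -!muln2; lia.
Qed.

End fractional_approximation.

Import HBSimple.

(** * Density of trigonometric polynomials in L1 *)

Section trigpoly_density.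
Context {R : realType}.
Implicit Types (f g h : R -> R[i]) (F : R -> R) (n N m : nat) (eps b x : R).
Local Notation mu := (@lebesgue_measure R).
Local Notation I := (`[0%R, (2 * pi)%R[%classic : set R).

Definition L1_approx f := forall eps, 0 < eps ->
  exists N T, trigpoly N T /\ (Np 1 (fun x => f x - T x)%R <= eps%:E)%E.

Lemma Np1_triangle f g h : cmeasurable f -> cmeasurable g -> cmeasurable h ->
  (Np 1 (fun x => f x - h x)%R <=
   Np 1 (fun x => f x - g x)%R + Np 1 (fun x => g x - h x)%R)%E.
Proof.
move=> mf mg mh.
have -> : (fun x => f x - h x) = fun x => (f x - g x) + (g x - h x).
  by apply/funext => x; rewrite addrA subrK.
by apply: NpD => //; exact: cmeasurableB.
Qed.

Lemma L1_approx_trigpoly N f : trigpoly N f -> L1_approx f.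
Proof.
move=> tf eps e0; exists N, f; split => //.
rewrite (_ : (fun x => f x - f x) = fun=> 0) ?Np0 ?lee_fin ?(ltW e0)//.
by apply/funext => x; rewrite subrr.
Qed.

Lemma L1_approx_lim f : cmeasurable f ->
  (forall eps, 0 < eps -> exists g, [/\ cmeasurable g, L1_approx g &
     (Np 1 (fun x => f x - g x)%R <= eps%:E)%E]) -> L1_approx f.
Proof.
move=> mf H eps e0; have e2 : 0 < eps / 2 by rewrite divr_gt0.
have [g [mg ag fg]] := H _ e2; have [N [T [tT gT]]] := ag _ e2.
exists N, T; split => //.
apply: le_trans (Np1_triangle mf mg (cmeasurable_trigpoly tT)) _.
by rewrite [eps]splitr EFinD; exact: leeD.
Qed.

Lemma L1_approxD f g : cmeasurable f -> cmeasurable g ->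
  L1_approx f -> L1_approx g -> L1_approx (fun x => f x + g x).
Proof.
move=> mf mg af ag eps e0; have e2 : 0 < eps / 2 by rewrite divr_gt0.
have [N [T [tT fT]]] := af _ e2; have [M [S [tS gS]]] := ag _ e2.
exists (maxn N M), (fun x => T x + S x); split.
  by apply: trigpolyD; [exact: trigpoly_widen (leq_maxl _ _) tT
                       |exact: trigpoly_widen (leq_maxr _ _) tS].
have -> : (fun x => f x + g x - (T x + S x)) =
    fun x => (f x - T x) + (g x - S x).
  by apply/funext => x; rewrite opprD addrACA.
apply: le_trans (NpD ltr01 (lexx _) _ _) _.
- exact: (cmeasurableB mf (cmeasurable_trigpoly tT)).
- exact: (cmeasurableB mg (cmeasurable_trigpoly tS)).
by rewrite [eps]splitr EFinD; exact: leeD.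
Qed.

Lemma L1_approxZ (a : R[i]) f : cmeasurable f ->
  L1_approx f -> L1_approx (fun x => a * f x).
Proof.
move=> mf af eps e0.
have a0 : 0 < nc a + 1 by rewrite ltr_wpDl ?nc_ge0.
have [N [T [tT fT]]] := af _ (divr_gt0 e0 a0).
exists N, (fun x => a * T x); split; first exact: trigpolyZ.
have -> : (fun x => a * f x - a * T x) = fun x => a * (f x - T x).
  by apply/funext => x; rewrite mulrBr.
rewrite NpZ; last exact: (cmeasurableB mf (cmeasurable_trigpoly tT)).
rewrite powRr1 ?nc_ge0//; apply: le_trans (lee_wpmul2l _ fT) _.
  by rewrite lee_fin nc_ge0.
rewrite -EFinM lee_fin mulrA ler_pdivrMr// mulrC ler_wpM2l ?(ltW e0)//.
by rewrite lerDl.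
Qed.

Definition cR F x : R[i] := (F x)%:C%C.

Lemma cmeasurable_cR F : measurable_fun setT F -> cmeasurable (cR F).
Proof. by move=> mF; split; [exact: mF|exact: measurable_cst]. Qed.

Lemma Np1_cR F : Np 1 (cR F) = nper (fun x => `|F x|).
Proof. by rewrite Np1E; apply: eq_nper => x; rewrite nc_real. Qed.

(* Odd with attracting fixed points -1 and 1: its iterates, applied to a
   trigonometric polynomial with values in [-1, 1], converge to the sign. *)
Definition smoothstep (t : R) : R := (3 * t - t ^+ 3) / 2.

(** The distance to 1 is multiplied by [1 - (s + s^2)/2] at each step. The iterates never fall below
    [t], so this factor is at most [1 - t/2]; both facts are carried through the induction. *)
Lemma smoothstep_iter m (t : R) : 0 < t -> t <= 1 ->
  0 <= 1 - iter m smoothstep t <= (1 - t / 2) ^+ m.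
Proof.
move=> t0 t1.
suff H : t <= iter m smoothstep t /\ 0 <= 1 - iter m smoothstep t <= (1 - t / 2) ^+ m.
  by case: H.
elim: m => [|m [IH1 /andP[IH2 IH3]]] /=; first by rewrite expr0; split => //; lra.
set s := iter m smoothstep t in IH1 IH2 IH3 *.
have s1 : s <= 1 by lra.
have s0 : 0 < s by lra.
have e : 1 - smoothstep s = (1 - s) * (1 - (s + s ^+ 2) / 2).
  by rewrite /smoothstep; field.
have h1 : 0 <= 1 - (s + s ^+ 2) / 2 by nra.
have h2 : 1 - (s + s ^+ 2) / 2 <= 1 - t / 2 by nra.
split; first by rewrite /smoothstep; nra.
by apply/andP; split; rewrite e; [exact: mulr_ge0|rewrite (exprSr _ m); exact: ler_pM].
Qed.

Lemma smoothstepN (t : R) : smoothstep (- t) = - smoothstep t.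
Proof. by rewrite /smoothstep; field. Qed.

Lemma smoothstep_iter_sgr m (t : R) : `|t| <= 1 ->
  `|iter m smoothstep t - Num.sg t| <= (1 - `|t| / 2) ^+ m.
Proof.
have it0 : iter m smoothstep 0 = 0.
  by elim: m => //= m ->; rewrite /smoothstep mulr0 expr0n/= subr0 mul0r.
have itN s : iter m smoothstep (- s) = - iter m smoothstep s.
  by elim: m {it0} => //= m ->; rewrite smoothstepN.
have pos s : 0 < s -> s <= 1 -> `|iter m smoothstep s - 1| <= (1 - s / 2) ^+ m.
  move=> s0 s1; have /andP[h1 h2] := smoothstep_iter m s0 s1.
  by rewrite distrC ger0_norm.
case: (ltrgtP t 0) => t0 t1.
- rewrite ltr0_norm// ltr0_sg// in t1 *.
  have := pos (- t); rewrite oppr_gt0 itN => /(_ t0 t1).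
  by rewrite -opprD normrN opprK.
- by rewrite gtr0_norm// gtr0_sg// in t1 *; exact: pos.
- by rewrite t0 it0 sgr0 subr0 normr0 mul0r subr0 expr1n.
Qed.

Lemma trigpoly_smoothstep m n (t : R -> R) : trigpoly n (cR t) ->
  exists N, trigpoly N (cR (fun x => iter m smoothstep (t x))).
Proof.
move=> tt; elim: m => [|m [N IH]]; first by exists n.
exists (N + N + N)%N; rewrite /=.
set s := fun x => iter m smoothstep (t x) in IH *.
have -> : cR (fun x => smoothstep (s x)) =
    fun x => (3 / 2)%:C%C * cR s x - (2^-1)%:C%C * (cR s x * cR s x * cR s x).
  apply/funext => x; rewrite /cR -!rmorphM -rmorphB; congr (_%:C%C).
  by rewrite /smoothstep; field.
apply: trigpolyB; apply: trigpolyZ.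
  by apply: trigpoly_widen IH; rewrite -addnA leq_addr.
by apply: trigpolyM => //; exact: trigpolyM.
Qed.

(* A trigonometric polynomial of order 1 that changes sign only at 0 and b
   modulo 2 pi. *)
Definition bumpt b x : R := sin (x / 2) * sin ((b - x) / 2).

Lemma trigpoly_bumpt b : trigpoly 1 (cR (bumpt b)).
Proof.
have -> : cR (bumpt b) = fun x => (4^-1)%:C%C *
   (expi (- (b / 2)) * expi (1%:~R * x) + expi (b / 2) * expi ((- 1)%:~R * x)) -
   (cos (b / 2) / 2)%:C%C.
  apply/funext => x; rewrite /cR /bumpt.
  have -> : sin (x / 2) * sin ((b - x) / 2) = (cos (x - b / 2) - cos (b / 2)) / 2.
    have -> : x - b / 2 = x / 2 - (b - x) / 2 by field.
    rewrite [X in _ - cos X](_ : b / 2 = x / 2 + (b - x) / 2); last by field.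
    by rewrite cosB cosD; field.
  rewrite mulrNz mulNr !mul1r -!expiD.
  rewrite (_ : b / 2 - x = - (x - b / 2)); last by rewrite opprB.
  rewrite (addrC (- (b / 2)) x) /expi cosN sinN.
  apply/eqP; rewrite eq_complex /=; apply/andP; split; apply/eqP; by field.
apply: trigpolyB; last exact: trigpoly_cst.
by apply: trigpolyZ; apply: trigpolyD; apply: trigpolyZ; exact: trigpoly_expi.
Qed.

Lemma bumpt_le1 b x : `|bumpt b x| <= 1.
Proof.
rewrite normrM mulr_ile1// ler_norml.
- by rewrite sin_geN1 sin_le1.
- by rewrite sin_geN1 sin_le1.
Qed.

Lemma bumpt_sgr b x : 0 < b -> b < 2 * pi -> 0 < x -> x < 2 * pi ->
  Num.sg (bumpt b x) = Num.sg (b - x).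
Proof.
move=> b0 b1 x0 x1.
have pp := pi_gt0 R.
have s1 : 0 < sin (x / 2).
  by apply: sin_gt0_pi; rewrite divr_gt0//= ltr_pdivrMr// mulrC.
rewrite /bumpt sgrM (gtr0_sg s1) mul1r.
case: (ltrgtP b x) => bx.
- have : 0 < sin ((x - b) / 2).
    by apply: sin_gt0_pi; apply/andP; split; lra.
  move=> h; rewrite [RHS]ltr0_sg ?subr_lt0//.
  have -> : (b - x) / 2 = - ((x - b) / 2) by field.
  by rewrite sinN ltr0_sg// oppr_lt0.
- have h : 0 < sin ((b - x) / 2).
    by apply: sin_gt0_pi; apply/andP; split; lra.
  by rewrite !gtr0_sg// subr_gt0.
- by rewrite bx subrr mul0r sin0.
Qed.

Lemma measurable_bumpt b : measurable_fun setT (bumpt b).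
Proof. by have [] := cmeasurable_trigpoly (trigpoly_bumpt b). Qed.

(** Dominated convergence with majorant 1: within the period the base is less than 1 except at the
    zeros 0 and [b] of [bumpt]. *)
Lemma nper_bumpt_cvg b : 0 < b -> b < 2 * pi ->
  nper (fun x => (1 - `|bumpt b x| / 2) ^+ m) @[m --> \oo] --> 0%E.
Proof.
move=> b0 b1; have mt := measurable_bumpt b.
have t1 := bumpt_le1 b.
have mI : measurable (I : set R) by [].
pose f_ m x : \bar R := ((1 - `|bumpt b x| / 2) ^+ m)%:E.
have mf m : measurable_fun setT (fun x => (1 - `|bumpt b x| / 2) ^+ m).
  apply: measurable_funX; apply: measurable_funB; first exact: measurable_cst.
  by apply: measurable_funM; [exact: measurableT_comp|exact: measurable_cst].
have bd x : 0 <= 1 - `|bumpt b x| / 2 <= 1.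
  by have := t1 x; have := normr_ge0 (bumpt b x); lra.
have := @dominated_convergence _ _ _ mu I mI f_ (cst 0%E) (cst 1%E).
move=> H; have [] := H.
- by move=> m; exact: mfunI.
- exact: measurable_cst.
- exists [set 0; b]; split.
  + by apply: measurableU; exact: measurable_set1.
  + apply: countable_lebesgue_measure0; apply: finite_set_countable.
    exact: finite_set2.
  move=> x /= /not_implyP[]; rewrite in_itv/= => /andP[x0 x2] ncv.
  have [->|xN0] := eqVneq x 0; first by left.
  have [->|xNb] := eqVneq x b; first by right.
  exfalso; apply: ncv; rewrite /f_; apply: cvg_EFin.
    by apply: nearW => m.
  apply: cvg_expr; rewrite ger0_norm; last by case/andP: (bd x).
  have xgt0 : 0 < x by rewrite lt_def xN0.
  have := bumpt_sgr b0 b1 xgt0 x2 => sg.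
  have : bumpt b x != 0.
    by rewrite -sgr_eq0 sg sgr_eq0 subr_eq0 eq_sym.
  by rewrite -normr_gt0; lra.
- apply/integrableP; split; first exact: measurable_cst.
  under eq_integral do rewrite /= normr1.
  have := @nper_cst R 1; rewrite /nper => ->; exact: ltry.
- apply: aeW => x m _; rewrite lee_fin ger0_norm ?exprn_ge0 ?exprn_ile1//.
  + by case/andP: (bd x).
  + by case/andP: (bd x).
- by move=> _ _; rewrite integral0.
Qed.

Lemma measurable_indic_itv b : measurable_fun setT (\1_(`]-oo, b[) : R -> R).
Proof. exact/measurable_indicP. Qed.

Lemma indic_itvE b x : \1_(`]-oo, b[) x = (nat_of_bool (x < b)%R)%:R :> R.
Proof.
rewrite indicE; case: ltP => bx.
  by rewrite mem_set//= in_itv.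
by rewrite memNset//= in_itv/= ltNge bx.
Qed.

(** Restricted to the period the indicator is constant unless [0 < b < 2 pi]. In that case it is
    [(1 + sg (bumpt b)) / 2] away from the zeros of [bumpt b], and the sign is replaced by an
    iterate of [smoothstep]. *)
Lemma L1_approx_itv b : L1_approx (cR (\1_(`]-oo, b[) : R -> R)).
Proof.
have mi := measurable_indic_itv b.
have [b0|b0] := leP b 0.
  move=> eps e0; exists 0%N, (fun=> 0); split; first exact: trigpoly0.
  rewrite Np1E /nper (eq_integral (cst 0%E)) ?integral0 ?lee_fin ?(ltW e0)//.
  move=> x xI; have {xI} /andP[x0 _] : 0 <= x < 2 * pi by move: xI; rewrite inE/= in_itv.
  by rewrite /cR indic_itvE ltNge (le_trans b0 x0) subr0 nc0.
have [b1|b1] := leP (2 * pi) b.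
  move=> eps e0; exists 0%N, (fun=> 1); split; first exact: trigpoly_cst.
  rewrite Np1E /nper (eq_integral (cst 0%E)) ?integral0 ?lee_fin ?(ltW e0)//.
  move=> x xI; have {xI} /andP[_ x1] : 0 <= x < 2 * pi by move: xI; rewrite inE/= in_itv.
  by rewrite /cR indic_itvE (lt_le_trans x1 b1) subrr nc0.
move=> eps e0.
have /fine_cvgP[_ /cvgr0_norm_lt/(_ _ e0)[m _ /(_ m (leqnn m))]] := nper_bumpt_cvg b0 b1.
rewrite /=; set B := nper _ => Be.
have mt := measurable_bumpt b.
have mf : measurable_fun setT (fun x => (1 - `|bumpt b x| / 2) ^+ m).
  apply: measurable_funX; apply: measurable_funB; first exact: measurable_cst.
  by apply: measurable_funM; [exact: measurableT_comp|exact: measurable_cst].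
have B0 : (0 <= B)%E.
  apply: nper_ge0 => x; rewrite exprn_ge0//.
  by have := bumpt_le1 b x; lra.
have Ble : (B <= eps%:E)%E.
  have Bfin : B \is a fin_num.
    rewrite ge0_fin_numE//; apply: (@le_lt_trans _ _ (nper (fun=> 1))).
      apply: le_nper => //.
      - by move=> x; rewrite exprn_ge0//; have := bumpt_le1 b x; lra.
      - move=> x; rewrite exprn_ile1//; have := bumpt_le1 b x;
        have := normr_ge0 (bumpt b x); lra.
    by rewrite nper_cst ltry.
  rewrite -(fineK Bfin) lee_fin; apply: le_trans (ltW Be).
  exact: ler_norm.
have [N tN] := trigpoly_smoothstep m (trigpoly_bumpt b).
exists N, (fun x => (2^-1)%:C%C + (2^-1)%:C%C * cR (fun x => iter m smoothstep (bumpt b x)) x).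
have tT : trigpoly N (fun x => (2^-1)%:C%C + (2^-1)%:C%C * cR (fun x => iter m smoothstep (bumpt b x)) x).
  by apply: trigpolyD; [exact: trigpoly_cst|exact: trigpolyZ].
split=> //; apply: le_trans Ble; rewrite Np1E; apply: le_nper_period => //.
- exact: (measurable_nc (cmeasurableB (cmeasurable_cR mi) (cmeasurable_trigpoly tT))).
- by move=> x; exact: nc_ge0.
move=> x /andP[x0 x1].
set s := iter m smoothstep (bumpt b x).
have -> : cR (\1_(`]-oo, b[)) x - ((2^-1)%:C%C + (2^-1)%:C%C * cR (fun x => iter m smoothstep (bumpt b x)) x) =
    ((nat_of_bool (x < b)%R)%:R - (2^-1 + 2^-1 * s))%:C%C.
  by rewrite /cR indic_itvE -/s rmorphB rmorphD rmorphM.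
rewrite nc_real.
have := smoothstep_iter_sgr m (bumpt_le1 b x); rewrite -/s.
(* At a zero of [bumpt] the majorant is 1 and the iterate has modulus at most 1, so the error is
   still covered. *)
have [t0|tN0] := eqVneq (bumpt b x) 0.
  rewrite t0 sgr0 normr0 subr0 mul0r subr0 expr1n !ler_norml => /andP[h1 h2].
  by case: (x < b); apply/andP; split; rewrite /=; lra.
have xgt0 : 0 < x.
  rewrite lt_def x0 andbT; apply: contra tN0 => /eqP ->.
  by rewrite /bumpt mul0r sin0 mul0r.
rewrite (bumpt_sgr b0 b1 xgt0 x1) !ler_norml => /andP[h1 h2].
case: (ltrgtP x b) h1 h2 => xb.
- rewrite gtr0_sg ?subr_gt0//= => h1 h2; apply/andP; split; lra.
- rewrite ltr0_sg ?subr_lt0//= => h1 h2; apply/andP; split; lra.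
- by move: tN0; rewrite xb /bumpt subrr mul0r sin0 mulr0 eqxx.
Qed.

Lemma measurable_indicR (A : set R) : measurable A ->
  measurable_fun setT (\1_A : R -> R).
Proof. by move=> mA; exact/measurable_indicP. Qed.

Lemma L1_approx_setU (A B : set R) : measurable A -> measurable B ->
  A `&` B = set0 -> L1_approx (cR (\1_A : R -> R)) ->
  L1_approx (cR (\1_B : R -> R)) -> L1_approx (cR (\1_(A `|` B) : R -> R)).
Proof.
move=> mA mB AB aA aB.
have -> : cR (\1_(A `|` B)) = fun x => cR (\1_A) x + cR (\1_B) x.
  apply/funext => x; rewrite /cR -rmorphD; congr (_%:C%C).
  rewrite !indicE in_setU; case xA: (x \in A); case xB: (x \in B) => //=.
  - suff : (A `&` B) x by rewrite AB.
    by split; apply/set_mem.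
  - by rewrite addr0.
  - by rewrite add0r.
  - by rewrite addr0.
by apply: L1_approxD => //; apply: cmeasurable_cR; exact: measurable_indicR.
Qed.

Lemma L1_approx_bigcup (F : (set R)^nat) : (forall k, measurable (F k)) ->
  trivIset setT F -> (forall k, L1_approx (cR (\1_(F k) : R -> R))) ->
  L1_approx (cR (\1_(\bigcup_k F k) : R -> R)).
Proof.
move=> mF tF aF.
have mU : measurable (\bigcup_k F k) by exact: bigcup_measurable.
pose U K := \big[setU/set0]_(k < K) F k.
have mUK K : measurable (U K) by exact: bigsetU_measurable.
have aU K : L1_approx (cR (\1_(U K) : R -> R)).
  elim: K => [|K IH].
    have -> : cR (\1_(U 0%N)) = fun=> 0.
      by apply/funext => x; rewrite /cR /U big_ord0 indic0.
    exact: (L1_approx_trigpoly (trigpoly0 0)).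
  rewrite /U big_ord_recr /=; apply: (L1_approx_setU (mUK K) (mF K) _ IH (aF K)).
  apply/seteqP; split => // x []; rewrite /U -bigcup_mkord => -[k /= kK Fkx] FKx.
  by move: kK; rewrite (tF k K Logic.I Logic.I) ?ltnn//; exists x.
apply: L1_approx_lim; first by apply: cmeasurable_cR; exact: measurable_indicR.
have mI : measurable (I : set R) by [].
pose f_ K x : \bar R := (`|\1_(\bigcup_k F k) x - \1_(U K) x|)%:E.
have mf K : measurable_fun setT (fun x => `|\1_(\bigcup_k F k) x - \1_(U K) x| : R).
  by apply: measurableT_comp => //; apply: measurable_funB; exact: measurable_indicR.
have f1 K x : `|\1_(\bigcup_k F k) x - \1_(U K) x| <= 1 :> R.
  by rewrite !indicE; case: (_ \in _); case: (_ \in _);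
    rewrite /= ?subrr ?subr0 ?sub0r ?normrN ?normr1 ?normr0.
have := @dominated_convergence _ _ _ mu I mI f_ (cst 0%E) (cst 1%E).
move=> H; have [] := H.
- by move=> m; exact: mfunI.
- exact: measurable_cst.
- apply: aeW => x _; have [[k _ Fkx]|nU] := pselect ((\bigcup_k F k) x).
    apply: cvg_near_cst; exists k.+1 => // K /= kK.
    rewrite /f_ !indicE !mem_set ?subrr ?normr0//; last by exists k.
    by rewrite /U -bigcup_mkord; exists k.
  apply: cvg_near_cst; apply: nearW => K.
  rewrite /f_ !indicE !memNset ?subrr ?normr0// => UKx; apply: nU.
  by move: UKx; rewrite /U -bigcup_mkord => -[k _ Fkx]; exists k.
- apply/integrableP; split; first exact: measurable_cst.
  under eq_integral do rewrite /= normr1.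
  have := @nper_cst R 1; rewrite /nper => ->; exact: ltry.
- by apply: aeW => x m _; rewrite lee_fin normr_id.
move=> _ _; rewrite integral0 => /fine_cvgP[fin /cvgr0_norm_lt cv] eps e0.
have [m1 _ h1] := fin; have [m2 _ h2] := cv _ e0.
pose m := maxn m1 m2.
have hf := h1 m (leq_maxl _ _); have hl := h2 m (leq_maxr _ _).
exists (cR (\1_(U m))); split => //.
- by apply: cmeasurable_cR; exact: measurable_indicR.
- have -> : (fun x => cR (\1_(\bigcup_k F k)) x - cR (\1_(U m)) x) =
      cR (fun x => \1_(\bigcup_k F k) x - \1_(U m) x).
    by apply/funext => x; rewrite /cR rmorphB.
  rewrite Np1_cR -[leLHS](fineK hf) lee_fin; apply: le_trans (ltW hl).
  exact: ler_norm.
Qed.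

(** Open left rays are closed under intersection and generate the Borel sets; approximability passes
    to complements and to countable disjoint unions, so Dynkin's theorem applies. *)
Lemma L1_approx_indic (A : set R) : measurable A -> L1_approx (cR (\1_A : R -> R)).
Proof.
move=> mA.
have := @dynkin_induction _ (measurableTypeR R) (@RGenInftyO.G R)
  (fun A => L1_approx (cR (\1_A : R -> R))) (RGenInftyO.measurableE R).
apply.
- move=> _ _ [x ->] [y ->]; exists (Num.min x y).
  by apply/seteqP; split => z /=; rewrite !in_itv/= lt_min => /andP.
- have -> : cR (\1_setT) = fun=> 1.
    by apply/funext => x; rewrite /cR indicT.
  exact: (L1_approx_trigpoly (trigpoly_cst 0 1)).
- by move=> _ [x ->]; exact: L1_approx_itv.
- move=> S mS aS.
  have -> : cR (\1_(~` S)) = fun x => 1 + (-1) * cR (\1_S) x.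
    apply/funext => x; rewrite /cR !indicE in_setC.
    by case: (x \in S); rewrite /= ?mulr0 ?addr0 // mulr1 subrr.
  have mc : cmeasurable (cR (\1_S : R -> R)).
    by apply: cmeasurable_cR; exact: measurable_indicR.
  apply: L1_approxD; [exact: cmeasurable_cst| | |exact: L1_approxZ].
    by apply: cmeasurableM => //; exact: cmeasurable_cst.
  exact: (L1_approx_trigpoly (trigpoly_cst 0 1)).
- by move=> F mF tF aF; exact: L1_approx_bigcup.
- by change ((@RGenInftyO.G R).-sigma.-measurable A); rewrite -RGenInftyO.measurableE; exact: mA.
Qed.

Lemma L1_approx_real F : measurable_fun setT F ->
  mu.-integrable I (EFin \o F) -> L1_approx (cR F).
Proof.
move=> mF iF; have mI : measurable (I : set R) by [].
have [g [_ _ /fine_cvgP[fin /cvgr0_norm_lt cv]]] :=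
  @approximation_sfun_integrable _ _ _ mu I mI _ iF.
apply: L1_approx_lim; first exact: cmeasurable_cR.
move=> eps e0.
have [m1 _ h1] := fin; have [m2 _ h2] := cv _ e0.
pose m := maxn m1 m2.
have hf := h1 m (leq_maxl _ _); have hl := h2 m (leq_maxr _ _).
have mg : measurable_fun setT (g m : R -> R) by exact: (@measurable_funPT _ _ (measurableTypeR R) R (g m)).
exists (cR (g m)); split.
- exact: cmeasurable_cR.
- have fr : finite_set (range (g m)) by exact: fimfunP.
  have -> : cR (g m) = fun x => \sum_(y <- finmap.enum_fset (fset_set (range (g m))))
      (y%:C%C * cR (\1_(g m @^-1` [set y])) x).
    apply/funext => x; rewrite /cR fimfunE fsbig_finite//= rmorph_sum.
    by apply: eq_bigr => y _; rewrite rmorphM.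
  have mi y : measurable (g m @^-1` [set y] : set R).
    by rewrite -[X in measurable X]setTI; exact: mg.
  have mc y : cmeasurable (cR (\1_(g m @^-1` [set y]) : R -> R)).
    by apply: cmeasurable_cR; apply: measurable_indicR; exact: mi.
  elim: (finmap.enum_fset _) => [|y s IH].
    under eq_fun do rewrite big_nil.
    exact: (L1_approx_trigpoly (trigpoly0 0)).
  under eq_fun do rewrite big_cons.
  have ml z : cmeasurable (fun x => z%:C%C * cR (\1_(g m @^-1` [set z])) x).
    exact: (cmeasurableM (cmeasurable_cst _) (mc z)).
  apply: L1_approxD; [exact: ml| | |exact: IH].
    exact: (@cmeasurable_sum R R s (fun z x => z%:C%C * cR (\1_(g m @^-1` [set z])) x) ml).
  by apply: L1_approxZ; [exact: mc|apply: L1_approx_indic; exact: mi].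
- have -> : (fun x => cR F x - cR (g m) x) = cR (fun x => F x - g m x).
    by apply/funext => x; rewrite /cR rmorphB.
  rewrite Np1_cR -[leLHS](fineK hf) lee_fin; apply: le_trans (ltW hl).
  exact: ler_norm.
Qed.

Lemma L1_trigpoly_dense f : L1 f -> L1_approx f.
Proof.
move=> lf; have [[m1 m2] _] := lf.
have -> : f = fun x => cR (fun x => complex.Re (f x)) x +
    (Complex 0 1) * cR (fun x => complex.Im (f x)) x.
  apply/funext => x; rewrite /cR; case: (f x) => a b /=.
  by apply/eqP; rewrite eq_complex /=; apply/andP; split; apply/eqP; ring.
have c1 := cmeasurable_cR m1; have c2 := cmeasurable_cR m2.
apply: L1_approxD.
- exact: c1.
- exact: (cmeasurableM (cmeasurable_cst _) c2).
- exact: (L1_approx_real m1 (L1_integrable_Re lf)).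
- apply: L1_approxZ; first exact: c2.
  by apply: L1_approx_real; [exact: m2|exact: L1_integrable_Im].
Qed.

End trigpoly_density.

(** * Passage to the limit *)

Section limit_argument.
Context {R : realType}.
Implicit Types (f g u w : R -> R[i]) (p alpha eps d : R) (n N M m l : nat) (k : int).

Lemma fourier_coefD f g k : L1 f -> L1 g ->
  fourier_coef (fun x => f x + g x) k = fourier_coef f k + fourier_coef g k.
Proof.
move=> lf lg; rewrite !fourier_coefE -(cmeanD (L1M_expi _ lf) (L1M_expi _ lg)).
by congr cmean; apply/funext => x; rewrite mulrDl.
Qed.

Lemma fourier_coefN f k : L1 f ->
  fourier_coef (fun x => - f x) k = - fourier_coef f k.
Proof.
move=> lf; rewrite !fourier_coefE -[RHS]mulN1r -(cmeanZ _ (L1M_expi _ lf)).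
by congr cmean; apply/funext => x; rewrite mulN1r mulNr.
Qed.

Lemma fourier_coefB f g k : L1 f -> L1 g ->
  fourier_coef (fun x => f x - g x) k = fourier_coef f k - fourier_coef g k.
Proof. by move=> lf lg; rewrite (fourier_coefD k lf (L1N lg)) fourier_coefN. Qed.

Lemma fourier_coef_trigpoly0 n f k : trigpoly n f -> (n < `|k|)%N ->
  fourier_coef f k = 0.
Proof. by move=> tf kn; rewrite (tp_fourier_coef tf) fourier_coef_tp leqNgt kn. Qed.

(** The de la Vallee Poussin means reproduce polynomials of order [M] and are bounded on L_1
    uniformly in [M], so density gives convergence; the error of approximation is met twice, hence
    [eps / (1 + C)]. *)
Lemma vker_approx f eps : L1 f -> 0 < eps -> exists M0 : nat,
  forall M, (M0 <= M)%N -> (0 < M)%N ->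
  (Np 1 (fun x => f x - tp (3 * M) (fun k => fourier_coef f k * (vcoef M k)%:C%C) x)%R
    <= eps%:E)%E.
Proof.
move=> lf e0; have [mf _] := lf.
have [C [C0 HC]] := @vker_bound R.
have C10 : 0 < 1 + C by rewrite addr_gt0.
have [N [T [tT fT]]] := L1_trigpoly_dense lf (divr_gt0 e0 C10).
exists N => M NM M0; have lT := L1_trigpoly tT; have mT := cmeasurable_trigpoly tT.
have N3M : (N <= 3 * M)%N by lia.
have -> : (fun x => f x - tp (3 * M) (fun k => fourier_coef f k * (vcoef M k)%:C%C) x) =
    fun x => (f x - T x) - tp (3 * M) (fun k =>
      fourier_coef (fun x => f x - T x) k * (vcoef M k)%:C%C) x.
  apply/funext => x; rewrite -addrA; congr (_ + _).
  rewrite -opprD; congr (- _).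
  rewrite {1}(tp_fourier_coef (trigpoly_widen N3M tT)) /tp -zsumD.
  apply: eq_zsum => k k3; rewrite -mulrDl; congr (_ * _).
  rewrite fourier_coefB//; have [kN|kN] := leqP `|k| N.
    by rewrite vcoef1// ?rmorph1 ?mulr1; [rewrite addrC subrK|lia].
  by rewrite (fourier_coef_trigpoly0 tT kN) subr0 add0r.
apply: le_trans (NpB ltr01 (lexx _) _ _) _.
- exact: (cmeasurableB mf mT).
- exact: (cmeasurable_trigpoly (trigpoly_tp _ _)).
apply: le_trans (leeD (lexx _) (Np1_convolution _ _ (L1B lf lT))) _.
have hV := HC _ M0.
apply: (@le_trans _ _ ((eps / (1 + C))%:E + (eps / (1 + C))%:E * C%:E)%E).
  apply: leeD => //; apply: lee_pmul => //; exact: Np_ge0.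
rewrite -EFinM -EFinD lee_fin -[X in X + _]mulr1 -mulrDr.
by rewrite divfK// gt_eqF.
Qed.

(** As [u] is not a polynomial, it is first replaced by a de la Vallee Poussin mean; the difference
    from the low-pass part is then [w] convolved with two kernels bounded in L_1. For [p = 1] two
    differences suffice, hence the parameter 2. *)
Lemma fractional_L1_approx alpha n : 0 < alpha -> (0 < n)%N ->
  exists C : R, 0 < C /\ forall u w, L1 u -> L1 w ->
  (forall k, k != 0 -> fourier_coef u k = ikinv alpha k * fourier_coef w k) ->
  forall eps, 0 < eps -> exists Q, trigpoly n Q /\
    (Np 1 (fun x => u x - Q x)%R <= C%:E * Np 1 w + eps%:E)%E.
Proof.
move=> alpha0 n0.
have r2 : 2 <= 2%:R * 1 :> R by rewrite mulr1.
have [C1 [C10 HC1]] := @ker_bound R 1 alpha 2 ltr01 (lexx _) alpha0 r2.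
have [C2 [C20 HC2]] := @vker_bound R.
have nR : 0 < n%:R :> R by rewrite ltr0n.
set C3 := C1 * n%:R `^ ((1 - alpha) * 1 - 1).
have C30 : 0 < C3 by rewrite mulr_gt0// powR_gt0.
exists (C2 * C3); split; first by rewrite mulr_gt0.
move=> u w lu lw Huw eps e0.
have [M0 HM0] := vker_approx lu e0.
pose M := maxn M0 n.
have MM0 : (M0 <= M)%N by exact: leq_maxl.
have nM : (n <= M)%N by exact: leq_maxr.
have Mgt0 : (0 < M)%N by lia.
(* Any [J] with [9 M <= 2^J n] would do, since the kernel bound is uniform in [J]. *)
pose J := (3 * M * 3)%N.
have NJ : (3 * M * 3 <= 2 ^ J * n)%N.
  by apply: leq_trans (ltnW (ltn_expl J (ltnSn 1))) _; rewrite leq_pmulr.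
have NJ' : (3 * M <= 2 ^ J * n)%N by apply: leq_trans NJ; rewrite leq_pmulr.
have nJ : (n <= 2 ^ J * n)%N by rewrite leq_pmull// expn_gt0.
set Vu := tp (3 * M) (fun k => fourier_coef u k * (vcoef M k)%:C%C).
pose Q := tp n (fun k => (chi 2 n `|k|)%:C%C * fourier_coef u k).
exists Q; split; first exact: trigpoly_tp.
have tVu : trigpoly (3 * M) Vu by exact: trigpoly_tp.
have tQ : trigpoly n Q by exact: trigpoly_tp.
have [mu' _] := lu.
apply: le_trans (Np1_triangle mu' (cmeasurable_trigpoly tVu) (cmeasurable_trigpoly tQ)) _.
rewrite addeC; apply: leeD; last exact: HM0.
(* The multiplier [vcoef - chi] factors as [vcoef * (1 - chi)], because [vcoef] is 1 wherever [chi]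
   at the modulus of [k] is nonzero. *)
have -> : (fun x => Vu x - Q x) = tp (2 ^ J * n) (fun k =>
    fourier_coef w k * (fourier_coef (@vker R M) k * ker alpha 2 n J k)).
  apply/funext => x; rewrite /Vu /Q /tp -(@zsum_widen _ (3 * M) _ _ NJ'); last first.
    by move=> k kM; rewrite vcoef0// mulr0 mul0r.
  rewrite -(@zsum_widen _ n _ _ nJ); last first.
    move=> k kn; rewrite chi_gt; last by lia.
    by rewrite !mul0r.
  rewrite -zsumB; apply: eq_zsum => k _; rewrite -mulrBl; congr (_ * _).
  rewrite /vker fourier_coef_tp; have [kM|kM] := leqP `|k| (3 * M); last first.
    rewrite vcoef0// chi_gt; last by lia.
    by rewrite !(mulr0, mul0r) subrr.
  rewrite kerE [chi 2 (2 ^ J * n) _]chi_le; last first.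
    by rewrite -abszE lez_nat leq_divRL//; apply: leq_trans NJ; rewrite leq_mul2r kM orbT.
  have [->|k0] := eqVneq k 0.
    by rewrite normr0 chi_le// vcoef1// rmorph1 mulr1 mul1r !subrr rmorph0 !(mul0r, mulr0).
  rewrite (Huw k k0); have [kn|kn] := leqP `|k| n.
    rewrite vcoef1//; last by lia.
    by rewrite rmorphB rmorph1; ring.
  rewrite chi_gt; last by lia.
  by rewrite subr0 rmorph1 rmorph0; ring.
apply: le_trans (Np1_convolution _ _ lw) _.
rewrite muleC; apply: lee_wpmul2r; first exact: Np_ge0.
have lV : L1 (@vker R M) by exact: (L1_trigpoly (trigpoly_tp _ _)).
apply: le_trans (Np1_convolution _ _ lV) _.
rewrite EFinM; apply: lee_pmul; [exact: Np_ge0|exact: Np_ge0|exact: HC2|].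
exact: HC1.
Qed.

(** Where the modulus is at most [d] its p-th power is at most [d^p]; elsewhere it is at most
    [d^(p-1)] times the modulus. The free threshold plays the role of Hölder's inequality. *)
Lemma Np_le_Np1 p d f : 0 < p -> p <= 1 -> 0 < d -> cmeasurable f ->
  (Np p f <= (d `^ p * (2 * pi))%:E + (d `^ (p - 1))%:E * Np 1 f)%E.
Proof.
move=> p0 p1 d0 mf; rewrite -nper_cst Np1E -nperZ ?powR_ge0//; last 2 first.
- exact: measurable_nc.
- by move=> x; exact: nc_ge0.
have m1 : measurable_fun setT (fun x => d `^ (p - 1) * nc (f x)).
  by apply: measurable_funM; [exact: measurable_cst|exact: measurable_nc].
rewrite -nperD; [|exact: measurable_cst|exact: m1|by move=> x; exact: powR_ge0
  |by move=> x; rewrite mulr_ge0 ?powR_ge0 ?nc_ge0].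
apply: le_nper.
- exact: measurable_ncp.
- by apply: measurable_funD => //; exact: measurable_cst.
- by move=> x; exact: powR_ge0.
move=> x; have z0 := nc_ge0 (f x); set z := nc (f x) in z0 *.
have [zd|dz] := leP z d.
  rewrite (@le_trans _ _ (d `^ p))//.
    by rewrite ge0_ler_powR ?nnegrE ?(ltW p0)// ltW.
  by rewrite lerDl mulr_ge0 ?powR_ge0.
have zgt0 := lt_trans d0 dz.
rewrite (@le_trans _ _ (d `^ (p - 1) * z))//; last by rewrite lerDr powR_ge0.
have -> : z `^ p = z `^ (p - 1) * z.
  by rewrite -[X in _ * X](powRr1 z0) -powRD ?(gt_eqF zgt0) ?implybT// subrK.
rewrite ler_wpM2r// -opprB !powRN lef_pV2 ?posrE ?powR_gt0//.
by rewrite ge0_ler_powR ?nnegrE ?subr_ge0 ?p1 ?(ltW d0) ?(ltW zgt0) ?(ltW dz).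
Qed.

Lemma bounded_sum_tail (a : nat -> R) (S : R) : (forall j : nat, 0 <= a j) ->
  (forall m, \sum_(j < m) a j <= S) ->
  forall eps, 0 < eps -> exists m, forall l, (m <= l)%N ->
    \sum_(m <= j < l) a j <= eps.
Proof.
move=> a0 aS eps e0.
pose E := range (fun m => \sum_(j < m) a j).
have hs : has_sup E.
  by split; [exists (\sum_(j < 0) a j); exists 0%N|exists S => _ [m _ <-]; exact: aS].
have [_ [m _ <-] hm] := sup_adherent e0 hs.
exists m => l ml.
have : \sum_(j < l) a j <= sup E by apply: sup_upper_bound => //; exists l.
rewrite -!(big_mkord predT) (@big_cat_nat _ _ _ m 0%N l)//= => hs'.
by rewrite -(big_mkord predT) in hm; lra.
Qed.

(* T_m is Cauchy in L1 by Nikolskii; its limit is identified with g by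
   approximating g - T_m in L1 by a bounded P: where |g - T_l| <= A it is at most
   A^(1-p) |g - T_l|^p, and elsewhere |g - T_m| is controlled by |g - T_m - P|. *)
Lemma L1_limit p n (T : nat -> R -> R[i]) g (S : R) : 0 < p -> p < 1 ->
  L1 g -> (forall j : nat, trigpoly (2 ^ j * n) (T j)) ->
  (forall eps, 0 < eps -> exists l0, forall l, (l0 <= l)%N ->
    (Np p (fun x => g x - T l x)%R <= eps%:E)%E) ->
  (forall m, \sum_(j < m) (2 ^+ j) `^ (1 - p) *
     fine (Np p (fun x => T j.+1 x - T j x)) <= S) ->
  forall eps, 0 < eps -> exists m, (Np 1 (fun x => g x - T m x)%R <= eps%:E)%E.
Proof.
move=> p0 p1 lg tT cvT sumT eps e0.
have [mg _] := lg.
have mT j := cmeasurable_trigpoly (tT j).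
have tD j : trigpoly (2 ^ j.+1 * n) (fun x => T j.+1 x - T j x).
  apply: trigpolyB => //; apply: trigpoly_widen (tT j).
  by rewrite leq_mul2r leq_exp2l// leqnSn orbT.
pose a j := (2 ^+ j) `^ (1 - p) * fine (Np p (fun x => T j.+1 x - T j x)).
have a0 j : 0 <= a j by rewrite mulr_ge0 ?powR_ge0 ?fine_ge0 ?Np_ge0.
pose d j := fine (Np 1 (fun x => T j.+1 x - T j x)).
have d0 j : 0 <= d j by rewrite fine_ge0 ?Np_ge0.
have aS j : a j <= S.
  apply: le_trans (sumT j.+1); rewrite big_ord_recr/= -/(a j) lerDr.
  by apply: sumr_ge0 => i _; exact: a0.
have S0 : 0 <= S := le_trans (a0 0%N) (aS 0%N).
(* The Nikolskii constant for order [2^(j+1) n], stripped of the weight [(2^j)^(1-p)]: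
   [4 * 2^j n + 1 <= 5 (n + 1) 2^j]. *)
pose c : R := (5 * n.+1%:R) `^ (1 - p).
have c0 : 0 <= c by exact: powR_ge0.
(* Nikolskii gives [d j <= (c * a j)^(1/p)]. As [1/p - 1 >= 0] and [a j <= S], the excess power is
   bounded by a constant, and summability of [a] passes to [d]. *)
pose B := c * (c * S) `^ (p^-1 - 1).
have B0 : 0 <= B by rewrite mulr_ge0 ?powR_ge0.
have dB j : d j <= B * a j.
  have h1 : d j `^ p <= c * a j.
    apply: le_trans (nikolskii p0 (ltW p1) (tD j)) _.
    rewrite /a mulrA ler_wpM2r ?fine_ge0 ?Np_ge0//.
    rewrite /c -powRM ?exprn_ge0 ?mulr_ge0//.
    rewrite ge0_ler_powR ?nnegrE ?subr_ge0 ?(ltW p1) ?mulr_ge0 ?exprn_ge0//.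
    rewrite -natrX -!natrM ler_nat expnS -!muln2.
    have : (0 < 2 ^ j)%N by rewrite expn_gt0.
    set q := (2 ^ j)%N; move=> q0; nia.
  have h2 : d j <= (c * a j) `^ p^-1.
    rewrite -[leLHS]powRr1// -(@mulfV _ p) ?gt_eqF// powRrM.
    apply: (ge0_ler_powR _ _ _ h1); rewrite ?nnegrE ?invr_ge0 ?powR_ge0 ?(ltW p0)//.
    exact: (mulr_ge0 c0 (a0 j)).
  apply: le_trans h2 _.
  have [->|caN0] := eqVneq (c * a j) 0.
    by rewrite powR0 ?invr_eq0 ?(gt_eqF p0) ?(mulr_ge0 B0 (a0 j)).
  have ca0 : 0 < c * a j by rewrite lt_def caN0 mulr_ge0.
  have -> : (c * a j) `^ p^-1 = (c * a j) `^ (p^-1 - 1) * (c * a j).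
    by rewrite -[X in _ = _ * X](powRr1 (ltW ca0)) -powRD ?(gt_eqF ca0) ?implybT// subrK.
  rewrite /B -mulrA [leRHS]mulrCA ler_wpM2r ?(ltW ca0)//.
  rewrite ge0_ler_powR ?nnegrE ?subr_ge0 ?invf_ge1 ?(ltW p1) ?(ltW ca0)//.
    exact: (mulr_ge0 c0 S0).
  exact: (ler_wpM2l c0 (aS j)).
have e4 : 0 < eps / 4 by rewrite divr_gt0.
have sumd m : \sum_(j < m) d j <= B * S.
  apply: le_trans (ler_wpM2l B0 (sumT m)); rewrite mulr_sumr.
  by apply: ler_sum => j _; exact: dB.
have [m Hm] := bounded_sum_tail d0 sumd e4.
exists m; set h := fun x => g x - T m x.
have mh : cmeasurable h by exact: cmeasurableB.
have lh : L1 h := L1B lg (L1_trigpoly (tT m)).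
have [N [P [tP hP]]] := L1_trigpoly_dense lh e4.
have mP := cmeasurable_trigpoly tP.
set A := N.*2.+1%:R * fine (Np 1 P) + 1.
have A0 : 0 < A by rewrite ltr_wpDl// mulr_ge0// fine_ge0// Np_ge0.
have PA x : nc (P x) <= A.
  by apply: le_trans (trigpoly_sup_le_L1 x tP) _; rewrite lerDl.
(* The order of choices matters: [m] from the Cauchy tail, then [P] and [A] from [T m], then [l]
   from [A]. This is possible because the tail bound holds for all [l >= m]. *)
have e8 : 0 < eps / 4 / A `^ (1 - p) by rewrite divr_gt0// powR_gt0.
have [l0 Hl0] := cvT _ e8.
pose l := maxn l0 m.
have ml : (m <= l)%N by exact: leq_maxr.
have Tlm : (Np 1 (fun x => T l x - T m x)%R <= (eps / 4)%:E)%E.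
  apply: (@le_trans _ _ (\sum_(m <= j < l) d j)%:E); last by rewrite lee_fin; exact: Hm.
  rewrite -(subnKC ml); elim: (l - m)%N => [|i IH].
    rewrite addn0 big_geq// (_ : (fun x => T m x - T m x) = fun=> 0) ?Np0//.
    by apply/funext => x; rewrite subrr.
  rewrite addnS big_nat_recr ?leq_addr//= EFinD.
  have -> : (fun x => T (m + i).+1 x - T m x) =
      fun x => (T (m + i)%N x - T m x) + (T (m + i).+1 x - T (m + i)%N x).
    by apply/funext => x; rewrite [RHS]addrC [RHS]addrA subrK.
  apply: le_trans (NpD ltr01 (lexx _) _ _) _; [exact: cmeasurableB|exact: cmeasurableB|].
  apply: leeD => //; rewrite /d fineK//; exact: (Np_trigpoly_fin ltr01 (tD _)).
have key x : nc (h x) <= 2 * nc (h x - P x) + (nc (T l x - T m x) +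
    A `^ (1 - p) * nc (g x - T l x) `^ p).
  have h1 : nc (h x) <= nc (h x - P x) + nc (P x).
    by rewrite -{1}(subrK (P x) (h x)); exact: ncD.
  have h2 : nc (P x) <= nc (h x - P x) + nc (h x).
    by have := ncB (h x) (h x - P x); rewrite subKr addrC.
  have h3 : nc (h x) <= nc (T l x - T m x) + nc (g x - T l x).
    have -> : h x = (T l x - T m x) + (g x - T l x).
      by rewrite /h [RHS]addrC [RHS]addrA subrK.
    exact: ncD.
  set y := nc (g x - T l x) in h3 *.
  have y0 : 0 <= y by exact: nc_ge0.
  have tl0 := nc_ge0 (T l x - T m x); have hp0 := nc_ge0 (h x - P x).
  have [yA|Ay] := leP y A.
    have h4 : y <= A `^ (1 - p) * y `^ p.
      have -> : y = y `^ (1 - p) * y `^ p.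
        by rewrite -powRD ?subrK ?powRr1// oner_eq0.
      rewrite {2}(_ : y `^ (1 - p) * y `^ p = y); last first.
        by rewrite -powRD ?subrK ?powRr1// oner_eq0.
      rewrite ler_wpM2r ?powR_ge0//.
      by rewrite ge0_ler_powR ?nnegrE ?subr_ge0 ?(ltW p1) ?(ltW A0).
    by lra.
  have h4 : A <= A `^ (1 - p) * y `^ p.
    have {1}-> : A = A `^ (1 - p) * A `^ p.
      by rewrite -powRD ?subrK ?powRr1// ?oner_eq0// ltW.
    by rewrite ler_wpM2l ?powR_ge0// ge0_ler_powR ?nnegrE ?(ltW p0) ?(ltW A0) ?(ltW Ay).
  by have := PA x; lra.
have m1 := measurable_nc (cmeasurableB mh mP).
have m2 := measurable_nc (cmeasurableB (mT l) (mT m)).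
have m3 := measurable_ncp p (cmeasurableB mg (mT l)).
have m4 : measurable_fun setT (fun x => A `^ (1 - p) * nc (g x - T l x) `^ p).
  by apply: measurable_funM => //; exact: measurable_cst.
have m5 : measurable_fun setT (fun x => 2 * nc (h x - P x)).
  by apply: measurable_funM => //; exact: measurable_cst.
have m6 : measurable_fun setT (fun x => nc (T l x - T m x) +
    A `^ (1 - p) * nc (g x - T l x) `^ p) by exact: measurable_funD.
rewrite Np1E; apply: (@le_trans _ _ (nper (fun x => 2 * nc (h x - P x) +
    (nc (T l x - T m x) + A `^ (1 - p) * nc (g x - T l x) `^ p)))).
  apply: le_nper => //.
  - exact: measurable_nc.
  - exact: measurable_funD.
  - by move=> x; exact: nc_ge0.
have n0 x : 0 <= nc (h x - P x) by exact: nc_ge0.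
have n1 x : 0 <= nc (T l x - T m x) by exact: nc_ge0.
have n2 x : 0 <= nc (g x - T l x) `^ p by exact: powR_ge0.
have n3 x : 0 <= A `^ (1 - p) * nc (g x - T l x) `^ p by rewrite mulr_ge0 ?powR_ge0.
rewrite nperD//; last 2 first.
- by move=> x; rewrite mulr_ge0.
- by move=> x; rewrite addr_ge0.
rewrite (nperD m2 m4 n1 n3) (nperZ m1 n0 (ler0n _ 2)) (nperZ m3 n2 (powR_ge0 A (1 - p))).
have -> : eps%:E = (2%:E * (eps / 4)%:E + ((eps / 4)%:E + (A `^ (1 - p))%:E * (eps / 4 / A `^ (1 - p))%:E))%E.
  rewrite -!EFinM -!EFinD; congr EFin.
  have : A `^ (1 - p) != 0 by rewrite gt_eqF// powR_gt0.
  by move: (A `^ (1 - p)) => z z0; field.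
apply: leeD.
  by apply: lee_wpmul2l; [rewrite lee_fin|rewrite -Np1E; exact: hP].
apply: leeD; first by rewrite -Np1E.
by rewrite lee_wpmul2l ?lee_fin ?powR_ge0//; apply: Hl0; exact: leq_maxl.
Qed.

(** Induction on [m], one approximant being added per difference. The constant is doubled since
    [T (m + 1) - T m] has order [2^(m+1) n], while the sum carries the weight of [2^m]. *)
Lemma fractional_telescope p alpha : 0 < p -> p <= 1 -> 0 < alpha ->
  exists C : R, 0 < C /\ forall n (T : nat -> R -> R[i]), (0 < n)%N ->
  (forall j : nat, trigpoly (2 ^ j * n) (T j)) ->
  forall m, exists Q, trigpoly n Q /\
  (Np p (fun x => tp (2 ^ m * n) (fun k => iw alpha k * fourier_coef (T m) k) x - Q x)%R
    <= (C * n%:R `^ (- (alpha * p)) * \sum_(j < m) (2 ^+ j) `^ (1 - p) *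
       fine (Np p (fun x => T j.+1 x - T j x)%R))%:E)%E.
Proof.
move=> p0 p1 alpha0.
have [C [C0 HC]] := fractional_integral_approx p0 p1 alpha0.
exists (C * 2); split; first by rewrite mulr_gt0.
move=> n T n0 tT; elim => [|m [Q [tQ HQ]]].
  (* The fractional integral of [T 0] already has order [n] and is its own approximant. *)
  exists (tp (2 ^ 0 * n) (fun k => iw alpha k * fourier_coef (T 0%N) k)); split.
    by rewrite -{1}[n]mul1n; exact: trigpoly_tp.
  set V := tp _ _; have -> : (fun x => V x - V x) = fun=> 0.
    by apply/funext => x; rewrite subrr.
  by rewrite Np0 ?big_ord0 ?mulr0.
have le1 : (2 ^ m * n <= 2 ^ m.+1 * n)%N by rewrite leq_mul2r leq_exp2l// leqnSn orbT.
have tD : trigpoly (2 ^ m.+1 * n) (fun x => T m.+1 x - T m x).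
  by apply: trigpolyB => //; exact: trigpoly_widen (tT m).
have [Q' [tQ' HQ']] := HC n m.+1 _ n0 tD.
exists (fun x => Q' x + Q x); split; first exact: trigpolyD.
have -> : (fun x => tp (2 ^ m.+1 * n) (fun k => iw alpha k * fourier_coef (T m.+1) k) x - (Q' x + Q x)) =
  fun x => (tp (2 ^ m.+1 * n) (fun k => iw alpha k * fourier_coef (fun x => T m.+1 x - T m x) k) x - Q' x) +
   (tp (2 ^ m * n) (fun k => iw alpha k * fourier_coef (T m) k) x - Q x).
  apply/funext => x; rewrite opprD addrACA; congr (_ + _).
  rewrite /tp -(@zsum_widen _ _ _ _ le1); last first.
    by move=> k km; rewrite (fourier_coef_trigpoly0 (tT m) km) mulr0 mul0r.
  rewrite -zsumD; apply: eq_zsum => k _; rewrite -mulrDl -mulrDr.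
  by rewrite (fourier_coefB _ (L1_trigpoly (tT m.+1)) (L1_trigpoly (tT m))) subrK.
apply: le_trans (NpD p0 p1 _ _) _.
- exact: (cmeasurableB (cmeasurable_trigpoly (trigpoly_tp _ _)) (cmeasurable_trigpoly tQ')).
- exact: (cmeasurableB (cmeasurable_trigpoly (trigpoly_tp _ _)) (cmeasurable_trigpoly tQ)).
rewrite big_ord_recr /= mulrDr EFinD addeC; apply: leeD => //.
apply: le_trans HQ' _; rewrite -(fineK (Np_trigpoly_fin p0 tD)) -EFinM lee_fin.
rewrite mulrA ler_wpM2r ?fine_ge0 ?Np_ge0//.
rewrite exprS powRM ?exprn_ge0// -!mulrA ler_wpM2l ?(ltW C0)//.
rewrite [leLHS]mulrCA ler_wpM2r ?mulr_ge0 ?powR_ge0//.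
rewrite ler1_powR ?ler1n//; lra.
Qed.

Theorem fractional_core p alpha : 0 < p -> p < 1 -> 0 < alpha ->
  exists C : R, 0 < C /\ forall n f g (T : nat -> R -> R[i]) (S : R), (0 < n)%N ->
  L1 f -> L1 g ->
  (forall k, k != 0 -> fourier_coef f k = ikinv alpha k * fourier_coef g k) ->
  (forall j : nat, trigpoly (2 ^ j * n) (T j)) ->
  (forall eps, 0 < eps -> exists l0, forall l, (l0 <= l)%N ->
    (Np p (fun x => g x - T l x)%R <= eps%:E)%E) ->
  (forall m, \sum_(j < m) (2 ^+ j) `^ (1 - p) *
     fine (Np p (fun x => T j.+1 x - T j x)) <= S) ->
  forall eps, 0 < eps -> exists Q, trigpoly n Q /\
    (Np p (fun x => f x - Q x)%R <= (C * n%:R `^ (- (alpha * p)) * S + eps)%:E)%E.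
Proof.
move=> p0 p1 alpha0.
have [C [C0 HC]] := fractional_telescope p0 (ltW p1) alpha0.
exists C; split => // n f g T S n0 lf lg Hfg tT cvT sumT eps e0.
(* [C'] depends on [n], but [eta] is chosen after it, so the final constant does not. *)
have [C' [C'0 HC']] := fractional_L1_approx alpha0 n0.
have [mf _] := lf.
have pp := pi_gt0 R.
(* Half of [eps] pays for the region where the remainder is below [d]; [eta] is then chosen so that
   its L_1 bound, weighted by [d^(p-1)], costs the other half. *)
pose d : R := (eps / 2 / (2 * pi)) `^ p^-1.
have d0 : 0 < d by rewrite powR_gt0// !divr_gt0// mulr_gt0.
have dp : d `^ p * (2 * pi) = eps / 2.
  rewrite /d -powRrM mulVf ?gt_eqF// powRr1 ?divfK// ?gt_eqF ?mulr_gt0//.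
  by rewrite !divr_ge0 ?ltW// mulr_gt0.
pose eta := eps / 2 / d `^ (p - 1) / (C' + 1).
have dp0 : 0 < d `^ (p - 1) by rewrite powR_gt0.
have eta0 : 0 < eta by rewrite !divr_gt0// addr_gt0.
have [m Hm] := L1_limit p0 p1 lg tT cvT sumT eta0.
have [Q1 [tQ1 HQ1]] := HC n T n0 tT m.
set Sm := tp _ _ in HQ1.
have tSm : trigpoly (2 ^ m * n) Sm by exact: trigpoly_tp.
have lSm := L1_trigpoly tSm.
have lTm := L1_trigpoly (tT m).
have [] := HC' (fun x => f x - Sm x) (fun x => g x - T m x) (L1B lf lSm) (L1B lg lTm) _ _ eta0.
  move=> k k0; rewrite !fourier_coefB// (Hfg k k0) mulrBr; congr (_ - _).
  rewrite /Sm fourier_coef_tp; case: leqP => km.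
    by rewrite /iw (negbTE k0).
  by rewrite (fourier_coef_trigpoly0 (tT m) km) mulr0.
move=> Q2 [tQ2 HQ2].
exists (fun x => Q1 x + Q2 x); split; first exact: trigpolyD.
have -> : (fun x => f x - (Q1 x + Q2 x)) =
    fun x => (Sm x - Q1 x) + (f x - Sm x - Q2 x).
  by apply/funext => x; ring.
have mSm := cmeasurable_trigpoly tSm.
have mQ1 := cmeasurable_trigpoly tQ1; have mQ2 := cmeasurable_trigpoly tQ2.
apply: le_trans (NpD p0 (ltW p1) _ _) _.
- exact: cmeasurableB.
- exact: (cmeasurableB (cmeasurableB mf mSm) mQ2).
rewrite EFinD; apply: leeD.
  apply: le_trans HQ1 _; rewrite lee_fin ler_wpM2l//.
  by rewrite mulr_ge0 ?powR_ge0 ?ltW.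
apply: le_trans (Np_le_Np1 p0 (ltW p1) d0 _) _.
  exact: (cmeasurableB (cmeasurableB mf mSm) mQ2).
rewrite dp [in leRHS](splitr eps) EFinD; apply: leeD => //.
apply: (@le_trans _ _ ((d `^ (p - 1))%:E * (C'%:E * eta%:E + eta%:E))%E).
  rewrite lee_wpmul2l ?lee_fin ?(ltW dp0)//; apply: le_trans HQ2 _.
  by rewrite leeD// lee_wpmul2l// lee_fin ltW.
rewrite -(EFinM C') -EFinD -EFinM lee_fin le_eqVlt; apply/orP; left; apply/eqP.
rewrite /eta; move: (d `^ (p - 1)) dp0 => z z0; field.
by rewrite !gt_eqF// addr_gt0.
Qed.

End limit_argument.

(** * Best approximation *)

Section best_approximation.
Context {R : realType}.
Implicit Types (f g : R -> R[i]) (p alpha eps : R) (n N m : nat).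

Lemma Lp_normE p f : Lp_norm p f = ((((2 * pi)^-1)%:E * Np p f) `^ p^-1)%E.
Proof. by []. Qed.

Lemma in_L1 f : in_Lp 1 f -> L1 f.
Proof.
move=> [_ mf]; rewrite Lp_normE invr1 poweRe1; last first.
  by rewrite mule_ge0 ?Np_ge0// lee_fin invr_ge0 ltW// twopi_gt0.
move=> h; split; first exact: mf.
move: h; case: (Np 1 f) (Np_ge0 1 f) => [r _ _| |]//.
  by rewrite ltry.
by rewrite gt0_muley ?ltxx// lte_fin invr_gt0 twopi_gt0.
Qed.

Lemma best_approx_ge0 n p f : (0 <= best_approx n p f)%E.
Proof. by apply: le_ereal_inf_tmp => _ [T _ <-]; exact: poweR_ge0. Qed.

Lemma best_approx_antitone n m p f : (n <= m)%N ->
  (best_approx m p f <= best_approx n p f)%E.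
Proof.
move=> nm; apply: ereal_inf_le_tmp => _ [T tT <-].
by exists T => //; exact: trigpoly_widen tT.
Qed.

Lemma best_approx_le n p f Q (x : R) : 0 < p -> trigpoly n Q ->
  (Np p (fun x => f x - Q x)%R <= x%:E)%E ->
  (best_approx n p f <= (((2 * pi)^-1 * x) `^ p^-1)%:E)%E.
Proof.
move=> p0 tQ hQ.
apply: (@le_trans _ _ (Lp_norm p (fun x => f x - Q x))).
  by apply: ereal_inf_lbound; exists Q.
have N0 := Np_ge0 p (fun x => f x - Q x).
rewrite Lp_normE -(fineK (_ : Np p (fun x => f x - Q x) \is a fin_num)); last first.
  by rewrite ge0_fin_numE// (le_lt_trans hQ)// ltry.
have i0 : 0 <= (2 * pi)^-1 :> R by rewrite invr_ge0 ltW// twopi_gt0.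
have f0 : 0 <= fine (Np p (fun x => f x - Q x)) by exact: fine_ge0.
have fx : fine (Np p (fun x => f x - Q x)) <= x.
  by rewrite -lee_fin fineK// ge0_fin_numE// (le_lt_trans hQ)// ltry.
rewrite -EFinM poweR_EFin lee_fin ge0_ler_powR ?nnegrE ?invr_ge0 ?(ltW p0)//.
- exact: mulr_ge0.
- exact: (mulr_ge0 i0 (le_trans f0 fx)).
- exact: (ler_wpM2l i0 fx).
Qed.

Lemma best_approx_fin n p f : 0 < p -> p <= 1 -> L1 f ->
  best_approx n p f \is a fin_num.
Proof.
move=> p0 p1 lf; rewrite ge0_fin_numE ?best_approx_ge0//.
have [mf f1] := lf.
have fE : Np 1 f = (fine (Np 1 f))%:E by rewrite fineK// ge0_fin_numE ?Np_ge0.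
have := Np_le_Np1 p0 p1 ltr01 mf; rewrite fE -EFinM -EFinD => h.
apply: le_lt_trans (best_approx_le p0 (trigpoly0 n) _) (ltry _).
have -> : (fun x => f x - 0) = f by apply/funext => x; rewrite subr0.
exact: h.
Qed.

(** The infimum need not be known to be attained. The slack is put on the p-th power, the scale on
    which errors will be added. *)
Lemma best_approx_near n p f eps : 0 < p -> best_approx n p f \is a fin_num ->
  0 < eps -> exists T, trigpoly n T /\
  (Np p (fun x => f x - T x)%R <=
     (2 * pi * (fine (best_approx n p f) `^ p + eps))%:E)%E.
Proof.
move=> p0 fe eps0; set e := fine _.
have e0 : 0 <= e by rewrite fine_ge0 ?best_approx_ge0.
have pi0 := @twopi_gt0 R.
set t := e `^ p + eps.
have t0 : 0 < t by rewrite ltr_wpDl ?powR_ge0.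
have et : e < t `^ p^-1.
  rewrite -[ltLHS]powRr1// -(@mulfV _ p) ?gt_eqF// powRrM.
  by rewrite gt0_ltr_powR ?nnegrE ?invr_gt0 ?powR_ge0 ?(ltW t0)// ltrDl.
have d0 : 0 < t `^ p^-1 - e by rewrite subr_gt0.
have [_ [T tT <-]] := lb_ereal_inf_adherent d0 fe.
rewrite -/(best_approx n p f) -(fineK fe) -/e -EFinD addrC subrK Lp_normE => h.
exists T; split; first exact: tT.
move: h; case: (Np p _) (Np_ge0 p (fun x => f x - T x)) => [r| |]//; last first.
  move=> _; rewrite gt0_muley ?lte_fin ?invr_gt0//.
  by rewrite poweRyr ?invr_eq0 ?(gt_eqF p0).
rewrite lee_fin => r0; rewrite -EFinM poweR_EFin lte_fin lee_fin => h.
rewrite -ler_pdivrMl// leNgt; apply/negP => h'; move: h; apply/negP; rewrite -leNgt.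
rewrite ge0_ler_powR ?nnegrE ?invr_ge0 ?(ltW p0) ?(ltW t0) ?(ltW h')//.
by rewrite mulr_ge0// invr_ge0 ltW.
Qed.

End best_approximation.

(** * Dyadic condensation and elementary sums *)

Section dyadic_sums.
Context {R : realType}.
Implicit Types (b : nat -> R) (p q : R) (n m : nat).

Lemma powR_exprn (x s : R) m : 0 <= x -> (x `^ s) ^+ m = (x ^+ m) `^ s.
Proof.
move=> x0; elim: m => [|m IH]; first by rewrite !expr0 powR1.
by rewrite !exprS IH powRM ?exprn_ge0.
Qed.

Lemma powRVK p (x : R) : 0 < p -> 0 <= x -> (x `^ p^-1) `^ p = x.
Proof. by move=> p0 x0; rewrite -powRrM mulVf ?gt_eqF// powRr1. Qed.

Lemma powRKV p (x : R) : 0 < p -> 0 <= x -> (x `^ p) `^ p^-1 = x.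
Proof. by move=> p0 x0; rewrite -powRrM mulfV ?gt_eqF// powRr1. Qed.

(** Put [L = 2^m n]. The block of the [L] indices from [L + 1] to [2L] has terms at least
    [b (2L) / (2L)^p], and [2 n^(p-1) L (2L)^(-p)] is exactly [(2^(m+1))^(1-p)]; this fixes the
    factor 2. The term [j = 0] has no block and stays apart as [b n]. *)
Lemma dyadic_sum_le p b n m : 0 < p -> p < 1 -> (0 < n)%N ->
  (forall i, 0 <= b i) -> (forall i j : nat, (i <= j)%N -> b j <= b i) ->
  \sum_(j < m.+1) (2 ^+ j) `^ (1 - p) * b (2 ^ j * n)%N <=
  b n + 2 * ((n%:R `^ (1 - p))^-1 *
    \sum_(n.+1 <= i < (2 ^ m * n).+1) b i * (i%:R `^ p)^-1).
Proof.
move=> p0 p1 n0 b0 bi; elim: m => [|m IH].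
  rewrite big_ord1 expr0 powR1 mul1r mul1n lerDl mulr_ge0// mulr_ge0 ?invr_ge0 ?powR_ge0//.
  by apply: sumr_ge0 => i _; rewrite mulr_ge0 ?invr_ge0 ?powR_ge0.
rewrite big_ord_recr/=; set L := (2 ^ m * n)%N in IH *.
have L2 : (2 ^ m.+1 * n = L + L)%N by rewrite /L expnS -mulnA mul2n addnn.
have nL : (n <= L)%N by rewrite /L leq_pmull// expn_gt0.
rewrite (@big_cat_nat _ _ _ L.+1)//=; last by rewrite L2; lia.
rewrite mulrDr mulrDr addrA; apply: lerD; first exact: IH.
have nR : 0 < n%:R :> R by rewrite ltr0n.
have L0 : (0 < L)%N by lia.
apply: (@le_trans _ _ (2 * ((n%:R `^ (1 - p))^-1 *
    \sum_(L.+1 <= i < (2 ^ m.+1 * n).+1) b (2 ^ m.+1 * n)%N * ((2 ^ m.+1 * n)%:R `^ p)^-1))); last first.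
  rewrite ler_wpM2l// ler_wpM2l ?invr_ge0 ?powR_ge0//.
  apply: ler_sum_nat => i /andP[Li iL].
  have i0 : 0 < i%:R :> R by rewrite ltr0n; lia.
  apply: ler_pM; rewrite ?invr_ge0 ?powR_ge0 ?b0 ?bi//.
  rewrite lef_pV2 ?posrE ?powR_gt0//; last by rewrite ltr0n L2; lia.
  by rewrite ge0_ler_powR ?nnegrE ?ler0n ?(ltW p0)// ler_nat -ltnS.
rewrite sumr_const_nat L2 subSS addnK -[_ *+ L]mulr_natl -L2.
have -> : L%:R = 2 ^+ m * n%:R :> R by rewrite /L natrM natrX.
have -> : (2 ^ m.+1 * n)%:R = 2 ^+ m.+1 * n%:R :> R by rewrite natrM natrX.
set c := b _; have c0 : 0 <= c by exact: b0.
have x0 : 0 < 2 ^+ m.+1 :> R by rewrite exprn_gt0.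
rewrite (powRM _ (ltW x0) (ltW nR)) !powRB ?gt_eqF ?implybT//.
rewrite powRr1 ?(ltW x0)// powRr1 ?(ltW nR)// exprS.
have a0 := powR_gt0 p nR; have y0 := powR_gt0 p x0.
move: a0 y0; rewrite exprS; set a := n%:R `^ p; set y := _ `^ p => a0 y0.
rewrite le_eqVlt; apply/orP; left; apply/eqP; field.
by rewrite !gt_eqF.
Qed.

Lemma geometric_small q (K eps : R) : 0 <= q -> q < 1 -> 0 <= K -> 0 < eps ->
  exists l0, forall l, (l0 <= l)%N -> K * q ^+ l <= eps.
Proof.
move=> q0 q1 K0 e0.
have nq : `|q| < 1 by rewrite ger0_norm.
have K1 : 0 < K + 1 by rewrite ltr_wpDl.
have /cvgr0_norm_lt/(_ _ (divr_gt0 e0 K1)) [l0 _ Hl] := cvg_expr nq.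
exists l0 => l /Hl /=; rewrite ger0_norm ?exprn_ge0// ltr_pdivlMr// => h.
have := exprn_ge0 l q0; nra.
Qed.

Lemma sum_half_le m : \sum_(j < m) 2^-1 ^+ j <= 2 :> R.
Proof.
have -> : \sum_(j < m) 2^-1 ^+ j = 2 - 2 * 2^-1 ^+ m :> R.
  elim: m => [|m IH]; first by rewrite big_ord0 expr0 mulr1 subrr.
  by rewrite big_ord_recr/= IH exprS; field.
by rewrite lerBlDr lerDl mulr_ge0// exprn_ge0// invr_ge0.
Qed.

End dyadic_sums.

Theorem theorem2p1 (R : realType) (p alpha : R)
    (hp0 : 0 < p) (hp1 : p < 1) (halpha : 0 < alpha) :
  exists C : R, 0 < C /\
    forall f g : R -> R[i],
      in_Lp 1 f -> weyl_derivative alpha f g ->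
      forall n : nat, (0 < n)%N ->
        (best_approx n p f <=
          (C / n%:R `^ alpha)%:E *
          (best_approx n p g +
           (((n%:R `^ (1 - p))^-1)%:E *
            \sum_(n.+1 <= nu <oo)
              (best_approx nu p g `^ p * ((nu%:R `^ p)^-1)%:E)) `^ p^-1))%E.
Proof.
have [C [C0 HC]] := fractional_core hp0 hp1 halpha.
(* 6 is 2 for the two errors in each [T (j + 1) - T j], times 3 from [X <= 3 * M^p]. *)
exists ((6 * C) `^ p^-1); split; first by rewrite powR_gt0// mulr_gt0.
move=> f g Lf [Lg fgE] n n0.
have lf := in_L1 Lf; have lg := in_L1 Lg.
have hfg k : k != 0 -> fourier_coef f k = ikinv alpha k * fourier_coef g k.
  by move=> k0; rewrite fgE (negbTE k0) mulrA ikinvK// mul1r.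
have nR : 0 < n%:R :> R by rewrite ltr0n.
have gfin nu : best_approx nu p g \is a fin_num by exact: best_approx_fin (ltW hp1) lg.
pose e nu := fine (best_approx nu p g).
have eE nu : best_approx nu p g = (e nu)%:E by rewrite fineK.
have e0 nu : 0 <= e nu by rewrite fine_ge0 ?best_approx_ge0.
pose b nu := e nu `^ p.
have b0 nu : 0 <= b nu by exact: powR_ge0.
have b_anti i j : (i <= j)%N -> b j <= b i.
  move=> ij; rewrite /b ge0_ler_powR ?nnegrE ?(ltW hp0)//.
  by rewrite fine_le//; exact: best_approx_antitone.

have cE : (6 * C) `^ p^-1 / n%:R `^ alpha = (6 * (C * n%:R `^ (- (alpha * p)))) `^ p^-1.
  rewrite mulrA [RHS]powRM ?powR_ge0 ?mulr_ge0 ?(ltW C0)//.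
  by rewrite -powRrM mulNr mulfK ?gt_eqF// powRN.
have c0 : 0 < (6 * C) `^ p^-1 / n%:R `^ alpha.
  by rewrite divr_gt0 ?powR_gt0 ?mulr_gt0.
under eq_eseriesr do rewrite eE poweR_EFin -/(b _) -EFinM.
set s := (\sum_(n.+1 <= nu <oo) _)%E.
have t0 nu : 0 <= b nu * (nu%:R `^ p)^-1 by rewrite mulr_ge0 ?invr_ge0 ?powR_ge0.
have s0 : (0 <= s)%E by apply: nneseries_ge0 => nu _ _; rewrite lee_fin.
have part N : ((\sum_(n.+1 <= nu < N) b nu * (nu%:R `^ p)^-1)%:E <= s)%E.
  by rewrite -sumEFin; apply: nneseries_lim_ge => nu _ _; rewrite lee_fin.
(* If the series diverges, the right-hand side is infinite. Otherwise its finiteness is what makes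
   the nearly best approximations converge to [g]. *)
have [sy|sy] := eqVneq s +oo%E.
  rewrite sy gt0_muley ?lte_fin ?invr_gt0 ?powR_gt0//.
  by rewrite poweRyr ?invr_eq0 ?(gt_eqF hp0)// eE addey// gt0_muley ?lte_fin// leey.
have sE : s = (fine s)%:E by rewrite fineK// ge0_fin_numE// lt_neqAle sy leey.
rewrite sE in part *; have {}s0 : 0 <= fine s by exact: fine_ge0.
set Y := (n%:R `^ (1 - p))^-1 * fine s.
have Y0 : 0 <= Y by rewrite mulr_ge0 ?invr_ge0 ?powR_ge0.
rewrite -EFinM poweR_EFin -/Y eE -EFinD -EFinM.
set M := e n + Y `^ p^-1.
have M0 : 0 <= M by rewrite addr_ge0 ?powR_ge0.
pose X := b n + 2 * Y.
have X0 : 0 <= X by rewrite addr_ge0 ?mulr_ge0.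
have XM : X <= 3 * M `^ p.
  have h1 : b n <= M `^ p.
    by rewrite ge0_ler_powR ?nnegrE ?(ltW hp0) ?lerDl ?powR_ge0.
  have h2 : Y <= M `^ p.
    rewrite -[leLHS](powRVK hp0 Y0).
    by rewrite ge0_ler_powR ?nnegrE ?(ltW hp0) ?powR_ge0// lerDr.
  by rewrite /X; lra.
(* Each term of the dyadic sum is at most [X], so [b (2^l n) <= X * q^l], and [q < 1] because
   [p < 1]. *)
pose q : R := (2 `^ (1 - p))^-1.
have q2 : 1 <= 2 `^ (1 - p) :> R.
  by rewrite -[leLHS](powRr0 2) ler_powR ?ler1n// subr_ge0 ltW.
have q2' : 2 `^ (1 - p) <= 2 :> R.
  by rewrite -[leRHS]powRr1// ler_powR ?ler1n// gerBl ltW.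
have dy m : \sum_(j < m) (2 ^+ j) `^ (1 - p) * b (2 ^ j * n)%N <= X.
  apply: (@le_trans _ _ (\sum_(j < m.+1) (2 ^+ j) `^ (1 - p) * b (2 ^ j * n)%N)).
    by rewrite big_ord_recr/= lerDl mulr_ge0 ?powR_ge0.
  apply: le_trans (dyadic_sum_le m hp0 hp1 n0 b0 b_anti) _.
  rewrite lerD2l ler_wpM2l// ler_wpM2l ?invr_ge0 ?powR_ge0//.
  by rewrite -lee_fin.
have pp := @twopi_gt0 R.
have key eta : 0 < eta ->
  (best_approx n p f <= ((2 * (C * n%:R `^ (- (alpha * p))) * (X + 2 * eta) + eta) `^ p^-1)%:E)%E.
  move=> eta0.
  (* The ratio 1/4 beats the weight [(2^j)^(1-p) <= 2^j], so the weighted slacks sum to at most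
     [2 * eta]. *)
  have ek j : 0 < eta * 4^-1 ^+ j :> R by rewrite mulr_gt0 ?exprn_gt0.
  have /choice[T HT] j := best_approx_near hp0 (gfin (2 ^ j * n)%N) (ek j).
  have tT j : trigpoly (2 ^ j * n) (T j) by case: (HT j).
  have nT j : (Np p (fun x => g x - T j x)%R <=
      (2 * pi * (b (2 ^ j * n)%N + eta * 4^-1 ^+ j))%:E)%E by case: (HT j).
  have mT j := cmeasurable_trigpoly (tT j).
  have [mg _] := lg.
  have ndT j : fine (Np p (fun x => T j.+1 x - T j x)) <=
      2 * (2 * pi) * (b (2 ^ j * n)%N + eta * 4^-1 ^+ j).
    have tD : trigpoly (2 ^ j.+1 * n) (fun x => T j.+1 x - T j x).
      apply: trigpolyB => //; apply: trigpoly_widen (tT j).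
      by rewrite leq_mul2r leq_exp2l// leqnSn orbT.
    rewrite -lee_fin (fineK (Np_trigpoly_fin hp0 tD)).
    have -> : (fun x => T j.+1 x - T j x) =
        fun x => (g x - T j x) - (g x - T j.+1 x).
      by apply/funext => x; ring.
    apply: le_trans (NpB hp0 (ltW hp1) (cmeasurableB mg (mT j)) (cmeasurableB mg (mT j.+1))) _.
    apply: le_trans (leeD (nT j) (nT j.+1)) _; rewrite -EFinD lee_fin.
    rewrite -mulrDr -mulrA mulrCA ler_wpM2l ?(ltW pp)// mulr2n mulrDl mul1r lerD2l.
    apply: lerD; first by apply: b_anti; rewrite leq_mul2r leq_exp2l// leqnSn orbT.
    by rewrite ler_wpM2l ?(ltW eta0)// exprS ler_piMl ?exprn_ge0 ?invr_ge0// invf_le1 ?ler1n.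
  have cvT eps : 0 < eps -> exists l0, forall l, (l0 <= l)%N ->
      (Np p (fun x => g x - T l x)%R <= eps%:E)%E.
    move=> eps0.
    have q0 : 0 <= q by rewrite invr_ge0 powR_ge0.
    have q1 : q < 1.
      rewrite invf_lt1 ?powR_gt0//.
      have : 1 `^ (1 - p) < 2 `^ (1 - p) :> R.
        by rewrite gt0_ltr_powR ?nnegrE ?subr_gt0 ?ltr1n.
      by rewrite powR1.
    have K0 : 0 <= 2 * pi * (X + eta) := mulr_ge0 (ltW pp) (addr_ge0 X0 (ltW eta0)).
    have [l0 Hl0] := geometric_small q0 q1 K0 eps0.
    exists l0 => l /Hl0 hl; apply: (le_trans (nT l)).
    rewrite lee_fin; apply: (le_trans _ hl).
    rewrite -[leRHS]mulrA ler_wpM2l ?(ltW pp)// mulrDl; apply: lerD.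
      rewrite exprVn ler_pdivlMr ?exprn_gt0 ?powR_gt0// mulrC.
      apply: le_trans (dy l.+1); rewrite big_ord_recr/=.
      have -> : (2 `^ (1 - p)) ^+ l = (2 ^+ l) `^ (1 - p) :> R.
        by rewrite powR_exprn.
      by rewrite lerDr; apply: sumr_ge0 => i _; rewrite mulr_ge0 ?powR_ge0.
    rewrite ler_wpM2l ?(ltW eta0)// lerXn2r ?nnegrE ?invr_ge0//.
    by rewrite lef_pV2 ?posrE ?powR_gt0//; lra.
  have sT m : \sum_(j < m) (2 ^+ j) `^ (1 - p) *
      fine (Np p (fun x => T j.+1 x - T j x)) <= 2 * (2 * pi) * (X + 2 * eta).
    apply: (@le_trans _ _ (\sum_(j < m) (2 * (2 * pi) * ((2 ^+ j) `^ (1 - p) * b (2 ^ j * n)%N)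
        + 2 * (2 * pi) * (eta * 2^-1 ^+ j)))).
      apply: ler_sum => j _.
      apply: le_trans (ler_wpM2l (powR_ge0 _ _) (ndT j)) _.
      rewrite mulrCA -mulrDr; apply: ler_wpM2l; first by rewrite mulr_ge0// ltW.
      rewrite mulrDr lerD2l mulrCA ler_wpM2l ?(ltW eta0)//.
      have -> : 4^-1 = 2^-1 * 2^-1 :> R by field.
      rewrite exprMn mulrA ler_piMl ?exprn_ge0 ?invr_ge0//.
      rewrite exprVn ler_pdivrMr ?exprn_gt0// mul1r.
      rewrite -[leRHS]powRr1 ?exprn_ge0// ler_powR ?exprn_ege1 ?ler1n//.
      by rewrite gerBl ltW.
    rewrite big_split/= -!mulr_sumr -mulrDr; apply: ler_wpM2l.
      by rewrite mulr_ge0// ltW.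
    apply: lerD; first exact: dy.
    by rewrite [leRHS]mulrC ler_wpM2l ?(ltW eta0)// sum_half_le.
  (* The factor [2 * pi] here and in [sT] cancels against the normalisation of [Lp_norm]. *)
  have [Q [tQ HQ]] := HC n f g T _ n0 lf lg hfg tT cvT sT (2 * pi * eta) (mulr_gt0 pp eta0).
  apply: le_trans (best_approx_le hp0 tQ HQ) _.
  rewrite lee_fin le_eqVlt; apply/orP; left; apply/eqP; congr (_ `^ _).
  move: (n%:R `^ _) pp => z; move: (pi : R) => w w0; field.
  by move: w0; rewrite pmulr_rgt0// => w0; rewrite gt_eqF.
have ffin := best_approx_fin n hp0 (ltW hp1) lf.
set D := C * n%:R `^ (- (alpha * p)) in cE key.
have D0 : 0 <= D by rewrite mulr_ge0 ?powR_ge0 ?(ltW C0).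
have fE : best_approx n p f = (fine (best_approx n p f))%:E by rewrite fineK.
set F := fine (best_approx n p f) in fE.
have F0 : 0 <= F by rewrite fine_ge0 ?best_approx_ge0.
have FX : F `^ p <= 2 * D * X.
  (* The slack enters as [2 D * 2 eta + eta = (4 D + 1) eta], which dictates the choice of [eta]. *)
  apply/ler_addgt0Pr => eps eps0.
  have K0 : 0 < 4 * D + 1 by rewrite ltr_wpDl// mulr_ge0.
  have eta0 : 0 < eps / (4 * D + 1) by exact: divr_gt0.
  have B0 : 0 <= 2 * D * (X + 2 * (eps / (4 * D + 1))) + eps / (4 * D + 1).
    have eta1 := ltW eta0; apply: addr_ge0; last exact: eta1.
    apply: (mulr_ge0 (mulr_ge0 (ler0n _ 2) D0)).
    exact: (addr_ge0 X0 (mulr_ge0 (ler0n _ 2) eta1)).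
  have := key _ eta0; rewrite fE lee_fin => h.
  have {h} : F `^ p <= 2 * D * (X + 2 * (eps / (4 * D + 1))) + eps / (4 * D + 1).
    rewrite -[leRHS](powRVK hp0 B0).
    by rewrite ge0_ler_powR ?nnegrE ?(ltW hp0) ?powR_ge0.
  move=> h; apply: le_trans h _; rewrite le_eqVlt; apply/orP; left; apply/eqP.
  by field; rewrite gt_eqF.
rewrite fE lee_fin cE.
rewrite -[leLHS](powRKV hp0 F0) -(powRKV hp0 M0) -powRM ?mulr_ge0 ?powR_ge0 ?(ltW C0)//.
rewrite ge0_ler_powR ?nnegrE ?invr_ge0 ?(ltW hp0) ?mulr_ge0 ?powR_ge0 ?(ltW C0)//.
by apply: le_trans FX _; have := ler_wpM2l D0 XM; lra.
Qed.
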